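(* In the setting fixed in the context (in particular with $\rho>0$ and the unbounded sector $S_d$ with bisecting direction $d\in\mathbb{R}$ chosen according to the geometric configuration described there), there exist $\varpi_c>0$ and $\varpi_f>0$ such that, if $$C_{\underline{\ell}}\le \varpi_c\quad(\underline{\ell}\in\mathcal{A}),\qquad C_j\le\varpi_f\quad (j\in J),$$ then the problem $$Q(\partial_z)u(t,z)=\exp_q\left(\alpha_Dt^{d_{D}}\sigma_{q;t}^{\frac{d_D}{k}}\right)R_D(\partial_z)u(t,z)+\sum_{\underline{\ell}=(\ell_0,\ell_1,\ell_2)\in\mathcal{A}}a_{\underline{\ell}}(z)\left(t^{\ell_0}\sigma_{q;t}^{\ell_1}R_{\underline{\ell}}(\partial_z)u\right)(t^{\ell_2},z)+f(t,z)$$ with null initial data $u(0,z)\equiv 0$ admits a formal solution $\hat{u}(t,z)=\sum_{p\ge1}u_p(z)t^p$ with coefficients $u_p\in\mathcal{O}_b(H_{\beta'})$, for any fixed $0<\beta'<\beta$, and $\hat u$ is $G_q$-summable of order $k$ with respect to $t$ in direction $d$ (as a formal power series in $t$ with coefficients in the Banach space $\mathcal{O}_b(H_{\beta'})$).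
   Context: **Notation.** $\mathbb{N}=\{1,2,\ldots\}$; $D(0,r)$ is the open disc. Fix $q>1$, an integer $k\ge1$, $\beta>0$, $\mu>1$. For $\gamma\in\mathbb{R}$, $\sigma_{q;t}^{\gamma}g(t)=g(q^{\gamma}t)$. $H_{\beta}=\{z\in\mathbb{C}:|\mathrm{Im}(z)|<\beta\}$. $\mathcal{O}_b(H)$ is the Banach space of bounded holomorphic functions on $H$ with the sup norm. $\exp_q(x)=\sum_{n\ge0}x^n/[n]_q^!$ with $[0]_q^!=1$, $[n]_q^!=\prod_{j=1}^n(1+q+\cdots+q^{j-1})$; it is entire. The formal operator is $\exp_q(\alpha_Dt^{d_D}\sigma_{q;t}^{d_D/k})=\sum_{n\ge0}\frac{\alpha_D^n}{[n]_q^!}(t^{d_D}\sigma_{q;t}^{d_D/k})^{(n)}$, where $^{(n)}$ is the $n$-th iterate. The expression $(t^{\ell_0}\sigma_{q;t}^{\ell_1}v)(t^{\ell_2},z)$ means $g(t^{\ell_2},z)$ where $g(t,z)=t^{\ell_0}v(q^{\ell_1}t,z)$. **Equation data.** $\mathcal{A}\subseteq\mathbb{N}^3$ is a finite set with $\ell_1\le \ell_0/k-1$ for all $\underline{\ell}=(\ell_0,\ell_1,\ell_2)\in\mathcal{A}$. $\alpha_D>0$, and $d_D\ge1$ is an integer with $d_D>\left(\frac{k}{\ell_2^2-1}\right)^{1/2}$ for all $\underline{\ell}\in\mathcal{A}$ with $\ell_2\ge2$. $Q,R_D,R_{\underline{\ell}}\in\mathbb{C}[X]$ satisfy $Q(im)\ne0$,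 $R_D(im)\neq0$ for $m\in\mathbb{R}$, $\deg R_{\underline{\ell}}\le\deg R_D=\deg Q$, and there are $0<r_{Q,R_D,1}<r_{Q,R_D,2}$ with $r_{Q,R_D,1}\le|Q(im)/R_D(im)|\le r_{Q,R_D,2}$ for all $m\in\mathbb{R}$. For $\underline{\ell}\in\mathcal{A}$, $A_{\underline{\ell}}:\mathbb{R}\to\mathbb{C}$ is continuous with $|A_{\underline{\ell}}(m)|\le C_{\underline{\ell}}(1+|m|)^{-\mu}e^{-\beta|m|}$, and $a_{\underline{\ell}}(z)=\frac{1}{(2\pi)^{1/2}}\int_{-\infty}^{\infty}A_{\underline{\ell}}(m)e^{izm}dm$, $z\in H_\beta$. $J\subseteq\mathbb{N}$ is finite; for $j\in J$, $\mathcal{F}_j:\mathbb{R}\to\mathbb{C}$ is continuous with $|\mathcal{F}_j(m)|\le C_j(1+|m|)^{-\mu}e^{-\beta|m|}$; and $f(t,z)=\sum_{j\in J}F_j(z)q^{\frac{j(j-1)}{2k}}t^j$ with $F_j(z)=\frac{1}{(2\pi)^{1/2}}\int_{-\infty}^{\infty}\mathcal{F}_j(m)e^{izm}dm$. **Geometric configuration.** Put $\tilde\alpha_D=\alpha_D q^{-\frac{d_D(d_D-1)}{2k}}$ and $\mu_q(x)=\frac{\log^2(x)}{2\log q}+\left(-\frac12+\frac{\log(q-1)}{\log q}\right)\log x$ for $x>0$. Fix $\theta\in(0,\pi/2)$, $\epsilon=\sin\theta$, and an unbounded sector $U$ with vertex $0$ contained in $\{z:|\arg z|<\pi-\theta\}$.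 Let $C_0,K_0,K_1>0$ be constants (they exist) with $|\exp_q(z)|\ge C_0$ on $\overline{D}(0,\frac{q^{1/2}}{q-1})$ and $\frac{\epsilon}{K_0}e^{\mu_q(|z|)}\le|\exp_q(z)|\le K_1e^{\mu_q(|z|)}$ on $U\setminus D(0,\frac{q^{1/2}}{q-1})$. $S_d$ is an (open) unbounded sector with vertex $0$ and bisecting direction $d$ such that $\tilde\alpha_D\tau^{d_D}\in U$ for $\tau\in S_d$, and $\rho>0$ is such that $\tilde\alpha_D\tau^{d_D}\in D(0,\frac{q^{1/2}}{q-1})$ for $\tau\in D(0,\rho)$. Finally $r_{Q,R_D,2}<\min\{C_0,\frac{\epsilon}{K_0}\min_{x\ge q^{1/2}/(q-1)}e^{\mu_q(x)}\}$. **$G_q$-summability.** Let $\mathbb{E}$ be a complex Banach space. $\hat U(T)=\sum_{n\ge1}a_nT^n\in\mathbb{E}[[T]]$ is $G_q$-summable of order $k$ in direction $d$ if $\sum_{n\ge1}a_nq^{-\frac{n(n-1)}{2k}}\xi^n$ converges on some disc around $0$, and its sum can be analytically continued to a function $W_k$ on some unbounded sector $S_{d,\delta}=\{\xi\in\mathbb{C}^*:|d-\arg\xi|<\delta\}$, $\delta>0$, with constants $K,\alpha>0$, $\Delta>1$ such that $\|W_k(\xi)\|_{\mathbb{E}}\le K|\xi|\exp\left(\frac{k}{2\log q}\log^2(|\xi|+\Delta)+\alpha\log(|\xi|+\Delta)\right)$ for all $\xi\in S_{d,\delta}$. *)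

(* Defs.v *)
From HB Require Import structures.
From mathcomp Require Import all_boot all_order all_algebra finmap.
From mathcomp Require Import complex.
From mathcomp Require Import all_classical all_reals all_analysis.

Set Implicit Arguments.
Unset Strict Implicit.
Unset Printing Implicit Defensive.

Import Order.TTheory GRing.Theory Num.Theory numFieldNormedType.Exports.
Export ComplexField.Normc.

Local Open Scope ring_scope.
Local Open Scope classical_set_scope.
Local Open Scope complex_scope.

(* The complex plane is R[i] for R : realType.  Its topology is the one that every numFieldType receives from its
   norm.  With it, [derivable f z 1] for f : R[i] -> E is complex
   differentiability at z, and [derive1n n f] is the n-th complex derivative. *)
HB.instance Definition _ (R : realType) :=
  NormedModule.copy R[i] (R[i] : numFieldType).

Section complex_analysis.
Context {R : realType}.
Implicit Types (z w : R[i]) (H : set R[i]).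

Definition cexp w : R[i] :=
  (expR (complex.Re w) * cos (complex.Im w)) +i* (expR (complex.Re w) * sin (complex.Im w)).

Definition cintegral (f : R -> R[i]) : R[i] :=
  (\int[lebesgue_measure]_m complex.Re (f m))%R +i* (\int[lebesgue_measure]_m complex.Im (f m))%R.

Definition inv_fourier (A : R -> R[i]) z : R[i] :=
  ((Num.sqrt (2 * pi))^-1)%:C *
  cintegral (fun m => A m * cexp ((0 +i* m) * z)).

Definition exp_decay (beta mu C : R) (A : R -> R[i]) : Prop :=
  forall m : R,
    normc (A m) <= C * (1 + `|m|) `^ (- mu) * expR (- (beta * `|m|)).

Definition strip (beta : R) : set R[i] := [set z | `|complex.Im z| < beta].

Definition sector (d delta : R) : set R[i] :=
  [set z | exists r phi : R,
     [/\ 0 < r, `|phi - d| < delta & z = r%:C * cexp (0 +i* phi)]].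

Definition holomorphic_on (E : normedModType R[i]) H (f : R[i] -> E) : Prop :=
  forall z, H z -> derivable f z 1.

(* P(d/dz) v; meaningful at points near which v is holomorphic *)
Definition diffop (P : {poly R[i]}) (v : R[i] -> R[i]) : R[i] -> R[i] :=
  fun z => \sum_(i < size P) P`_i * derive1n i v z.

End complex_analysis.

Section bounded_holomorphic.
Context {R : realType}.
Implicit Types (H : set R[i]) (f g : R[i] -> R[i]).

(* Functions on an open set H are represented by their extension by 0 to the
   whole plane, so that Leibniz equality is equality on H. *)
Definition bounded_hol H : {pred R[i] -> R[i]} := fun f =>
  `[< [/\ holomorphic_on H f,
          exists M : R, forall z, H z -> normc (f z) <= M &
          forall z, ~ H z -> f z = 0] >].

Lemma bounded_hol_submod_closed H : submod_closed (bounded_hol H).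
Proof.
split.
  apply/asboolP; split => //.
  by exists 0 => z _; have /= -> := normc0 R.
move=> a f g /asboolP[fh [M fM] f0] /asboolP[gh [N gN] g0].
apply/asboolP; split.
- move=> z Hz; apply: derivableD; last exact: gh.
  by apply: derivableZ; exact: fh.
- exists (normc a * M + N) => z Hz.
  apply: (le_trans (le_normcD _ _)); apply: lerD; last exact: gN.
  rewrite normcM ler_wpM2l//; last exact: fM.
  by case: a => x y; rewrite sqrtr_ge0.
- move=> z Hz; rewrite -[LHS]/(a * f z + g z).
  by rewrite f0// g0// mulr0 addr0.
Qed.

HB.instance Definition _ H :=
  GRing.isSubmodClosed.Build R[i] (R[i] -> R[i]) (bounded_hol H)
    (bounded_hol_submod_closed H).

Record Ob H := MkOb { Ob_fun :> R[i] -> R[i]; _ : Ob_fun \in bounded_hol H }.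

HB.instance Definition _ H := [isSub of Ob H for @Ob_fun H].
HB.instance Definition _ H := [Choice of Ob H by <:].
HB.instance Definition _ H := [SubChoice_isSubLmodule of Ob H by <:].

Definition sup_norm H (f : Ob H) : R[i] :=
  (sup [set normc (f z) | z in H])%:C.

Let normc_ge0 (z : R[i]) : 0 <= normc z.
Proof. by case: z => x y; rewrite sqrtr_ge0. Qed.

Let Ob_has_ubound H (f : Ob H) : has_ubound [set normc (f z) | z in H].
Proof.
case: f => f /= /asboolP[_ [M fM] _].
by exists M => _ [z Hz <-]; exact: fM.
Qed.

Let sup_norm_ub H (f : Ob H) z : normc (f z) <= sup [set normc (f z) | z in H].
Proof.
have [Hz|nHz] := pselect (H z).
  by apply: ub_le_sup; [exact: Ob_has_ubound|exists z].
have -> : normc (f z) = 0.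
  by case: f => f /= /asboolP[_ _ f0]; rewrite f0// normc0.
have [[w Hw]|/forallNP H0] := pselect (exists w, H w); last first.
  rewrite (_ : [set _ | _ in _] = set0) ?sup0//.
  by apply/seteqP; split => // x [w /H0].
by apply: (le_trans (normc_ge0 (f w))); apply: ub_le_sup;
  [exact: Ob_has_ubound|exists w].
Qed.

Let sup_norm_le H (f : Ob H) (M : R) : 0 <= M ->
  (forall z, normc (f z) <= M) -> sup [set normc (f z) | z in H] <= M.
Proof.
move=> M0 fM; have [[w Hw]|/forallNP H0] := pselect (exists w, H w); last first.
  rewrite (_ : [set _ | _ in _] = set0) ?sup0//.
  by apply/seteqP; split => // x [w /H0].
by apply: ge_sup; [exists (normc (f w)), w|move=> _ [z _ <-]; exact: fM].
Qed.

Lemma sup_norm_normD H (f g : Ob H) :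
  sup_norm (f + g) <= sup_norm f + sup_norm g.
Proof.
rewrite /sup_norm -rmorphD lecR; apply: sup_norm_le => [|z].
  by rewrite addr_ge0 ?(le_trans (normc_ge0 (_ 0)) (sup_norm_ub _ 0)).
by apply: (le_trans (le_normcD (f z) (g z))); apply: lerD; exact: sup_norm_ub.
Qed.

Lemma sup_normZ H (a : R[i]) (f : Ob H) :
  sup_norm (a *: f) = `|a| * sup_norm f.
Proof.
rewrite /sup_norm (_ : `|a| = (normc a)%:C); last by case: a.
rewrite -rmorphM; congr (_%:C); apply/eqP; rewrite eq_le; apply/andP; split.
  apply: sup_norm_le => [|z].
    by rewrite mulr_ge0// (le_trans (normc_ge0 (f 0)))// sup_norm_ub.
  rewrite (_ : (a *: f) z = a * f z)// normcM ler_wpM2l//.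
have [->|a0] := eqVneq a 0.
  rewrite normc0 mul0r.
  by rewrite (le_trans (normc_ge0 ((0 *: f : Ob H) 0)))// sup_norm_ub.
have na0 : 0 < normc a.
  by rewrite lt_neqAle normc_ge0 andbT eq_sym; apply: contra_neq a0 => /eq0_normc.
rewrite mulrC -ler_pdivlMr//; apply: sup_norm_le => [|z].
  rewrite divr_ge0//.
  by rewrite (le_trans (normc_ge0 ((a *: f : Ob H) 0)))// sup_norm_ub.
by rewrite ler_pdivlMr// mulrC -normcM; exact: (sup_norm_ub (a *: f) z).
Qed.

Lemma sup_norm_eq0 H (f : Ob H) : sup_norm f = 0 -> f = 0.
Proof.
move=> [f0]; apply/val_inj/funext => z; apply/eq0_normc/eqP.
by rewrite eq_le normc_ge0 andbT -f0 sup_norm_ub.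
Qed.

HB.instance Definition _ H :=
  Lmodule_isNormed.Build R[i] (Ob H) (@sup_norm_normD H) (@sup_normZ H)
    (@sup_norm_eq0 H).

End bounded_holomorphic.

Section q_calculus.
Context {R : realType}.
Implicit Types (q : R) (x z w : R[i]).

Definition qfact q (n : nat) : R :=
  \prod_(1 <= j < n.+1) \sum_(i < j) q ^+ i.

Definition exp_q q x : R[i] :=
  limn (series (fun n : nat => ((qfact q n)^-1)%:C * x ^+ n)).

Definition mu_q q (x : R) : R :=
  ln x ^+ 2 / (2 * ln q) + (- 2^-1 + ln (q - 1) / ln q) * ln x.

End q_calculus.

(* A formal power series in t with coefficients in V is the sequence
   nat -> V of its coefficients. *)
Section formal_series.
Context {R : realType} {V : lmodType R[i]}.
Implicit Types (q : R) (g : nat -> V).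

(* t^l g(t) *)
Definition t_mul (l : nat) g : nat -> V :=
  fun p => if (l <= p)%N then g (p - l)%N else 0.

(* g(q^gamma t) *)
Definition q_dilation q (gamma : R) g : nat -> V :=
  fun p => (q `^ (gamma * p%:R))%:C *: g p.

(* g(t^l), for l >= 1 *)
Definition t_subst (l : nat) g : nat -> V :=
  fun p => if (l %| p)%N then g (p %/ l)%N else 0.

(* exp_q(alpha t^d sigma^(d/k)) g.  As d >= 1, the n-th iterate of
   t^d sigma^(d/k) has order at least n in t, hence the coefficient of t^p in
   the infinite sum only receives the terms with n <= p. *)
Definition exp_q_op q (k : nat) (alpha : R) (d : nat) g : nat -> V :=
  fun p => \sum_(n < p.+1)
    (alpha ^+ n / qfact q n)%:C *:
      iter n (fun h => t_mul d (q_dilation q (d%:R / k%:R) h)) g p.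

End formal_series.

Section Gq_summability.
Context {R : realType} {E : normedModType R[i]}.
Implicit Types (q : R) (k : nat) (a : nat -> E) (xi : R[i]).

Definition qBorel_partial_sum q k a xi : nat -> E := fun N =>
  \sum_(1 <= n < N)
    ((q `^ (- ((n * n.-1)%:R / (2 * k%:R))))%:C * xi ^+ n) *: a n.

(* The series under consideration is sum_(n >= 1) a n T^n; a 0 is ignored. *)
Definition Gq_summable q k (d : R) a : Prop :=
  exists2 r : R, 0 < r &
  (forall xi, normc xi < r -> cvgn (qBorel_partial_sum q k a xi)) /\
  exists (delta : R) (W : R[i] -> E), [/\ 0 < delta,
    holomorphic_on (sector d delta) W,
    (forall xi, sector d delta xi -> normc xi < r ->
       W xi = limn (qBorel_partial_sum q k a xi)) &
    exists K alpha Delta : R, [/\ 0 < K, 0 < alpha, 1 < Delta &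
      forall xi, sector d delta xi ->
        `|W xi| <= (K * normc xi *
          expR (k%:R / (2 * ln q) * ln (normc xi + Delta) ^+ 2 +
                alpha * ln (normc xi + Delta)))%:C]].

End Gq_summability.

Section equation.
Context {R : realType}.
Implicit Types (q beta : R) (u : nat -> R[i] -> R[i]).

Definition ell0 (l : nat * nat * nat) : nat := l.1.1.
Definition ell1 (l : nat * nat * nat) : nat := l.1.2.
Definition ell2 (l : nat * nat * nat) : nat := l.2.

(* The coefficients of f(t, z) = sum_(j in J) F_j(z) q^(j(j-1)/(2k)) t^j *)
Definition forcing q (k : nat) (J : {fset nat}) (F : nat -> R[i] -> R[i]) :
    nat -> R[i] -> R[i] :=
  fun p z => if p \in J then F p z * (q `^ ((p * p.-1)%:R / (2 * k%:R)))%:C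
             else 0.

(* sum_p u_p(z) t^p satisfies the equation, coefficient of t^p by coefficient,
   for z in the strip of half-width beta. *)
Definition formal_solution q (k : nat) beta (A : {fset nat * nat * nat})
    (alphaD : R) (dD : nat) (Q RD : {poly R[i]})
    (Rl : nat * nat * nat -> {poly R[i]})
    (a : nat * nat * nat -> R[i] -> R[i])
    (f : nat -> R[i] -> R[i]) u : Prop :=
  forall (p : nat) (z : R[i]), strip beta z ->
    diffop Q (u p) z =
      exp_q_op q k alphaD dD (fun n => diffop RD (u n)) p z
      + \sum_(l <- A) a l z *
          t_subst (ell2 l)
            (t_mul (ell0 l)
              (q_dilation q (ell1 l)%:R (fun n => diffop (Rl l) (u n)))) p z
      + f p z.

End equation.

(* Main.v *)
Require Import Defs.
From mathcomp Require Import all_boot all_order all_algebra finmap.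
From mathcomp Require Import complex.
From mathcomp Require Import all_classical all_reals all_analysis.
From mathcomp Require Import measurable_realfun.
From mathcomp Require Import ring lra.
Import Order.TTheory GRing.Theory Num.Theory numFieldNormedType.Exports.
Set Implicit Arguments.
Unset Strict Implicit.
Unset Printing Implicit Defensive.
Local Open Scope ring_scope.
Local Open Scope classical_set_scope.
Local Open Scope complex_scope.

(* With u_p = q^(p(p-1)/(2k)) inv_fourier(omega_p), the equation becomes in the
   Borel-Fourier plane, for the generating function w(t, m) of the omega_p(m),
     (Q(im)/RD(im) - exp_q(alphaDt t^dD)) w(t, m)
       = sum over l2 = 1 of c_l t^l0 T_l w(lambda_l t, m) + g(t, m),
   where T_l convolves with A_l and 0 < lambda_l <= 1/q because
   l1 <= l0/k - 1.  The terms with l2 >= 2 only involve w through its Taylor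
   coefficients, damped by a Gaussian factor; together with the forcing they
   form the entire function g, and the hypothesis dD > (k/(l2^2-1))^(1/2) says
   that g divided by exp_q(alphaDt t^dD) has q-exponential growth of order k.

   The constant term of exp_q is 1 and r2 < C_0 <= 1, so Q/RD - 1 is bounded
   below and the omega_p are given by a strong recursion; a geometric majorant
   produces w on a disc.  Since |Q/RD| <= r2 stays away from |exp_q| on S_d, the
   equation itself extends w from S_d cap D(0, rho q^n) to
   S_d cap D(0, rho q^(n+1)).  A factor (|t| + 2)^al in the growth bound shrinks
   geometrically in al when t is replaced by lambda_l t, so that for al large the
   constants of the induction are absorbed and the bound is uniform in n. *)

(** Frequencies carry the weight [expw b] with beta' < b < beta. The gap beta - b pays for the
    polynomial growth of the R_l inside the convolutions and makes the T_l bounded; the gap b -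
    beta' makes the inverse Fourier transform bounded from the weighted space into O_b(H_beta'). The
    omega_p are defined pointwise in [m], independently of [b], so one formal solution serves every
    beta'; only its majorants depend on [b].

    Estimates are kept pointwise in [m], as [dominated b C f], and holomorphy is encoded by [wdiff],
    a quadratic Taylor remainder uniform in [m]. This notion passes through sums, products,
    inverses, dilations and the T_l, and the inverse Fourier transform turns it into a quadratic
    remainder in the sup norm, hence into differentiability with values in O_b. Limits in O_b are
    exhibited as transforms of explicit functions.

    In the continuation the unbounded factors |t|^l0 must not spoil the constants: on the sector the
    inverse of Q/RD - exp_q decays like exp(-dD^2 ln^2 |t| / (2 ln q)), faster than any power of
    |t|. *)

Section basics.
Context {R : realType}.
Implicit Types z w : R[i].

Lemma normc_ge0 z : 0 <= normc z.
Proof. by case: z => x y; rewrite sqrtr_ge0. Qed.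

Lemma normcR (x : R) : normc x%:C = `|x|.
Proof. by rewrite /normc/= expr0n addr0 sqrtr_sqr. Qed.

Lemma normcX z n : normc (z ^+ n) = normc z ^+ n.
Proof. by elim: n => [|n IH]; rewrite ?expr0 ?normc1// !exprS normcM IH. Qed.

Lemma normcN' z : normc (- z) = normc z.
Proof. by case: z => x y; rewrite /normc/= !sqrrN. Qed.

Lemma normcD z w : normc (z + w) <= normc z + normc w.
Proof. exact: le_normcD. Qed.

Lemma normcBC z w : normc (z - w) = normc (w - z).
Proof. by rewrite -normcN' opprB. Qed.

Lemma normr_Re z : `|complex.Re z| <= normc z.
Proof.
by case: z => x y /=; rewrite -sqrtr_sqr ler_wsqrtr// lerDl sqr_ge0.
Qed.

Lemma normr_Im z : `|complex.Im z| <= normc z.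
Proof.
by case: z => x y /=; rewrite -sqrtr_sqr ler_wsqrtr// lerDr sqr_ge0.
Qed.

Lemma normc_le_ReIm z : normc z <= `|complex.Re z| + `|complex.Im z|.
Proof.
case: z => x y /=.
rewrite -[leRHS]ger0_norm ?addr_ge0// -sqrtr_sqr ler_wsqrtr//.
rewrite sqrrD !real_normK ?num_real// -addrA lerD2l lerDr.
by rewrite mulrn_wge0// mulr_ge0.
Qed.

Lemma normc_sum I (r : seq I) (P : pred I) (F : I -> R[i]) :
  normc (\sum_(i <- r | P i) F i) <= \sum_(i <- r | P i) normc (F i).
Proof.
elim/big_ind2 : _ => // [|x a y b xa yb]; first by rewrite normc0.
by apply: (le_trans (normcD _ _)); exact: lerD.
Qed.

Lemma normc_le_dist z w : normc z - normc w <= normc (z - w).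
Proof. by rewrite lerBlDr -[X in normc X <= _](subrK w) normcD. Qed.

Lemma normcE z : `|z| = (normc z)%:C.
Proof. by []. Qed.

(** The norm is [R[i]]-valued and the order of [R[i]] only compares numbers with equal imaginary
    parts, so a positive radius [e] is real and can be replaced by its real part. *)
Lemma cvg_normc_le (E : normedModType R[i]) (u : nat -> E) l (b : nat -> R) :
  (forall n, `|u n - l| <= (b n)%:C) -> b @ \oo --> 0 -> u @ \oo --> l.
Proof.
move=> ub b0; apply/cvgrPdist_le => /= e; rewrite ltcE/= => /andP[/eqP ei er].
move/cvgr0Pnorm_le : b0 => /(_ _ er); apply: filterS => n bn.
rewrite distrC (le_trans (ub n))// lecE/= ei eqxx/=.
by rewrite (le_trans (ler_norm _)).
Qed.

Lemma cvgc_ReIm (u : nat -> R[i]) (a b : R) :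
  (fun n => complex.Re (u n)) @ \oo --> a ->
  (fun n => complex.Im (u n)) @ \oo --> b -> u @ \oo --> a +i* b.
Proof.
move=> ua ub.
apply: (@cvg_normc_le _ _ _ (fun n => `|complex.Re (u n) - a| + `|complex.Im (u n) - b|)).
  move=> n; rewrite normcE lecR.
  by apply: (le_trans (normc_le_ReIm _)); case: (u n).
rewrite -[0]addr0; apply: cvgD; rewrite -(normr0 R); apply: cvg_norm.
  by rewrite -(subrr a); apply: cvgB => //; exact: cvg_cst.
by rewrite -(subrr b); apply: cvgB => //; exact: cvg_cst.
Qed.

(** * Complex series with geometric majorants *)

Definition csum (a : nat -> R[i]) : R[i] := limn (series a).

Lemma cvgc_Re (u : nat -> R[i]) l : u @ \oo --> l ->
  (fun n => complex.Re (u n)) @ \oo --> complex.Re l.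
Proof.
move=> /cvgrPdist_le ul; apply/cvgrPdist_le => e e0.
have := ul e%:C; rewrite ltcR => /(_ e0); apply: filterS => n.
rewrite normcE lecR; apply: le_trans.
by apply: le_trans (normr_Re _); rewrite raddfB.
Qed.

Lemma cvgc_Im (u : nat -> R[i]) l : u @ \oo --> l ->
  (fun n => complex.Im (u n)) @ \oo --> complex.Im l.
Proof.
move=> /cvgrPdist_le ul; apply/cvgrPdist_le => e e0.
have := ul e%:C; rewrite ltcR => /(_ e0); apply: filterS => n.
rewrite normcE lecR; apply: le_trans.
by apply: le_trans (normr_Im _); rewrite raddfB.
Qed.

Lemma series_Re (a : nat -> R[i]) N :
  complex.Re (series a N) = series (fun n => complex.Re (a n)) N.
Proof. by rewrite /series/= raddf_sum. Qed.

Lemma series_Im (a : nat -> R[i]) N :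
  complex.Im (series a N) = series (fun n => complex.Im (a n)) N.
Proof. by rewrite /series/= raddf_sum. Qed.

Lemma geo_sum_le (K x : R) M N : 0 <= K -> 0 <= x < 1 ->
  \sum_(M <= n < N) K * x ^+ n <= K * x ^+ M / (1 - x).
Proof.
move=> K0 /andP[x0 x1]; have x1' : 0 < 1 - x by rewrite subr_gt0.
(* The sharp telescoped form is the one that propagates by induction on [N]; [maxn] covers the empty
   range. *)
suff : \sum_(M <= n < N) K * x ^+ n <= K * (x ^+ M - x ^+ (maxn M N)) / (1 - x).
  move=> /le_trans; apply; rewrite ler_wpM2r ?invr_ge0 ?(ltW x1')//.
  by rewrite ler_wpM2l// gerBl exprn_ge0.
elim: N => [|N IH]; first by rewrite big_geq// maxn0 subrr mulr0 mul0r.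
have [MN|NM] := leqP M N; last by rewrite big_geq// (maxn_idPl NM) subrr mulr0 mul0r.
rewrite big_nat_recr//= (maxn_idPr (leqW MN)); move: IH; rewrite (maxn_idPr MN).
rewrite -(lerD2r (K * x ^+ N)) => /le_trans; apply.
rewrite -[X in _ + X](mulfK (lt0r_neq0 x1')) -mulrDl exprS.
by rewrite ler_wpM2r ?invr_ge0 ?(ltW x1')// le_eqVlt; apply/orP; left; apply/eqP; ring.
Qed.

Lemma limc_eq (u : nat -> R[i]) l : u @ \oo --> l -> limn u = l.
Proof. by move=> ul; apply: cvg_lim. Qed.

Section geometric_majorant.
Variables (a : nat -> R[i]) (K x : R).
Hypotheses (x01 : 0 <= x < 1) (aKx : forall n, normc (a n) <= K * x ^+ n).

Lemma geo_ge0 : 0 <= K.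
Proof. by have := aKx 0; rewrite expr0 mulr1; exact: le_trans (normc_ge0 _). Qed.

Lemma series_geo_dist M N : (M <= N)%N ->
  normc (series a N - series a M) <= K * x ^+ M / (1 - x).
Proof.
move=> MN; rewrite sub_series_geq//; apply: le_trans (geo_sum_le M N geo_ge0 x01).
by apply: (le_trans (normc_sum _ _ _)); apply: ler_sum => i _; exact: aKx.
Qed.

Lemma is_cvg_real_geo (b : nat -> R) : (forall n, `|b n| <= K * x ^+ n) ->
  cvgn (series b).
Proof.
move=> bK; apply: normed_cvg; apply: (@series_le_cvg _ _ (geometric K x)) => //.
- by move=> n /=; rewrite normr_ge0.
- by move=> n /=; rewrite mulr_ge0 ?geo_ge0 ?exprn_ge0//; case/andP: x01.
- by apply: is_cvg_geometric_series; rewrite ger0_norm; case/andP: x01.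
Qed.

Lemma cvg_csum : series a @ \oo --> csum a.
Proof.
have cr : cvgn (series (fun n => complex.Re (a n))).
  by apply: is_cvg_real_geo => n; apply: le_trans (aKx n); exact: normr_Re.
have ci : cvgn (series (fun n => complex.Im (a n))).
  by apply: is_cvg_real_geo => n; apply: le_trans (aKx n); exact: normr_Im.
have ca : series a @ \oo --> limn (series (fun n => complex.Re (a n))) +i*
    limn (series (fun n => complex.Im (a n))).
  by apply: cvgc_ReIm; [under eq_fun do rewrite series_Re|under eq_fun do rewrite series_Im].
by rewrite /csum (limc_eq ca).
Qed.

Lemma csum_tail N : normc (csum a - series a N) <= K * x ^+ N / (1 - x).
Proof.
apply/ler_addgt0Pr => e e0.
have /cvgrPdist_le/(_ e%:C) := cvg_csum; rewrite ltcR => /(_ e0) [M _ MP].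
pose m := maxn M N; have := MP m; rewrite /= leq_maxl normcE lecR => /(_ isT) h.
have -> : csum a - series a N = (series a m - series a N) + (csum a - series a m) by ring.
apply: (le_trans (normcD _ _)); apply: lerD => //.
exact: (@series_geo_dist N m (leq_maxr M N)).
Qed.

Lemma csum_le : normc (csum a) <= K / (1 - x).
Proof. by have := csum_tail 0; rewrite /series/= big_geq// subr0 expr0 mulr1. Qed.

End geometric_majorant.

Lemma csum_eq (a : nat -> R[i]) l : series a @ \oo --> l -> csum a = l.
Proof. exact: limc_eq. Qed.

Lemma cvgcB (u v : nat -> R[i]) (l l' : R[i]) : u @ \oo --> l -> v @ \oo --> l' ->
  (fun n => u n - v n) @ \oo --> l - l'.
Proof. exact: (@cvgB _ _ _ _ _ u v l l'). Qed.

Lemma cvgcZ (c : R[i]) (u : nat -> R[i]) (l : R[i]) : u @ \oo --> l ->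
  (fun n => c * u n) @ \oo --> c * l.
Proof. by move=> ul; apply: cvgMl_tmp. Qed.

Lemma csum_comb (a b c : nat -> R[i]) (h : R[i]) : series a @ \oo --> csum a ->
  series b @ \oo --> csum b -> series c @ \oo --> csum c ->
  csum (fun n => a n - b n - h * c n) = csum a - csum b - h * csum c.
Proof.
move=> ca cb cc; apply: csum_eq.
rewrite (_ : series _ = (fun n => series a n - series b n - h * series c n)); last first.
  by apply/funext => n; rewrite /series/= mulr_sumr -!sumrB.
exact: (cvgcB (cvgcB ca cb) (@cvgcZ h _ _ cc)).
Qed.

Lemma cvg_geo0 (C x : R) : 0 <= x < 1 -> (fun n => C * x ^+ n) @ \oo --> (0 : R).
Proof. by move=> /andP[x0 x1]; apply: cvg_geometric; rewrite ger0_norm. Qed.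

(** Summing the triangle row by row leaves, for each [i], a partial sum of [b], so that only tails
    of [b] occur in the error of [csum_cauchy]. *)
Lemma series_cauchy (a b : nat -> R[i]) N :
  series (fun p => \sum_(i < p.+1) a i * b (p - i)%N) N =
  \sum_(i < N) a i * series b (N - i)%N.
Proof.
elim: N => [|N IH]; first by rewrite /series/= big_geq// big_ord0.
rewrite seriesSr IH [in RHS]big_ord_recr /= subSnn.
rewrite [in LHS]big_ord_recr/= subnn addrA.
have -> : series b 1 = b 0%N by rewrite /series/= big_nat1.
congr (_ + _); rewrite -big_split/=; apply: eq_bigr => i _.
by rewrite subSn ?(ltnW (ltn_ord i))// seriesSr mulrDr.
Qed.

(** The error is a tail of [a] times [csum b], plus the [a i] times tails of [b] at [N - i]. The
    strict inequality [x < y] sums the latter, of size x^i y^(N-i), to a multiple of y^N. *)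
Lemma csum_cauchy (a b : nat -> R[i]) (K L x y : R) :
  (forall n, normc (a n) <= K * x ^+ n) -> (forall n, normc (b n) <= L * y ^+ n) ->
  0 <= x -> x < y -> y < 1 ->
  csum (fun p => \sum_(i < p.+1) a i * b (p - i)%N) = csum a * csum b.
Proof.
move=> aK bL x0 xy y1; have y0 := le_lt_trans x0 xy.
have x01 : 0 <= x < 1 by rewrite x0 (lt_trans xy).
have y01 : 0 <= y < 1 by rewrite (ltW y0).
have K0 := geo_ge0 aK; have L0 := geo_ge0 bL.
have y1' : 0 < 1 - y by rewrite subr_gt0.
have xy1 : 0 <= x / y < 1 by rewrite divr_ge0 ?(ltW y0)//= ltr_pdivrMr ?mul1r.
pose D := K / (1 - x) * normc (csum b) + K * (L / (1 - y)) / (1 - x / y).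
apply: csum_eq; apply: (@cvg_normc_le _ _ _ (fun N => D * y ^+ N)); last exact: cvg_geo0.
move=> N; rewrite normcE lecR normcBC series_cauchy.
have -> : csum a * csum b - \sum_(i < N) a i * series b (N - i)%N =
    (csum a - series a N) * csum b + \sum_(i < N) a i * (csum b - series b (N - i)%N).
  under [X in _ = _ + X]eq_bigr do rewrite mulrBr.
  rewrite sumrB -mulr_suml mulrBl /series/= big_mkord; ring.
rewrite [leRHS]mulrDl; apply: (le_trans (normcD _ _)); apply: lerD.
  rewrite normcM [leRHS]mulrAC ler_wpM2r ?normc_ge0//.
  apply: (le_trans (csum_tail x01 aK N)).
  rewrite mulrAC ler_wpM2l ?divr_ge0// ?subr_ge0 ?(ltW (lt_trans xy y1))//.
  by rewrite lerXn2r ?nnegrE// ltW.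
apply: (le_trans (normc_sum _ _ _)).
have h : forall i : 'I_N, true -> normc (a i * (csum b - series b (N - i)%N)) <=
    K * (L / (1 - y)) * y ^+ N * (x / y) ^+ i.
  move=> i _; rewrite normcM.
  apply: (le_trans (ler_pM (normc_ge0 _) (normc_ge0 _) (aK i) (csum_tail y01 bL _))).
  have -> : y ^+ N = y ^+ (N - i)%N * y ^+ i by rewrite -exprD subnK// ltnW.
  rewrite le_eqVlt; apply/orP; left; apply/eqP; rewrite expr_div_n.
  field; rewrite ?(lt0r_neq0 y1')/=; last by rewrite expf_neq0 ?gt_eqF.
apply: (le_trans (ler_sum _ h)).
rewrite -(big_mkord xpredT (fun i => K * (L / (1 - y)) * y ^+ N * (x / y) ^+ i)).
apply: (le_trans (geo_sum_le _ _ _ xy1)).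
  by rewrite !mulr_ge0 ?exprn_ge0 ?invr_ge0 ?(ltW y0) ?(ltW y1').
by rewrite expr0 mulr1 mulrAC.
Qed.

(** The remainder is h^2 times a polynomial in [z] and [h] with nonnegative coefficients, so it is
    dominated by its value at [normc z] and [e], rescaled by the square of [normc h / e]. The
    induction uses R_(n+1) = (z + h) R_n + h^2 n z^(n-1) on both sides. *)
Lemma pow_remainder (z h : R[i]) (e : R) n : 0 < e -> normc h <= e ->
  normc ((z + h) ^+ n - z ^+ n - h * (n%:R * z ^+ n.-1)) <=
  (normc h / e) ^+ 2 * ((normc z + e) ^+ n - normc z ^+ n - e * (n%:R * normc z ^+ n.-1)).
Proof.
move=> e0 he; elim: n => [|n IH]; first by rewrite !(expr0, mul0r, mulr0, subrr) normc0.
have -> : (z + h) ^+ n.+1 - z ^+ n.+1 - h * (n.+1%:R * z ^+ n) =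
    (z + h) * ((z + h) ^+ n - z ^+ n - h * (n%:R * z ^+ n.-1)) + h ^+ 2 * (n%:R * z ^+ n.-1).
  case: n {IH} => [|n]; rewrite ?expr0 ?expr1 /=; first by ring.
  by rewrite !exprS -!natr1; ring.
have -> : (normc z + e) ^+ n.+1 - normc z ^+ n.+1 - e * (n.+1%:R * normc z ^+ n) =
    (normc z + e) * ((normc z + e) ^+ n - normc z ^+ n - e * (n%:R * normc z ^+ n.-1))
      + e ^+ 2 * (n%:R * normc z ^+ n.-1).
  case: n {IH} => [|n]; rewrite ?expr0 ?expr1 /=; first by ring.
  by rewrite !exprS -!natr1; ring.
apply: (le_trans (normcD _ _)); rewrite [leRHS]mulrDr; apply: lerD.
  rewrite normcM [leRHS]mulrCA; apply: ler_pM; rewrite ?normc_ge0//.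
  by apply: (le_trans (normcD _ _)); rewrite lerD2l.
rewrite !normcM !normcX.
have -> : (normc h / e) ^+ 2 * (e ^+ 2 * (n%:R * normc z ^+ n.-1)) =
  normc h ^+ 2 * (n%:R * normc z ^+ n.-1) by field; rewrite gt_eqF.
have -> : normc (n%:R : R[i]) = n%:R by rewrite -(rmorph_nat (real_complex R)) normcR normr_nat.
by [].
Qed.

End basics.

(** * Complex-valued measurable functions and integrals *)

Section measurability.
Context {R : realType}.

Definition cmeas d (T : measurableType d) (f : T -> R[i]) :=
  measurable_fun setT (fun t => complex.Re (f t)) /\
  measurable_fun setT (fun t => complex.Im (f t)).

Context d (T : measurableType d).
Implicit Types (f g : T -> R[i]).

Lemma cmeas_cst (c : R[i]) : cmeas (fun _ : T => c).
Proof. by split; exact: measurable_cst. Qed.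

Lemma cmeasD f g : cmeas f -> cmeas g -> cmeas (fun t => f t + g t).
Proof.
move=> [fr fi] [gr gi]; split; under eq_fun do rewrite raddfD/=;
  exact: measurable_funD.
Qed.

Lemma cmeasN f : cmeas f -> cmeas (fun t => - f t).
Proof.
move=> [fr fi]; split; under eq_fun do rewrite raddfN/=; exact: measurable_funN.
Qed.

Lemma cmeasB f g : cmeas f -> cmeas g -> cmeas (fun t => f t - g t).
Proof. by move=> mf mg; apply: cmeasD => //; exact: cmeasN. Qed.

Lemma cmeasM f g : cmeas f -> cmeas g -> cmeas (fun t => f t * g t).
Proof.
move=> [fr fi] [gr gi]; split.
  rewrite (_ : (fun _ => _) = (fun t => complex.Re (f t) * complex.Re (g t) -
    complex.Im (f t) * complex.Im (g t))).
    by apply: measurable_funB; exact: measurable_funM.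
  by apply/funext => t; case: (f t) (g t) => ? ? [].
rewrite (_ : (fun _ => _) = (fun t => complex.Re (f t) * complex.Im (g t) +
    complex.Im (f t) * complex.Re (g t))).
  by apply: measurable_funD; exact: measurable_funM.
by apply/funext => t; case: (f t) (g t) => ? ? [].
Qed.

Lemma cmeasZ (c : R[i]) f : cmeas f -> cmeas (fun t => c * f t).
Proof. by move=> mf; apply: cmeasM => //; exact: cmeas_cst. Qed.

Lemma cmeasX f n : cmeas f -> cmeas (fun t => f t ^+ n).
Proof.
move=> mf; elim: n => [|n IH]; first exact: cmeas_cst.
by under eq_fun do rewrite exprS; exact: cmeasM.
Qed.

Lemma cmeas_sum I (r : seq I) (P : pred I) (F : I -> T -> R[i]) :
  (forall i, P i -> cmeas (F i)) -> cmeas (fun t => \sum_(i <- r | P i) F i t).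
Proof.
move=> mF; elim: r => [|i r IH].
  by under eq_fun do rewrite big_nil; exact: cmeas_cst.
under eq_fun do rewrite big_cons.
have [Pi|nPi] := boolP (P i) => //.
by apply: cmeasD => //; exact: mF.
Qed.

Lemma measurable_inv_pos (h : T -> R) : (forall t, 0 < h t) ->
  measurable_fun setT h -> measurable_fun setT (fun t => (h t)^-1).
Proof.
move=> h0 mh; rewrite (_ : (fun _ => _) = (fun t => expR (- ln (h t)))).
  apply: (measurableT_comp (@measurable_expR R)).
  apply: (measurableT_comp (@oppr_measurable R _)).
  exact: (measurableT_comp (@measurable_ln R)).
by apply/funext => t; rewrite expRN lnK// posrE.
Qed.

Lemma cmeasV f : (forall t, f t != 0) -> cmeas f -> cmeas (fun t => (f t)^-1).
Proof.
move=> f0 [fr fi].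
pose n2 t := complex.Re (f t) ^+ 2 + complex.Im (f t) ^+ 2.
have mn : measurable_fun setT (fun t => (n2 t)^-1).
  apply: measurable_inv_pos => [t|].
    rewrite /n2 lt_neqAle addr_ge0 ?sqr_ge0// andbT eq_sym.
    rewrite paddr_eq0 ?sqr_ge0// !sqrf_eq0.
    by have := f0 t; rewrite eq_complex.
  by apply: measurable_funD; exact: measurable_funX.
split.
  rewrite (_ : (fun _ => _) = (fun t => complex.Re (f t) * (n2 t)^-1)).
    exact: measurable_funM.
  by apply/funext => t; rewrite /n2; case: (f t).
rewrite (_ : (fun _ => _) = (fun t => - (complex.Im (f t) * (n2 t)^-1))).
  by apply: measurable_funN; exact: measurable_funM.
by apply/funext => t; rewrite /n2; case: (f t) => a b /=.
Qed.

Lemma cmeas_cvg (u : nat -> T -> R[i]) f :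
  (forall n, cmeas (u n)) -> (forall t, (fun n => u n t) @ \oo --> f t) -> cmeas f.
Proof.
move=> mu uf; split.
  apply: (@measurable_fun_cvg _ _ _ _ (fun n t => complex.Re (u n t))) => [n|t _].
    by case: (mu n).
  by apply: cvgc_Re; exact: uf.
apply: (@measurable_fun_cvg _ _ _ _ (fun n t => complex.Im (u n t))) => [n|t _].
  by case: (mu n).
by apply: cvgc_Im; exact: uf.
Qed.

Lemma cmeas_csum (u : nat -> T -> R[i]) : (forall n, cmeas (u n)) ->
  (forall t, series (u ^~ t) @ \oo --> csum (u ^~ t)) -> cmeas (fun t => csum (u ^~ t)).
Proof.
move=> mu uf; apply: (@cmeas_cvg (fun n t => series (u ^~ t) n)) => //.
by move=> n; apply: cmeas_sum.
Qed.

Lemma cmeas_real (h : T -> R) : measurable_fun setT h -> cmeas (fun t => (h t)%:C).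
Proof. by move=> mh; split => //=; exact: measurable_cst. Qed.

Lemma cmeas_cexp f : cmeas f -> cmeas (fun t => cexp (f t)).
Proof.
move=> [fr fi].
have me : measurable_fun setT (fun t => expR (complex.Re (f t))).
  exact: (measurableT_comp (@measurable_expR R)).
split; rewrite /cexp /=; apply: measurable_funM => //.
  apply: (measurableT_comp _ fi); apply: continuous_measurable_fun.
  exact: continuous_cos.
apply: (measurableT_comp _ fi); apply: continuous_measurable_fun.
exact: continuous_sin.
Qed.

End measurability.

Lemma cmeas_comp {R : realType} d d' (T : measurableType d) (T' : measurableType d')
  (f : T' -> R[i]) (h : T -> T') :
  cmeas f -> measurable_fun setT h -> cmeas (fun t => f (h t)).
Proof.
move=> [fr fi] mh; split.
  exact: (measurableT_comp fr mh).
exact: (measurableT_comp fi mh).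
Qed.

Lemma cmeas_continuous {R : realType} (f : R -> R[i]) : continuous f -> cmeas f.
Proof.
move=> cf; split; apply: continuous_measurable_fun => x; apply/cvgrPdist_le => e e0.
  have /cvgrPdist_le/(_ e%:C) := cf x; rewrite ltcR => /(_ e0); apply: filterS => y.
  by rewrite normcE lecR; apply: le_trans; apply: le_trans (normr_Re _); rewrite raddfB.
have /cvgrPdist_le/(_ e%:C) := cf x; rewrite ltcR => /(_ e0); apply: filterS => y.
by rewrite normcE lecR; apply: le_trans; apply: le_trans (normr_Im _); rewrite raddfB.
Qed.

Lemma cmeas_imaginary {R : realType} : cmeas (fun m : R => (0 +i* m : R[i])).
Proof. by split => //=; exact: measurable_cst. Qed.

Lemma cmeas_horner {R : realType} (P : {poly R[i]}) :
  cmeas (fun m : R => P.[0 +i* m]).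
Proof.
under eq_fun do rewrite horner_coef.
apply: cmeas_sum => i _; apply: cmeasZ; apply: cmeasX; exact: cmeas_imaginary.
Qed.

(** * The exponential weight *)

Section exponential_weight.
Context {R : realType}.
Implicit Types (a b : R).
Local Notation mu := (@lebesgue_measure R).

Definition expw b (m : R) : R := expR (- (b * `|m|)).

Lemma expw_gt0 b m : 0 < expw b m. Proof. exact: expR_gt0. Qed.

Lemma expw_ge0 b m : 0 <= expw b m. Proof. exact: expR_ge0. Qed.

Lemma continuous_expw b : continuous (expw b).
Proof.
move=> x; apply: continuous_comp; last exact: continuous_expR.
apply: cvgN; apply: cvgM; first exact: cvg_cst.
exact: norm_continuous.
Qed.

Lemma measurable_expw b : measurable_fun setT (expw b).
Proof. by apply: continuous_measurable_fun; exact: continuous_expw. Qed.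

Lemma integrable_expw b : 0 < b -> mu.-integrable setT (EFin \o expw b).
Proof.
move=> b0; apply/integrableP; split.
  by apply/measurable_EFinP; exact: measurable_expw.
under eq_integral do rewrite /= ger0_norm ?expw_ge0//.
rewrite (@ge0_symfun_integralT _ (expw b)); last 3 first.
- by move=> x; exact: expw_ge0.
- exact: continuous_expw.
- by move=> x; rewrite /expw/= normrN.
rewrite lte_mul_pinfty// ?lee_fin//.
(* On the half line the weight is [b^-1] times the density of the exponential law, whose total mass
   is 1. *)
apply: (@le_lt_trans _ _ (\int[mu]_x (b^-1%:E * (exponential_pdf b x)%:E))%E).
  rewrite integral_mkcond; apply: ge0_le_integral => //.
  - by move=> x _; apply: erestrict_ge0 => y _; rewrite lee_fin expw_ge0.
  - apply/(measurable_restrictT _ _).1 => //.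
      by rewrite -set_itvcy; exact: measurable_itv.
    by apply/measurable_EFinP; apply: measurable_funTS; exact: measurable_expw.
  - by apply/measurable_EFinP; apply: measurable_funM => //; exact: measurable_exponential_pdf.
  - move=> x _; rewrite patchE; case: ifPn => [/set_mem/= x0|_].
      rewrite exponential_pdfE// -EFinM lee_fin /expw ger0_norm//.
      by rewrite mulrA mulVf ?gt_eqF// mul1r mulNr.
    rewrite -[point]/(0%:E) -EFinM.
    by rewrite lee_fin mulr_ge0 ?invr_ge0 ?exponential_pdf_ge0 ?(ltW b0).
rewrite ge0_integralZl//; last 3 first.
- by apply/measurable_EFinP; exact: measurable_exponential_pdf.
- by move=> x _; rewrite lee_fin exponential_pdf_ge0// ltW.
- by rewrite lee_fin invr_ge0 ltW.
by rewrite integral_exponential_pdf// mule1 ltry.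
Qed.

End exponential_weight.

(** * Integrals of exponentially dominated functions *)

Section complex_integral.
Context {R : realType}.
Implicit Types (a b C : R) (f g : R -> R[i]).
Local Notation mu := (@lebesgue_measure R).

(** A ball of radius [C] in a weighted sup-norm space. Carrying [C] explicitly replaces the norm,
    and measurability is a regularity that survives the pointwise limits taken below. *)
Definition dominated b C f := cmeas f /\ forall m, normc (f m) <= C * expw b m.

Lemma dominated_ge0 b C f : dominated b C f -> 0 <= C.
Proof.
move=> [_ /(_ 0)] h; have := le_trans (normc_ge0 _) h.
by rewrite pmulr_lge0 ?expw_gt0.
Qed.

Lemma integrable_dom b C (g : R -> R) : 0 < b -> measurable_fun setT g ->
  (forall m, `|g m| <= C * expw b m) -> mu.-integrable setT (EFin \o g).
Proof.
move=> b0 mg gC; apply: (@le_integrable _ _ _ mu _ measurableT _ (EFin \o (fun m => C * expw b m))).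
- exact/measurable_EFinP.
- by move=> x _ /=; rewrite lee_fin (le_trans (gC x))// ler_norm.
- rewrite (_ : EFin \o _ = (fun m => C%:E * (EFin \o expw b) m)%E).
    by apply: integrableZl => //; exact: integrable_expw.
  by apply/funext => m /=; rewrite EFinM.
Qed.

Lemma dom_Re b C f : dominated b C f -> 0 < b ->
  mu.-integrable setT (EFin \o (fun m => complex.Re (f m))).
Proof.
move=> [[fr fi] fC] b0; apply: (@integrable_dom b C) => // m.
exact: le_trans (normr_Re _) (fC m).
Qed.

Lemma dom_Im b C f : dominated b C f -> 0 < b ->
  mu.-integrable setT (EFin \o (fun m => complex.Im (f m))).
Proof.
move=> [[fr fi] fC] b0; apply: (@integrable_dom b C) => // m.
exact: le_trans (normr_Im _) (fC m).
Qed.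

Definition Iexpw b : R := (\int[mu]_m expw b m)%R.

Lemma Iexpw_ge0 b : 0 <= Iexpw b.
Proof. by apply: Rintegral_ge0 => m _; exact: expw_ge0. Qed.

Lemma Rintegral_dom b C (g : R -> R) : 0 < b -> measurable_fun setT g ->
  (forall m, `|g m| <= C * expw b m) -> `|(\int[mu]_m g m)%R| <= C * Iexpw b.
Proof.
move=> b0 mg gC; apply: (le_trans (le_normr_Rintegral _ _)) => //.
  exact: integrable_dom gC.
rewrite -RintegralZl//; last exact: integrable_expw.
apply: le_Rintegral => //.
- by apply: (@integrable_dom b C) => [//||m]; [exact: measurableT_comp|rewrite normr_id].
- apply: (@integrable_dom b `|C|) => [//||m].
    by apply: measurable_funM => //; exact: measurable_expw.
  by rewrite normrM (ger0_norm (expw_ge0 _ _)).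
Qed.

(** The factor 2 comes from bounding the real and imaginary parts separately. *)
Lemma cintegral_le b C f : dominated b C f -> 0 < b ->
  normc (cintegral f) <= 2 * C * Iexpw b.
Proof.
move=> [[fr fi] fC] b0; apply: (le_trans (normc_le_ReIm _)) => /=.
rewrite -mulrA mulr_natl mulr2n; apply: lerD; apply: Rintegral_dom => // m.
  exact: le_trans (normr_Re _) (fC m).
exact: le_trans (normr_Im _) (fC m).
Qed.

Lemma cintegralD b C C' f g : dominated b C f -> dominated b C' g -> 0 < b ->
  cintegral (fun m => f m + g m) = cintegral f + cintegral g.
Proof.
move=> df dg b0; rewrite /cintegral; apply/eqP; rewrite eq_complex/=.
apply/andP; split; apply/eqP.
  under eq_Rintegral do rewrite raddfD/=.
  by rewrite RintegralD//; [exact: dom_Re df b0|exact: dom_Re dg b0].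
under eq_Rintegral do rewrite raddfD/=.
by rewrite RintegralD//; [exact: dom_Im df b0|exact: dom_Im dg b0].
Qed.

Lemma cintegralZ b C f (c : R[i]) : dominated b C f -> 0 < b ->
  cintegral (fun m => c * f m) = c * cintegral f.
Proof.
move=> df b0; have fr := dom_Re df b0; have fi := dom_Im df b0.
have key : forall x y : R, mu.-integrable setT (EFin \o (fun m => x * complex.Re (f m))) /\
   mu.-integrable setT (EFin \o (fun m => y * complex.Im (f m))).
  case: df => [[mr mi] fC] x y; split.
    apply: (@integrable_dom b (`|x| * C)) => //; first exact: measurable_funM.
    move=> m; rewrite normrM -mulrA ler_wpM2l//.
    exact: le_trans (normr_Re _) (fC m).
  apply: (@integrable_dom b (`|y| * C)) => //; first exact: measurable_funM.
  move=> m; rewrite normrM -mulrA ler_wpM2l//.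
  exact: le_trans (normr_Im _) (fC m).
case: c => x y; rewrite /cintegral; apply/eqP; rewrite eq_complex/=.
apply/andP; split; apply/eqP.
  transitivity (\int[mu]_m (x * complex.Re (f m) - y * complex.Im (f m)))%R.
    by apply: eq_Rintegral => m _; case: (f m).
  have [k1 k2] := key x y.
  by rewrite RintegralB// !RintegralZl.
transitivity (\int[mu]_m (x * complex.Im (f m) + y * complex.Re (f m)))%R.
  by apply: eq_Rintegral => m _; case: (f m).
have [k1 k2] := key y x.
by rewrite RintegralD// !RintegralZl.
Qed.

Lemma eq_cintegral f g : f =1 g -> cintegral f = cintegral g.
Proof. by move=> /funext ->. Qed.

(** By uniqueness of Lebesgue measure it suffices to compare both measures on half-open
    intervals. *)
Lemma lebesgue_measure_shift (s : R) (A : set R) : measurable A ->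
  pushforward mu ((fun x => x + s) : _ -> measurableTypeR R) A = mu A.
Proof.
have ms : measurable_fun setT ((fun x => x + s) : measurableTypeR R -> measurableTypeR R).
  by apply: measurable_funD.
pose pm : {measure set (measurableTypeR R) -> \bar R} := pushforward mu ((fun x => x + s) : measurableTypeR R -> measurableTypeR R).
move=> mA; apply/esym/(@lebesgue_measure_unique _ (pm ms)) => //= _ [[a b]] _ <-.
rewrite /pushforward.
rewrite (_ : _ @^-1` _ = `]a - s, b - s]%classic); last first.
  by apply/seteqP; split => x /=; rewrite !in_itv/= ltrBlDr lerBrDr.
rewrite !lebesgue_measure_itv/=.
by rewrite !lte_fin ltrD2r; case: ifPn => // _; rewrite -!EFinB; congr (_%:E); ring.
Qed.

Lemma Rintegral_shift b C (g : R -> R) (s : R) : 0 < b -> measurable_fun setT g ->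
  (forall m, `|g m| <= C * expw b m) ->
  (\int[mu]_m g (m + s)%R)%R = (\int[mu]_m g m)%R.
Proof.
move=> b0 mg gC; rewrite /Rintegral; congr fine.
have ms : measurable_fun setT ((fun x => x + s) : measurableTypeR R -> measurableTypeR R).
  by apply: measurable_funD.
pose sh : measurableTypeR R -> measurableTypeR R := fun x => x + s.
transitivity (\int[pushforward mu sh]_m (g m)%:E)%E.
  rewrite integral_pushforward//.
  - exact/measurable_EFinP.
  - rewrite preimage_setT.
    apply: (@integrable_dom b (C * expR (b * `|s|)) (fun m => g (m + s))) => //.
      exact: measurableT_comp.
    move=> m; apply: (le_trans (gC _)); rewrite -mulrA; apply: ler_wpM2l.
      have := le_trans (normr_ge0 _) (gC 0).
      by rewrite pmulr_lge0 ?expw_gt0.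
    rewrite /expw -expRD ler_expR lerNl opprD opprK -mulrN -mulrDr.
    rewrite ler_pM2l// addrC lerBlDr.
    by apply: le_trans (ler_normB (m + s) s); rewrite addrK.
apply: eq_measure_integral => //= A mA _; exact: lebesgue_measure_shift.
Qed.

Lemma cintegral_shift b C f (s : R) : 0 < b -> dominated b C f ->
  cintegral (fun m => f (m + s)) = cintegral f.
Proof.
move=> b0 [[fr fi] fC]; rewrite /cintegral.
rewrite (@Rintegral_shift b C (fun m => complex.Re (f m)))//; last first.
  by move=> m; exact: le_trans (normr_Re _) (fC m).
rewrite (@Rintegral_shift b C (fun m => complex.Im (f m)))//.
by move=> m; exact: le_trans (normr_Im _) (fC m).
Qed.

Section fubini.
Variables (b C : R).
Hypothesis b0 : 0 < b.

Lemma integrable_prod_dom (g : R * R -> R) : measurable_fun setT g ->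
  (forall x y, `|g (x, y)| <= C * expw b x * expw b y) ->
  (mu \x mu)%E.-integrable setT (EFin \o g).
Proof.
move=> mg gC; apply/integrable12ltyP; first exact/measurable_EFinP.
apply: (@le_lt_trans _ _ (\int[mu]_x (`|C| * Iexpw b * expw b x)%:E)%E).
  apply: ge0_le_integral => //=.
  - by move=> x _; apply: integral_ge0.
  - apply: (@measurable_fun_fubini_tonelli_F _ _ _ _ R mu (fun z => `|(g z)%:E|%E)) => //.
    by apply: measurableT_comp => //; exact/measurable_EFinP.
  - apply/measurable_EFinP; apply: measurable_funM => //; exact: measurable_expw.
  - move=> x _; apply: (@le_trans _ _ (\int[mu]_y ((`|C| * expw b x)%:E * (expw b y)%:E))%E).
      apply: ge0_le_integral => //=.
      + have msec : measurable_fun setT (fun y => g (x, y)).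
          by apply: measurableT_comp mg _; exact: pair1_measurable.
        by apply/measurable_EFinP; exact: measurableT_comp msec.
      + apply/measurable_EFinP; apply: measurable_funM => //; exact: measurable_expw.
      + move=> y _; rewrite lee_fin (le_trans (gC x y))// ler_wpM2r ?expw_ge0//.
        by rewrite ler_wpM2r ?expw_ge0// ler_norm.
    rewrite ge0_integralZl//; last 3 first.
    + by apply/measurable_EFinP; exact: measurable_expw.
    + by move=> y _; rewrite lee_fin expw_ge0.
    + by rewrite lee_fin mulr_ge0 ?expw_ge0.
    rewrite -(@fineK _ (\int[mu]_y (expw b y)%:E)%E); last first.
      by apply: integrable_fin_num => //; exact: integrable_expw.
    by rewrite -EFinM lee_fin mulrAC.
apply: integrable_lty => //.
apply: (@integrable_dom b (`|C| * Iexpw b) (fun m => `|C| * Iexpw b * expw b m)) => // [|m].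
  by apply: measurable_funM => //; exact: measurable_expw.
by rewrite ger0_norm// !mulr_ge0 ?expw_ge0 ?Iexpw_ge0.
Qed.

Section real.
Variable g : R * R -> R.
Hypotheses (mg : measurable_fun setT g)
  (gC : forall x y, `|g (x, y)| <= C * expw b x * expw b y).

Lemma integrable_sec1 x : mu.-integrable setT (EFin \o (fun y => g (x, y))).
Proof.
apply: (@integrable_dom b (C * expw b x)) => //.
by apply: measurableT_comp mg _; exact: pair1_measurable.
Qed.

Lemma integrable_sec2 y : mu.-integrable setT (EFin \o (fun x => g (x, y))).
Proof.
apply: (@integrable_dom b (C * expw b y)) => //.
  by apply: measurableT_comp mg _; exact: pair2_measurable.
by move=> m; rewrite mulrAC.
Qed.

Lemma Rintegral_fubini :
  (\int[mu]_x (\int[mu]_y g (x, y)))%R = (\int[mu]_y (\int[mu]_x g (x, y)))%R.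
Proof.
rewrite /Rintegral; congr fine.
transitivity (\int[mu]_x \int[mu]_y (g (x, y))%:E)%E.
  by apply: eq_integral => x _; rewrite fineK//; apply: integrable_fin_num => //; exact: integrable_sec1.
rewrite (@Fubini _ _ _ _ R mu mu (EFin \o g)); last exact: integrable_prod_dom.
by apply: eq_integral => y _; rewrite fineK//; apply: integrable_fin_num => //; exact: integrable_sec2.
Qed.

Lemma measurable_Rintegral1 : measurable_fun setT (fun x => (\int[mu]_y g (x, y))%R).
Proof.
apply/measurable_EFinP; rewrite (_ : _ \o _ = (fun x => \int[mu]_y (g (x, y))%:E)%E); last first.
  by apply/funext => x /=; rewrite fineK//; apply: integrable_fin_num => //; exact: integrable_sec1.
apply: (@measurable_fubini_F _ _ _ _ R mu mu (EFin \o g)); exact: integrable_prod_dom.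
Qed.

End real.

Variable f : R * R -> R[i].
Hypotheses (mf : cmeas f)
  (fC : forall x y, normc (f (x, y)) <= C * expw b x * expw b y).

Lemma cintegral_fubini :
  cintegral (fun x => cintegral (fun y => f (x, y))) =
  cintegral (fun y => cintegral (fun x => f (x, y))).
Proof.
case: mf => fr fi; rewrite {1 3}/cintegral/=.
rewrite (@Rintegral_fubini (fun z => complex.Re (f z)))//; last first.
  by move=> x y; exact: le_trans (normr_Re _) (fC x y).
rewrite (@Rintegral_fubini (fun z => complex.Im (f z)))//.
by move=> x y; exact: le_trans (normr_Im _) (fC x y).
Qed.

Lemma cmeas_cintegral1 : cmeas (fun x => cintegral (fun y => f (x, y))).
Proof.
case: mf => fr fi; split => /=.
  apply: (@measurable_Rintegral1 (fun z => complex.Re (f z))) => // x y.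
  exact: le_trans (normr_Re _) (fC x y).
apply: (@measurable_Rintegral1 (fun z => complex.Im (f z))) => // x y.
exact: le_trans (normr_Im _) (fC x y).
Qed.

End fubini.

End complex_integral.

(** * The inverse Fourier transform on a strip *)

Section complex_exponential.
Context {R : realType}.
Implicit Types (z w : R[i]).

Lemma cexpD z w : cexp (z + w) = cexp z * cexp w.
Proof.
case: z w => a b [c d]; rewrite /cexp/=; apply/eqP; rewrite eq_complex/=.
by rewrite expRD cosD sinD; apply/andP; split; apply/eqP; ring.
Qed.

Lemma normc_cexp z : normc (cexp z) = expR (complex.Re z).
Proof.
rewrite /cexp/normc/= !exprMn -mulrDr cos2Dsin2 mulr1 sqrtr_sqr ger0_norm//.
Qed.

Lemma mvt0_le (f f' : R -> R) (y g : R) : (forall t, is_derive t (1 : R) f (f' t)) ->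
  (forall t, `|t| <= `|y| -> `|f' t| <= g) -> `|f y - f 0| <= g * `|y|.
Proof.
move=> df f'g.
have cf a b : {within `[a, b], continuous f}.
  apply: continuous_subspaceT => x; apply: differentiable_continuous.
  by apply/derivable1_diffP; case: (df x).
have [y0|/ltW y0] := leP 0 y.
  have [x xy ->] := MVT_segment y0 (fun x _ => df x) (cf 0 y).
  rewrite subr0 normrM ler_wpM2r//; apply: f'g; rewrite !ger0_norm//.
    by move: xy; rewrite in_itv/= => /andP[].
  by move: xy; rewrite in_itv/= => /andP[].
have [x xy] := MVT_segment y0 (fun x _ => df x) (cf y 0).
rewrite distrC => ->; rewrite sub0r normrM normrN ler_wpM2r//; apply: f'g.
move: xy; rewrite in_itv/= => /andP[yx x0].
by rewrite !ler0_norm// lerN2.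
Qed.

Lemma sin_le_id (y : R) : `|sin y| <= `|y|.
Proof.
have := @mvt0_le sin cos y 1; rewrite sin0 subr0 mul1r; apply => t.
by move=> _; rewrite ler_norml cos_geN1 cos_le1.
Qed.

Lemma cos_sub1_le (y : R) : `|cos y - 1| <= `|y| ^+ 2.
Proof.
have := @mvt0_le cos (fun t => - sin t) y `|y|; rewrite cos0 expr2; apply => t ty.
by rewrite normrN (le_trans (sin_le_id _)).
Qed.

Lemma cos_sub1_le' (y : R) : `|cos y - 1| <= `|y|.
Proof.
have := @mvt0_le cos (fun t => - sin t) y 1; rewrite cos0 mul1r; apply => t ty.
by rewrite normrN ler_norml sin_geN1 sin_le1.
Qed.

Lemma sin_sub_le (y : R) : `|sin y - y| <= `|y| ^+ 2.
Proof.
have := @mvt0_le (fun t => sin t - t) (fun t => cos t - 1) y `|y|.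
rewrite sin0 !subr0 expr2; apply => t ty.
by apply: (le_trans (cos_sub1_le' t)).
Qed.

Lemma expR_sub1_le (x : R) : `|expR x - 1| <= expR `|x| * `|x|.
Proof.
have := @mvt0_le expR expR x (expR `|x|); rewrite expR0; apply => t tx.
by rewrite ger0_norm ?expR_ge0// ler_expR (le_trans (ler_norm _)).
Qed.

Lemma expR_taylor2 (x : R) : `|expR x - 1 - x| <= expR `|x| * `|x| ^+ 2.
Proof.
have := @mvt0_le (fun t => expR t - 1 - t) (fun t => expR t - 0 - 1) x (expR `|x| * `|x|).
rewrite expR0 subrr !subr0 expr2 mulrA; apply => t tx.
rewrite subr0 (le_trans (expR_sub1_le _))//.
by rewrite ler_pM ?expR_ge0// ler_expR.
Qed.

(** The real and imaginary parts each split into two products of one-variable remainders of [expR],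
    [cos] and [sin], whence the factor 4. *)
Lemma cexp_taylor2 w : normc (cexp w - 1 - w) <= 4 * normc w ^+ 2 * expR (normc w).
Proof.
apply: (le_trans (normc_le_ReIm _)).
have hx := normr_Re w; have hy := normr_Im w.
move: hx hy; set n := normc w; case: w @n => x y; set n := normc _ => /= hx hy.
have n0 : 0 <= n by exact: normc_ge0.
have ex : expR `|x| <= expR n by rewrite ler_expR.
have e0 : 0 <= expR n by exact: expR_ge0.
have x2 : `|x| ^+ 2 <= n ^+ 2 by rewrite lerXn2r ?nnegrE.
have y2 : `|y| ^+ 2 <= n ^+ 2 by rewrite lerXn2r ?nnegrE.
have n20 : 0 <= n ^+ 2 by rewrite sqr_ge0.
have -> : 4 * n ^+ 2 * expR n = (expR n * n ^+ 2 + expR n * n ^+ 2)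
  + (expR n * n ^+ 2 + expR n * n ^+ 2) by ring.
apply: lerD.
  have -> : expR x * cos y - 1 - x = (expR x - 1 - x) * cos y + (1 + x) * (cos y - 1) by ring.
  apply: (le_trans (ler_normD _ _)); apply: lerD; rewrite normrM.
    rewrite -[leRHS]mulr1; apply: ler_pM => //.
      by apply: (le_trans (expR_taylor2 x)); apply: ler_pM; rewrite ?expR_ge0.
    by rewrite ler_norml cos_geN1 cos_le1.
  apply: ler_pM => //; last exact: le_trans (cos_sub1_le y) y2.
  apply: (le_trans (ler_normD _ _)); rewrite normr1.
  exact: le_trans (expR_ge1Dx _) ex.
have -> : expR x * sin y - 0 - y = (expR x - 1) * sin y + (sin y - y) by ring.
apply: (le_trans (ler_normD _ _)); apply: lerD.
  rewrite normrM expr2 mulrA; apply: ler_pM => //.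
    by apply: (le_trans (expR_sub1_le x)); apply: ler_pM; rewrite ?expR_ge0.
  exact: le_trans (sin_le_id y) hy.
apply: (le_trans (sin_sub_le y)); apply: (le_trans y2).
by rewrite ler_peMl// -expR0 ler_expR.
Qed.

End complex_exponential.

(** A quadratic remainder is what the estimates below produce. The target [E] is arbitrary so that
    the criterion serves both scalar transforms and functions with values in O_b. *)
Lemma quad_derivable {R : realType} (E : normedModType R[i]) (F : R[i] -> E) z (D : E)
    (C e : R) : 0 < e ->
  (forall h, normc h <= e -> `|F (z + h) - F z - h *: D| <= (C * normc h ^+ 2)%:C) ->
  derivable F z 1 /\ derive1 F z = D.
Proof.
move=> e0 FD.
suff H : h^-1 *: (F (h + z) - F z) @[h --> 0^'] --> D.
  split; last by apply: (cvg_lim _ H); exact: norm_hausdorff.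
  apply/cvg_ex; exists D; rewrite (_ : (fun _ => _) = (fun h => h^-1 *: (F (h + z) - F z)))//.
  by apply/funext => h /=; rewrite -[h%:A]/(h * 1) mulr1.
apply/cvgrPdist_le => /= t; rewrite ltcE/= => /andP[/eqP ti tr].
(* The second entry turns the error C |h| of the difference quotient into at most the prescribed
   [t]; the added 1 allows [C = 0]. *)
pose r := Order.min e (complex.Re t / (`|C| + 1)).
have r0 : 0 < r by rewrite lt_min e0 divr_gt0// ltr_wpDl.
rewrite /dnbhs /within /=; apply/nbhs_ballP; exists r%:C => /=; first by rewrite ltcR.
move=> h /=; rewrite /ball/= sub0r normrN normcE ltcR => hr h0.
have hn0 : 0 < normc h by rewrite lt_neqAle normc_ge0 andbT eq_sym; apply: contra_neq h0 => /eq0_normc.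
have -> : D - h^-1 *: (F (h + z) - F z) = - (h^-1 *: (F (z + h) - F z - h *: D)).
  by rewrite [h + z]addrC [in RHS]scalerBr scalerA mulVf// scale1r opprB.
rewrite normrN normrZ normcE normcV.
have he : normc h <= e by rewrite (le_trans (ltW hr))// ge_min lexx.
have := FD _ he => /(ler_wpM2l _) H.
apply: le_trans (H _ _) _; first by rewrite lecR invr_ge0 ltW.
rewrite -rmorphM lecE/= ti eqxx/= expr2 mulrCA mulKf ?gt_eqF//.
apply: (le_trans (ler_wpM2r (normc_ge0 _) (ler_norm C))).
apply: (@le_trans _ _ ((`|C| + 1) * r)).
  by apply: ler_pM => //; [exact: normc_ge0|rewrite lerDl|exact: ltW].
by rewrite mulrC -ler_pdivlMr ?ltr_wpDl// ge_min lexx orbT.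
Qed.

Section fourier.
Context {R : realType}.
Implicit Types (a b C : R) (f g A : R -> R[i]) (z : R[i]).

Lemma dominated_weaken a b C C' f : dominated b C f -> a <= b -> C <= C' ->
  dominated a C' f.
Proof.
move=> [mf fC] ab CC'; split => // m; apply: (le_trans (fC m)).
apply: ler_pM => //; rewrite ?expw_ge0 ?(dominated_ge0 (conj mf fC))//.
by rewrite ler_expR lerN2 ler_wpM2r.
Qed.

Lemma dominatedD b C C' f g : dominated b C f -> dominated b C' g ->
  dominated b (C + C') (fun m => f m + g m).
Proof.
move=> [mf fC] [mg gC]; split; first exact: cmeasD.
by move=> m; rewrite mulrDl (le_trans (normcD _ _))// lerD.
Qed.

Lemma dominatedZ b C f (c : R[i]) : dominated b C f ->
  dominated b (normc c * C) (fun m => c * f m).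
Proof.
move=> [mf fC]; split; first exact: cmeasZ.
by move=> m; rewrite normcM -mulrA ler_wpM2l ?normc_ge0.
Qed.

Lemma dominated0 b : dominated b 0 (fun=> 0).
Proof. by split; [exact: cmeas_cst|move=> m; rewrite normc0 mul0r]. Qed.

Lemma dominatedM b C C' f g : cmeas f -> (forall m, normc (f m) <= C) ->
  dominated b C' g -> dominated b (C * C') (fun m => f m * g m).
Proof.
move=> mf fC [mg gC]; split; first exact: cmeasM.
by move=> m; rewrite normcM -mulrA ler_pM ?normc_ge0.
Qed.

Lemma dominated_sum b I (r : seq I) (P : pred I) (C : I -> R) (F : I -> R -> R[i]) :
  (forall i, P i -> dominated b (C i) (F i)) ->
  dominated b (\sum_(i <- r | P i) C i) (fun m => \sum_(i <- r | P i) F i m).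
Proof.
move=> dF; split; first by apply: cmeas_sum => i /dF[].
move=> m; rewrite mulr_suml; apply: (le_trans (normc_sum _ _ _)).
by apply: ler_sum => i /dF[_]; apply.
Qed.

Lemma linear_le_exp a : 0 < a -> forall m : R, `|m| * expw a m <= a^-1.
Proof.
move=> a0 m; rewrite /expw expRN ler_pdivrMr ?expR_gt0// mulrC ler_pdivlMr//.
apply: le_trans (expR_ge1Dx _); rewrite mulrC; lra.
Qed.

Lemma dominated_imag a b C f : dominated b C f -> a < b ->
  dominated a (C * (b - a)^-1) (fun m => (0 +i* m) * f m).
Proof.
move=> [mf fC] ab; have C0 := dominated_ge0 (conj mf fC).
split; first by apply: cmeasM => //; exact: cmeas_imaginary.
move=> m; rewrite normcM.
have -> : normc (0 +i* m) = `|m| by rewrite /normc/= expr0n add0r sqrtr_sqr.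
apply: (le_trans (ler_wpM2l (normr_ge0 m) (fC m))).
have -> : expw b m = expw (b - a) m * expw a m.
  by rewrite /expw -expRD; congr expR; ring.
rewrite mulrCA -mulrA ler_wpM2l// mulrA ler_wpM2r ?expw_ge0//.
by apply: linear_le_exp; rewrite subr_gt0.
Qed.

(** Decay at every rate below [b]. Unlike [dominated b], this is stable under multiplication by
    polynomials in [m], hence under differential operators after transformation. *)
Definition decays b f := forall a, 0 < a < b -> exists C, dominated a C f.

Lemma decaysD b f g : decays b f -> decays b g -> decays b (fun m => f m + g m).
Proof.
move=> df dg a ab; have [C fC] := df a ab; have [C' gC] := dg a ab.
by exists (C + C'); exact: dominatedD.
Qed.

Lemma decaysZ b f (c : R[i]) : decays b f -> decays b (fun m => c * f m).
Proof.
by move=> df a /df[C fC]; exists (normc c * C); exact: dominatedZ.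
Qed.

Lemma decays0 b : decays b (fun=> 0).
Proof. by move=> a _; exists 0; exact: dominated0. Qed.

Lemma decays_sum b I (r : seq I) (P : pred I) (F : I -> R -> R[i]) :
  (forall i, P i -> decays b (F i)) -> decays b (fun m => \sum_(i <- r | P i) F i m).
Proof.
move=> dF; elim: r => [|i r IH].
  by under eq_fun do rewrite big_nil; exact: decays0.
under eq_fun do rewrite big_cons.
have [Pi|nPi] := boolP (P i) => //.
by apply: decaysD => //; exact: dF.
Qed.

Lemma decays_imag b f : decays b f -> decays b (fun m => (0 +i* m) * f m).
Proof.
move=> df a /andP[a0 ab]; have ab' : a < (a + b) / 2 by lra.
have [|C fC] := df ((a + b) / 2); first by apply/andP; split; lra.
by eexists; apply: dominated_imag fC ab'.
Qed.

Lemma decays_imagX b f n : decays b f -> decays b (fun m => (0 +i* m) ^+ n * f m).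
Proof.
move=> df; elim: n => [|n IH].
  by under eq_fun do rewrite expr0 mul1r.
by under eq_fun do rewrite exprS -mulrA; exact: decays_imag.
Qed.

Lemma decays_horner b f (P : {poly R[i]}) : decays b f ->
  decays b (fun m => P.[0 +i* m] * f m).
Proof.
move=> df; under eq_fun do rewrite horner_coef mulr_suml.
apply: decays_sum => i _; under eq_fun do rewrite -mulrA.
by apply: decaysZ; exact: decays_imagX.
Qed.

Lemma decays_dominated b C f : dominated b C f -> decays b f.
Proof.
by move=> fC a /andP[_ ab]; exists C; apply: dominated_weaken fC _ _ => //; exact: ltW.
Qed.

Definition fkernel z (m : R) : R[i] := cexp ((0 +i* m) * z).

Lemma cmeas_fkernel z : cmeas (fkernel z).
Proof.
apply: cmeas_cexp; apply: cmeasM; [exact: cmeas_imaginary|exact: cmeas_cst].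
Qed.

Lemma normc_fkernel a z m : `|complex.Im z| <= a -> normc (fkernel z m) <= expw (- a) m.
Proof.
move=> za; rewrite /fkernel normc_cexp /expw ler_expR mulNr opprK.
case: z za => x y /= ya; rewrite mul0r sub0r -mulrN.
by apply: (le_trans (ler_norm _)); rewrite normrM normrN mulrC ler_wpM2r.
Qed.

Lemma dominated_fkernel a b C f z : dominated b C f -> `|complex.Im z| <= a ->
  dominated (b - a) C (fun m => f m * fkernel z m).
Proof.
move=> [mf fC] za; split; first by apply: cmeasM => //; exact: cmeas_fkernel.
move=> m; rewrite normcM.
apply: (le_trans (ler_pM (normc_ge0 _) (normc_ge0 _) (fC m) (normc_fkernel m za))).
by rewrite -mulrA /expw -expRD le_eqVlt; apply/orP; left; apply/eqP; congr (_ * expR _); ring.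
Qed.

Definition fcst : R[i] := ((Num.sqrt (2 * pi))^-1)%:C.

Lemma inv_fourierE f z : inv_fourier f z = fcst * cintegral (fun m => f m * fkernel z m).
Proof. by []. Qed.

Lemma eq_inv_fourier f g z : f =1 g -> inv_fourier f z = inv_fourier g z.
Proof. by move=> /funext ->. Qed.

Lemma inv_fourierD b C C' f g z : dominated b C f -> dominated b C' g ->
  `|complex.Im z| < b ->
  inv_fourier (fun m => f m + g m) z = inv_fourier f z + inv_fourier g z.
Proof.
move=> df dg zb; rewrite !inv_fourierE -mulrDr; congr (_ * _).
under eq_cintegral do rewrite mulrDl.
by apply: cintegralD (dominated_fkernel df (lexx _)) (dominated_fkernel dg (lexx _)) _;
  rewrite subr_gt0.
Qed.

Lemma inv_fourierZ b C f (c : R[i]) z : dominated b C f -> `|complex.Im z| < b ->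
  inv_fourier (fun m => c * f m) z = c * inv_fourier f z.
Proof.
move=> df zb; rewrite !inv_fourierE mulrCA; congr (_ * _).
under eq_cintegral do rewrite -mulrA.
by apply: cintegralZ (dominated_fkernel df (lexx _)) _; rewrite subr_gt0.
Qed.

Lemma inv_fourier0 z : inv_fourier (fun=> 0) z = 0 :> R[i].
Proof.
rewrite (_ : (fun=> 0) = (fun m : R => (0 : R[i]) * 0)); last by apply/funext => m; rewrite mulr0.
have zb : `|complex.Im z| < `|complex.Im z| + 1 by rewrite ltrDl.
by rewrite (inv_fourierZ _ (dominated0 _) zb) mul0r.
Qed.

Definition fbound (e : R) : R := normc fcst * (2 * Iexpw e).

Lemma fbound_ge0 e : 0 <= fbound e.
Proof. by rewrite mulr_ge0 ?normc_ge0// mulr_ge0 ?Iexpw_ge0. Qed.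

Lemma inv_fourier_le a b C f z : dominated b C f -> `|complex.Im z| <= a -> a < b ->
  normc (inv_fourier f z) <= fbound (b - a) * C.
Proof.
move=> df za ab; rewrite inv_fourierE normcM.
have -> : fbound (b - a) * C = normc fcst * (2 * C * Iexpw (b - a)) by rewrite /fbound; ring.
rewrite ler_wpM2l ?normc_ge0//.
by apply: cintegral_le (dominated_fkernel df za) _; rewrite subr_gt0.
Qed.

Lemma fkernel_taylor2 z h m : normc (fkernel (z + h) m - fkernel z m - h * ((0 +i* m) * fkernel z m))
  <= 4 * normc h ^+ 2 * (`|m| ^+ 2 * normc (fkernel z m) * expw (- normc h) m).
Proof.
rewrite /fkernel mulrDr cexpD; set w := (0 +i* m) * h; set k := cexp _.
have -> : k * cexp w - k - h * ((0 +i* m) * k) = k * (cexp w - 1 - w) by rewrite /w; ring.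
rewrite normcM; have wn : normc w = `|m| * normc h.
  by rewrite normcM; congr (_ * _); rewrite /normc/= expr0n add0r sqrtr_sqr.
apply: (le_trans (ler_wpM2l (normc_ge0 _) (cexp_taylor2 w))).
rewrite /expw mulNr opprK [normc h * _]mulrC wn.
by rewrite le_eqVlt; apply/orP; left; apply/eqP; rewrite !exprMn; ring.
Qed.

(** Differentiation under the integral sign: the second-order remainder of the kernel costs |m|^2
    exp(|h| |m|), which the weight absorbs while [z] stays away from the boundary of the strip. *)
Lemma inv_fourier_taylor2 b C f z : dominated b C f -> `|complex.Im z| < b ->
  exists K e, 0 < e /\ forall h, normc h <= e ->
  normc (inv_fourier f (z + h) - inv_fourier f z -
    h * inv_fourier (fun m => (0 +i* m) * f m) z) <= K * normc h ^+ 2.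
Proof.
move=> df zb; set y := `|complex.Im z| in zb *.
(* An eighth of the distance to the boundary: one share pays for exp(|h| |m|), two for |m|^2, one is
   the rate left for integrability, and the rest is slack. *)
pose e := (b - y) / 8; have e0 : 0 < e by rewrite /e; lra.
have C0 := dominated_ge0 df.
exists (normc fcst * (2 * (4 * C * e^-1 ^+ 2) * Iexpw e)), e; split => // h he.
have dk : forall w, normc (w - z) <= e -> `|complex.Im w| <= y + e.
  move=> w wz; rewrite -[w](subrK z) addrC raddfD/= (le_trans (ler_normD _ _))//.
  by rewrite lerD2l (le_trans (normr_Im _)).
pose d (m : R) : R[i] := f m * (fkernel (z + h) m - fkernel z m - h * ((0 +i* m) * fkernel z m)).
have d1 : dominated (b - (y + e)) C (fun m => f m * fkernel (z + h) m).
  by apply: dominated_fkernel => //; apply: dk; rewrite [z + h]addrC addrK.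
have d2 : dominated (b - (y + e)) C (fun m => f m * fkernel z m).
  by apply: dominated_fkernel => //; apply: dk; rewrite subrr normc0 ltW.
have d3' : dominated (b - e) (C * (b - (b - e))^-1) (fun m => (0 +i* m) * f m).
  by apply: dominated_imag => //; lra.
have d3 : dominated (b - e - (y + e)) (C * (b - (b - e))^-1) (fun m => (0 +i* m) * f m * fkernel z m).
  by apply: dominated_fkernel => //; apply: dk; rewrite subrr normc0 ltW.
pose b1 := b - e - (y + e).
have b10 : 0 < b1 by rewrite /b1 /e; lra.
have b1le : b1 <= b - (y + e) by rewrite /b1; lra.
have {}d1 := dominated_weaken d1 b1le (lexx _).
have {}d2 := dominated_weaken d2 b1le (lexx _).
have dn2 := dominatedZ (-1) d2; have dn3 := dominatedZ (- h) d3.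
have -> : inv_fourier f (z + h) - inv_fourier f z - h * inv_fourier (fun m => (0 +i* m) * f m) z
    = fcst * cintegral d.
  rewrite !inv_fourierE mulrCA -!mulrBr; congr (_ * _).
  rewrite -[X in _ = X](_ : cintegral (fun m => f m * fkernel (z + h) m + -1 * (f m * fkernel z m) + - h * ((0 +i* m) * f m * fkernel z m)) = _).
    rewrite (cintegralD (dominatedD d1 dn2) dn3 b10) (cintegralD d1 dn2 b10).
    by rewrite (cintegralZ _ d2 b10) (cintegralZ _ d3 b10); ring.
  by apply: eq_cintegral => m; rewrite /d; ring.
rewrite normcM -mulrA ler_wpM2l ?normc_ge0//.
have dd : dominated e (4 * C * e^-1 ^+ 2 * normc h ^+ 2) d.
  split.
    apply: cmeasM; first by case: df.
    apply: cmeasB; first by apply: cmeasB; exact: cmeas_fkernel.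
    apply: cmeasZ; apply: cmeasM; [exact: cmeas_imaginary|exact: cmeas_fkernel].
  move=> m; rewrite normcM; case: df => _ /(_ m) fm.
  apply: (le_trans (ler_pM (normc_ge0 _) (normc_ge0 _) fm (fkernel_taylor2 _ _ _))).
  have k1 : normc (fkernel z m) <= expw (- y) m by exact: normc_fkernel.
  have k2 : expw (- normc h) m <= expw (- e) m.
    by rewrite ler_expR lerN2 ler_wpM2r// lerN2.
  have k3 : `|m| ^+ 2 <= e^-1 ^+ 2 * expw (- (2 * e)) m.
    have -> : expw (- (2 * e)) m = (expw e m)^-1 ^+ 2.
      by rewrite /expw -expRN -expRM_natl; congr expR; rewrite mulNr !opprK; ring.
    rewrite -exprMn lerXn2r ?nnegrE ?mulr_ge0 ?invr_ge0 ?expw_ge0 ?(ltW e0)//.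
    by rewrite ler_pdivlMr ?expw_gt0//; exact: linear_le_exp.
  have k0 : expw b m * (expw (- (2 * e)) m * expw (- y) m * expw (- e) m) <= expw e m.
    rewrite /expw -!expRD ler_expR.
    have -> : - (b * `|m|) + (- (- (2 * e) * `|m|) + - (- y * `|m|) + - (- e * `|m|)) = - ((b - y - 3 * e) * `|m|) by ring.
    by rewrite lerN2 ler_wpM2r// /e; lra.
  apply: (@le_trans _ _ (C * expw b m * (4 * normc h ^+ 2 *
     (e^-1 ^+ 2 * expw (- (2 * e)) m * expw (- y) m * expw (- e) m)))).
    rewrite ler_wpM2l ?mulr_ge0 ?expw_ge0// ler_wpM2l ?mulr_ge0 ?normc_ge0//.
    apply: ler_pM; rewrite ?mulr_ge0 ?normc_ge0 ?sqr_ge0 ?expw_ge0//.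
    by apply: ler_pM; rewrite ?normc_ge0 ?sqr_ge0.
  rewrite -[X in X <= _](_ : 4 * C * e^-1 ^+ 2 * normc h ^+ 2 *
      (expw b m * (expw (- (2 * e)) m * expw (- y) m * expw (- e) m)) = _); last by ring.
  by rewrite ler_wpM2l// !mulr_ge0 ?normc_ge0 ?invr_ge0 ?(ltW e0).
apply: (le_trans (cintegral_le dd e0)).
by rewrite le_eqVlt; apply/orP; left; apply/eqP; ring.
Qed.

Lemma inv_fourier_derive b f z : decays b f -> strip b z ->
  derivable (inv_fourier f) z 1 /\
  derive1 (inv_fourier f) z = inv_fourier (fun m => (0 +i* m) * f m) z.
Proof.
rewrite /strip/= => df zb; pose a := (`|complex.Im z| + b) / 2.
have [|C fC] := df a; first by apply/andP; split; rewrite /a; have := normr_ge0 (complex.Im z); lra.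
have za : `|complex.Im z| < a by rewrite /a; lra.
have [K [e [e0 He]]] := inv_fourier_taylor2 fC za.
by apply: (quad_derivable e0 (C := K)) => h /He; rewrite normcE lecR.
Qed.

Lemma strip_ball b z : strip b z -> exists2 e : R, 0 < e & forall h, normc h <= e -> strip b (z + h).
Proof.
rewrite /strip/= => zb; exists ((b - `|complex.Im z|) / 2); first by lra.
move=> h he; rewrite raddfD/= (le_lt_trans (ler_normD _ _))//.
have := normr_Im h; lra.
Qed.

Lemma near_derive1 (E : normedModType R[i]) (F G : R[i] -> E) z (e : R) : 0 < e ->
  (forall h, normc h <= e -> F (z + h) = G (z + h)) ->
  (derivable G z 1 -> derivable F z 1) /\ derive1 F z = derive1 G z.
Proof.
move=> e0 FG.
have FGn : {near z, F =1 G}.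
  apply/nbhs_ballP; exists e%:C => /=; first by rewrite ltcR.
  move=> w; rewrite /ball/= normcE ltcR normcBC => wz.
  by rewrite -[w](subrK z) addrC FG// ltW.
split; last by rewrite !derive1E; apply: near_eq_derive => //; rewrite oner_eq0.
by apply: near_eq_derivable => //; rewrite ?oner_eq0//; apply: filterS FGn.
Qed.

Lemma derive1n_inv_fourier b f n z : decays b f -> strip b z ->
  derive1n n (inv_fourier f) z = inv_fourier (fun m => (0 +i* m) ^+ n * f m) z.
Proof.
move=> df; elim: n z => [|n IH] z zb.
  by rewrite derive1n0; apply: eq_inv_fourier => m; rewrite expr0 mul1r.
rewrite derive1nS.
have [e e0 He] := strip_ball zb.
(* The induction hypothesis holds only on the strip, so it is differentiated on a disc around [z]
   inside it. *)
have [_ ->] := near_derive1 e0 (fun h hh => IH _ (He h hh)).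
have [_ ->] := inv_fourier_derive (decays_imagX n df) zb.
by apply: eq_inv_fourier => m; rewrite exprS mulrA.
Qed.

Lemma inv_fourier_sum b I (r : seq I) (P : pred I) (F : I -> R -> R[i]) z :
  (forall i, P i -> decays b (F i)) -> strip b z ->
  inv_fourier (fun m => \sum_(i <- r | P i) F i m) z = \sum_(i <- r | P i) inv_fourier (F i) z.
Proof.
rewrite /strip/= => dF zb; pose a := (`|complex.Im z| + b) / 2.
have ab : 0 < a < b by apply/andP; split; rewrite /a; have := normr_ge0 (complex.Im z); lra.
have za : `|complex.Im z| < a by rewrite /a; lra.
elim: r => [|i r IH].
  by under eq_fun do rewrite big_nil; rewrite big_nil inv_fourier0.
under eq_fun do rewrite big_cons; rewrite big_cons.
have [Pi|nPi] := boolP (P i) => //.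
have [C Ci] := dF i Pi a ab.
have [C' C'i] := decays_sum r dF ab.
by rewrite (inv_fourierD Ci C'i za) IH.
Qed.

Lemma inv_fourier_decaysZ b f (c : R[i]) z : decays b f -> strip b z ->
  inv_fourier (fun m => c * f m) z = c * inv_fourier f z.
Proof.
rewrite /strip/= => df zb; pose a := (`|complex.Im z| + b) / 2.
have ab : 0 < a < b by apply/andP; split; rewrite /a; have := normr_ge0 (complex.Im z); lra.
have za : `|complex.Im z| < a by rewrite /a; lra.
have [C fC] := df _ ab; exact: inv_fourierZ fC za.
Qed.

Lemma inv_fourier_decaysD b f g z : decays b f -> decays b g -> strip b z ->
  inv_fourier (fun m => f m + g m) z = inv_fourier f z + inv_fourier g z.
Proof.
rewrite /strip/= => df dg zb; pose a := (`|complex.Im z| + b) / 2.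
have ab : 0 < a < b by apply/andP; split; rewrite /a; have := normr_ge0 (complex.Im z); lra.
have za : `|complex.Im z| < a by rewrite /a; lra.
have [C fC] := df _ ab; have [C' gC] := dg _ ab; exact: inv_fourierD fC gC za.
Qed.

Lemma diffop_inv_fourier b f (P : {poly R[i]}) z : decays b f -> strip b z ->
  diffop P (inv_fourier f) z = inv_fourier (fun m => P.[0 +i* m] * f m) z.
Proof.
move=> df zb; rewrite /diffop.
under eq_bigr do rewrite (derive1n_inv_fourier _ df zb).
rewrite -[RHS](_ : inv_fourier (fun m => \sum_(i < size P) P`_i * ((0 +i* m) ^+ i * f m)) z = _).
  rewrite (inv_fourier_sum _ (b := b))//; last first.
    by move=> i _; apply: decaysZ; exact: decays_imagX.
  by apply: eq_bigr => i _; rewrite (inv_fourier_decaysZ _ (decays_imagX _ df) zb).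
apply: eq_inv_fourier => m; rewrite horner_coef mulr_suml.
by apply: eq_bigr => i _; rewrite mulrA.
Qed.

End fourier.

(** * Polynomials on the imaginary axis *)

Section polynomial_growth.
Context {R : realType}.
Implicit Types (P : {poly R[i]}) (m : R).

Lemma linear_factor_lower (z : R[i]) : complex.Re z != 0 ->
  exists2 c : R, 0 < c & forall m, c * (1 + `|m|) <= normc ((0 +i* m) - z).
Proof.
move=> z0; have a0 : 0 < `|complex.Re z| by rewrite normr_gt0.
(* Write 1 + |m| as (1 + |Im z|) + (|m| - |Im z|): the real part of the factor controls the first
   summand, its imaginary part the second. *)
pose k := (1 + `|complex.Im z|) / `|complex.Re z| + 1.
have k0 : 0 < k by rewrite ltr_wpDl// divr_ge0// addr_ge0.
exists k^-1; first by rewrite invr_gt0.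
move=> m; rewrite mulrC ler_pdivrMr//; set w := _ - z.
have h1 : `|complex.Re z| <= normc w.
  by have := normr_Re w; rewrite /w raddfB/= sub0r normrN.
have h2 : `|m| - `|complex.Im z| <= normc w.
  by apply: le_trans (normr_Im w); rewrite /w raddfB/= lerB_dist.
have h3 : 1 + `|complex.Im z| <= (1 + `|complex.Im z|) / `|complex.Re z| * normc w.
  by rewrite -mulrA ler_peMr ?addr_ge0// mulrC ler_pdivlMr// mul1r.
rewrite /k mulrDr mulr1 [normc w * _]mulrC; lra.
Qed.

(** Over the complex numbers [P] splits into linear factors; having no zero on the imaginary axis,
    it has only roots with nonzero real part, and each factor is then at least a multiple of 1 +
    |m|. *)
Lemma poly_lower P : (forall m, P.[0 +i* m] != 0) ->
  exists2 c : R, 0 < c & forall m, c * (1 + `|m|) ^+ (size P).-1 <= normc P.[0 +i* m].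
Proof.
move=> P0; have [r Pr] := closed_field_poly_normal P.
have lc0 : lead_coef P != 0.
  by rewrite lead_coef_eq0; apply/eqP => PE; have := P0 0; rewrite PE horner0 eqxx.
have r0 z : z \in r -> complex.Re z != 0.
  move=> zr; apply/eqP => z0; have := P0 (complex.Im z).
  have zE : z = 0 +i* complex.Im z by case: z z0 {zr} => x y /= ->.
  rewrite -zE; apply/negP; rewrite negbK -/(root P z) Pr rootZ//.
  by rewrite root_prod_XsubC.
have -> : (size P).-1 = size r by rewrite Pr size_scale// size_prod_XsubC.
have [c c0 Hc] : exists2 c : R, 0 < c & forall m, c * (1 + `|m|) ^+ (size r) <=
    normc (\prod_(z <- r) ((0 +i* m) - z)).
  elim: r r0 {Pr} => [|z r IH] r0.
    by exists 1 => // m; rewrite expr0 big_nil normc1 mulr1.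
  have [|c c0 Hc] := IH; first by move=> w wr; apply: r0; rewrite inE wr orbT.
  have [|c' c'0 Hc'] := linear_factor_lower (z := z); first by apply: r0; rewrite inE eqxx.
  exists (c' * c); first exact: mulr_gt0.
  move=> m; rewrite big_cons normcM/= exprS mulrACA ler_pM//.
    by rewrite mulr_ge0 ?(ltW c'0)// addr_ge0.
  by rewrite mulr_ge0 ?(ltW c0)// exprn_ge0// addr_ge0.
exists (normc (lead_coef P) * c).
  rewrite mulr_gt0// lt_neqAle normc_ge0 andbT eq_sym.
  by apply: contra_neq lc0 => /eq0_normc.
move=> m; rewrite [in leRHS]Pr hornerZ normcM -mulrA ler_wpM2l ?normc_ge0//.
rewrite horner_prod (eq_bigr (fun z => (0 +i* m) - z))// => z _.
by rewrite hornerXsubC.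
Qed.

Lemma poly_upper P n : (size P <= n.+1)%N ->
  exists2 K : R, 0 <= K & forall m, normc P.[0 +i* m] <= K * (1 + `|m|) ^+ n.
Proof.
move=> Pn; exists (\sum_(i < size P) normc P`_i); first by apply: sumr_ge0 => i _; exact: normc_ge0.
move=> m; rewrite horner_coef mulr_suml; apply: (le_trans (normc_sum _ _ _)).
apply: ler_sum => i _; rewrite normcM normcX ler_wpM2l ?normc_ge0//.
have -> : normc (0 +i* m) = `|m| by rewrite /normc/= expr0n add0r sqrtr_sqr.
apply: (@le_trans _ _ ((1 + `|m|) ^+ i)).
  by rewrite lerXn2r ?nnegrE ?addr_ge0// lerDr.
by rewrite ler_weXn2l ?lerDl// -ltnS (leq_trans (ltn_ord i)).
Qed.

Lemma expw_le1 (a m : R) : 0 <= a -> expw a m <= 1.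
Proof. by move=> a0; rewrite /expw -expR0 ler_expR oppr_le0 mulr_ge0. Qed.

Lemma poly_expw n (a b : R) : a < b ->
  exists2 K : R, 0 <= K & forall m, (1 + `|m|) ^+ n * expw b m <= K * expw a m.
Proof.
(* Each of the [n] factors 1 + |m| spends one share [e] of the gap; dividing by [n.+1] also covers
   [n = 0]. *)
move=> ab; pose e := (b - a) / n.+1%:R.
have e0 : 0 < e by rewrite divr_gt0// subr_gt0.
exists ((1 + e^-1) ^+ n); first by rewrite exprn_ge0// addr_ge0// invr_ge0 ltW.
move=> m; have h : (1 + `|m|) * expw e m <= 1 + e^-1.
  by rewrite mulrDl mul1r lerD ?expw_le1 ?(ltW e0)//; exact: linear_le_exp.
apply: (@le_trans _ _ (((1 + `|m|) * expw e m) ^+ n * expw a m)).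
  rewrite exprMn -mulrA ler_wpM2l ?exprn_ge0 ?addr_ge0//.
  rewrite /expw -expRM_natl -expRD ler_expR -[leRHS]opprK lerN2 opprD mulrN !opprK.
  rewrite mulrA -mulrDl ler_wpM2r// -lerBrDr /e mulrCA ler_piMr ?subr_ge0 ?(ltW ab)//.
  by rewrite ler_pdivrMr// mul1r ler_nat.
by rewrite ler_wpM2r ?expw_ge0// lerXn2r ?nnegrE ?mulr_ge0 ?addr_ge0 ?expw_ge0 ?invr_ge0 ?(ltW e0).
Qed.

End polynomial_growth.

(** * Convolution in the frequency variable *)

Section convolution.
Context {R : realType}.
Implicit Types (a b C : R) (f g A : R -> R[i]) (z : R[i]) (P Q : {poly R[i]}).

(** The factor [fcst] is the normalisation for which [inv_fourier_conv] holds without a constant. *)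
Definition fconv A g (m : R) : R[i] := fcst * cintegral (fun s => A (m - s) * g s).

Lemma expw_conv a b (m s : R) : 0 <= a -> a <= b -> expw b (m - s) <= expw a m * expw (- a) s.
Proof.
move=> a0 ab; rewrite /expw -expRD ler_expR mulNr opprK.
have ms : `|m| - `|s| <= `|m - s| by exact: lerB_dist.
suff : a * (`|m| - `|s|) <= b * `|m - s| by rewrite mulrBr; lra.
apply: (@le_trans _ _ (a * `|m - s|)); first exact: ler_wpM2l.
exact: ler_wpM2r.
Qed.

Lemma dominated_conv_slice b C C' c A g (m : R) : dominated b C A -> 0 <= b ->
  dominated c C' g -> dominated c (C * C') (fun s => A (m - s) * g s).
Proof.
move=> [mA AC] b0 dg; apply: dominatedM => //.
  by apply: (cmeas_comp mA); apply: measurable_funB.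
have C0 := dominated_ge0 (conj mA AC).
move=> s; apply: (le_trans (AC _)); rewrite -[leRHS]mulr1 ler_wpM2l//.
exact: expw_le1.
Qed.

Lemma cmeas_conv_kernel b C A g : dominated b C A -> cmeas g ->
  cmeas (fun p : R * R => A (p.1 - p.2) * g p.2).
Proof.
move=> [mA _] mg; apply: cmeasM; last exact: (cmeas_comp mg measurable_snd).
by apply: (cmeas_comp mA); apply: measurable_funB; [exact: measurable_fst|exact: measurable_snd].
Qed.

(** [A] decays only in [m - s]. Giving up half of the rate [c] of [g] transfers that much decay to
    [m], which yields a bound integrable jointly in both variables, as Fubini requires. *)
Lemma conv_kernel_le b c C C' A g (m s : R) : dominated b C A -> dominated c C' g ->
  0 < c -> c <= b ->
  normc (A (m - s) * g s) <= C * C' * expw (c / 2) m * expw (c / 2) s.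
Proof.
move=> dA dg c0 cb; have C0 := dominated_ge0 dA; have C'0 := dominated_ge0 dg.
case: dA dg => _ AC [_ gC]; rewrite normcM.
apply: (le_trans (ler_pM (normc_ge0 _) (normc_ge0 _) (AC _) (gC _))).
rewrite mulrACA -!mulrA; do 2 apply: ler_wpM2l => //.
have c20 : 0 <= c / 2 by lra.
apply: (le_trans (ler_wpM2r (expw_ge0 _ _) (expw_conv m s c20 _))); first by lra.
rewrite -mulrA ler_wpM2l ?expw_ge0// /expw -expRD ler_expR.
by rewrite le_eqVlt; apply/orP; left; apply/eqP; field.
Qed.

Lemma cmeas_fconv b c C C' A g : dominated b C A -> dominated c C' g ->
  0 < c -> c <= b -> cmeas (fconv A g).
Proof.
move=> dA dg c0 cb; apply: cmeasZ.
apply: (@cmeas_cintegral1 _ (c / 2) (C * C') _ (fun p : R * R => A (p.1 - p.2) * g p.2)).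
- by lra.
- by apply: cmeas_conv_kernel dA _; case: dg.
- by move=> x y; exact: conv_kernel_le dA dg c0 cb.
Qed.

Lemma fconvD b c C C' C'' A f g : dominated b C A -> dominated c C' f -> dominated c C'' g ->
  0 < c -> 0 <= b -> fconv A (fun s => f s + g s) =1 (fun m => fconv A f m + fconv A g m).
Proof.
move=> dA df dg c0 b0 m; rewrite /fconv -mulrDr; congr (_ * _).
under eq_cintegral do rewrite mulrDr.
exact: cintegralD (dominated_conv_slice m dA b0 df) (dominated_conv_slice m dA b0 dg) c0.
Qed.

Lemma fconvZ b c C C' A f (x : R[i]) : dominated b C A -> dominated c C' f ->
  0 < c -> 0 <= b -> fconv A (fun s => x * f s) =1 (fun m => x * fconv A f m).
Proof.
move=> dA df c0 b0 m; rewrite /fconv mulrCA; congr (_ * _).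
under eq_cintegral do rewrite mulrCA.
exact: cintegralZ (dominated_conv_slice m dA b0 df) c0.
Qed.

(* Convolution of [A] with [Q(is) f(s)] divided by [P(im)]: although [Q] grows,
   the quotient is bounded on the weight [expw b] since
   [1 + |s| <= (1 + |m|)(1 + |m - s|)] and [A] has decay to spare. *)
Definition wconv P Q A f (m : R) : R[i] :=
  (P.[0 +i* m])^-1 * fconv A (fun s => Q.[0 +i* s] * f s) m.

Section wconv_bound.
Variables (P Q : {poly R[i]}) (A : R -> R[i]) (b beta CA : R).
Hypotheses (P0 : forall m, P.[0 +i* m] != 0) (sQP : (size Q <= size P)%N).
Hypotheses (b0 : 0 < b) (bbeta : b < beta) (dA : dominated beta CA A).

Lemma wconv_slice C f : dominated b C f ->
  exists C', dominated (b / 2) C' (fun s => Q.[0 +i* s] * f s).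
Proof.
move=> df; apply: (decays_horner _ (decays_dominated df)).
by have h := b0; apply/andP; split; lra.
Qed.

Lemma cmeas_wconv C f : dominated b C f -> cmeas (wconv P Q A f).
Proof.
move=> df; have [C' dC'] := wconv_slice df.
have h1 := b0; have h2 := bbeta.
apply: cmeasM; last by apply: cmeas_fconv dA dC' _ _; lra.
by apply: cmeasV => //; exact: cmeas_horner.
Qed.

Lemma wconvD C C' f g : dominated b C f -> dominated b C' g ->
  wconv P Q A (fun s => f s + g s) =1 (fun m => wconv P Q A f m + wconv P Q A g m).
Proof.
move=> df dg m; have [? d1] := wconv_slice df; have [? d2] := wconv_slice dg.
rewrite /wconv -mulrDr -(fconvD dA d1 d2) ?divr_gt0 ?(ltW (lt_trans b0 bbeta))//.
congr (_ * _); rewrite (_ : (fun s => _ * (f s + g s)) = (fun s => Q.[0 +i* s] * f s + Q.[0 +i* s] * g s))//.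
by apply/funext => s; rewrite mulrDr.
Qed.

Lemma wconvZ C f (x : R[i]) : dominated b C f ->
  wconv P Q A (fun s => x * f s) =1 (fun m => x * wconv P Q A f m).
Proof.
move=> df m; have [? d1] := wconv_slice df.
rewrite /wconv [RHS]mulrCA -(fconvZ x dA d1) ?divr_gt0 ?(ltW (lt_trans b0 bbeta))//.
congr (_ * _); rewrite (_ : (fun s => _ * (x * f s)) = (fun s => x * (Q.[0 +i* s] * f s)))//.
by apply/funext => s; rewrite mulrCA.
Qed.

Lemma wconv_dominated : exists2 M : R, 0 <= M &
  forall C f, dominated b C f -> dominated b (M * C) (wconv P Q A f).
Proof.
have CA0 := dominated_ge0 dA; have hb0 := b0; have hbb := bbeta.
pose n := (size P).-1.
have sP : (0 < size P)%N by rewrite size_poly_gt0; apply/eqP => PE; have := P0 0; rewrite PE horner0 eqxx.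
have [c c0 Pc] := poly_lower P0; rewrite -/n in Pc.
have [|K K0 QK] := @poly_upper _ Q n; first by rewrite /n prednK.
(* Half of the surplus rate of [A] absorbs the power of 1 + |s|, the other half keeps the integral
   finite. *)
pose e := (beta - b) / 2; have e0 : 0 < e by rewrite /e; lra.
have [|K2 K20 EK] := @poly_expw _ n e (beta - b); first by rewrite /e; lra.
exists (c^-1 * (normc fcst * (2 * (CA * K * K2) * Iexpw e))).
  by rewrite mulr_ge0 ?invr_ge0 ?(ltW c0)// mulr_ge0 ?normc_ge0// !mulr_ge0 ?Iexpw_ge0.
move=> C f df; split; first exact: cmeas_wconv df.
have C0 := dominated_ge0 df.
have [mf fC] := df; move=> m; set p := (1 + `|m|) ^+ n.
have p0 : 0 < p by rewrite exprn_gt0// ltr_wpDr.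
(* After translation by [m] the integration variable is the argument of [A], and the factor [p]
   extracted from [Q] is compensated by the lower bound on [P]. *)
pose g s := A (- s) * (Q.[0 +i* (s + m)] * f (s + m)).
have dg : dominated e (CA * K * K2 * C * p * expw b m) g.
  split.
    case: dA => mA _; apply: cmeasM; first by apply: (cmeas_comp mA); exact: measurable_funN.
    have mh : cmeas (fun s : R => Q.[0 +i* s] * f s) by apply: cmeasM => //; exact: cmeas_horner.
    have ms : measurable_fun setT (fun s : R => s + m) by apply: measurable_funD.
    exact: (cmeas_comp mh ms).
  move=> s; rewrite /g !normcM.
  have h1 : normc (A (- s)) <= CA * expw beta s.
    by case: dA => _ /(_ (- s)); rewrite /expw normrN.
  have h2 : normc Q.[0 +i* (s + m)] <= K * ((1 + `|s|) ^+ n * p).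
    apply: (le_trans (QK _)); rewrite ler_wpM2l// /p -exprMn lerXn2r ?nnegrE ?mulr_ge0 ?addr_ge0//.
    apply: (@le_trans _ _ (1 + (`|s| + `|m|))); first by rewrite lerD2l ler_normD.
    have : 0 <= `|s| * `|m| by rewrite mulr_ge0.
    by rewrite mulrDl mul1r mulrDr mulr1; lra.
  have h3 : normc (f (s + m)) <= C * (expw b m * expw (- b) s).
    apply: (le_trans (fC _)); rewrite ler_wpM2l//.
    by have := @expw_conv b b m (- s) (ltW b0) (lexx _); rewrite opprK addrC /expw normrN.
  apply: (@le_trans _ _ (CA * expw beta s * (K * ((1 + `|s|) ^+ n * p) * (C * (expw b m * expw (- b) s))))).
    by apply: ler_pM; rewrite ?normc_ge0 ?mulr_ge0 ?normc_ge0//; apply: ler_pM; rewrite ?normc_ge0.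
  have -> : CA * expw beta s * (K * ((1 + `|s|) ^+ n * p) * (C * (expw b m * expw (- b) s))) =
     (CA * K * C * p * expw b m) * ((1 + `|s|) ^+ n * expw (beta - b) s).
    rewrite (_ : expw (beta - b) s = expw beta s * expw (- b) s); first by ring.
    by rewrite /expw -expRD; congr expR; ring.
  apply: (le_trans (ler_wpM2l _ (EK s))).
    by rewrite !mulr_ge0 ?expw_ge0 ?(ltW p0).
  by rewrite le_eqVlt; apply/orP; left; apply/eqP; ring.
rewrite /wconv /fconv.
have -> : cintegral (fun s => A (m - s) * (Q.[0 +i* s] * f s)) = cintegral g.
  rewrite -(cintegral_shift (- m) e0 dg); apply: eq_cintegral => s.
  by rewrite /g subrK opprB.
rewrite !normcM normcV.
apply: (@le_trans _ _ ((c * p)^-1 * (normc fcst * (2 * (CA * K * K2 * C * p * expw b m) * Iexpw e)))).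
  apply: ler_pM; rewrite ?invr_ge0 ?mulr_ge0 ?normc_ge0//.
    rewrite lef_pV2 ?posrE ?mulr_gt0//; first exact: Pc.
    by rewrite (lt_le_trans _ (Pc m)) ?mulr_gt0.
  by rewrite ler_wpM2l ?normc_ge0//; exact: cintegral_le dg e0.
rewrite le_eqVlt; apply/orP; left; apply/eqP; field.
by rewrite !gt_eqF.
Qed.

End wconv_bound.

(** The kernel is multiplicative, [fkernel z m = fkernel z (m - s) * fkernel z s], so Fubini and a
    translation of [m] factor the double integral. *)
Lemma inv_fourier_conv b c C C' A g z : dominated b C A -> dominated c C' g ->
  c <= b -> `|complex.Im z| < c ->
  inv_fourier A z * inv_fourier g z = inv_fourier (fconv A g) z.
Proof.
(* The kernel lowers the rate from [c] to [c - y], and [conv_kernel_le] halves what is left. *)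
move=> dA dg cb zc; pose y := `|complex.Im z|; pose e := (c - y) / 2.
have e0 : 0 < e by rewrite /e /y; lra.
have dA' := dominated_fkernel dA (lexx y).
have dg' := dominated_fkernel dg (lexx y).
have c0 : 0 < c by apply: le_lt_trans zc.
have b0 : 0 <= b by lra.
pose F (p : R * R) := A (p.1 - p.2) * g p.2 * fkernel z p.1.
have mF : cmeas F.
  apply: cmeasM; first by apply: cmeas_conv_kernel dA _; case: dg.
  exact: (cmeas_comp (cmeas_fkernel z) measurable_fst).
have FE m s : F (m, s) = A (m - s) * fkernel z (m - s) * (g s * fkernel z s).
  rewrite /F /= (_ : fkernel z m = fkernel z (m - s) * fkernel z s); first by ring.
  rewrite /fkernel -cexpD -mulrDl (_ : (0 +i* (m - s)) + (0 +i* s) = 0 +i* m)//.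
  by apply/eqP; rewrite eq_complex/= addr0 subrK !eqxx.
rewrite [RHS]inv_fourierE.
transitivity (fcst * cintegral (fun m => fcst * cintegral (fun s => F (m, s)))); last first.
  congr (_ * _); apply: eq_cintegral => m; rewrite /fconv -mulrA; congr (_ * _).
  rewrite mulrC -(cintegralZ _ (dominated_conv_slice m dA b0 dg) c0).
  by apply: eq_cintegral => s; rewrite /F/= mulrC.
have FC m s : normc (F (m, s)) <= C * C' * expw e m * expw e s.
  rewrite FE; apply: conv_kernel_le dA' dg' _ _; rewrite ?subr_gt0//.
  by rewrite lerD2r.
have dF : dominated e (C * C' * Iexpw e * 2) (fun m => cintegral (fun s => F (m, s))).
  split; first exact: (@cmeas_cintegral1 _ e (C * C') e0 F mF FC).
  move=> m; have d : dominated e (C * C' * expw e m) (fun s => F (m, s)).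
    split; last by move=> s; exact: FC.
    by apply: (cmeas_comp mF); exact: pair1_measurable.
  apply: (le_trans (cintegral_le d e0)).
  by rewrite le_eqVlt; apply/orP; left; apply/eqP; ring.
rewrite (cintegralZ _ dF e0) (@cintegral_fubini _ e (C * C') e0 F mF FC) !inv_fourierE.
rewrite mulrACA -mulrA; congr (_ * (_ * _)).
rewrite -(cintegralZ (cintegral (fun m => A m * fkernel z m)) dg') ?subr_gt0//.
apply: eq_cintegral => s.
have -> : cintegral (fun m => F (m, s)) = cintegral (fun m => (g s * fkernel z s) * (A (m - s) * fkernel z (m - s))).
  by apply: eq_cintegral => m; rewrite FE mulrC.
have by0 : 0 < b - y by rewrite /y; lra.
rewrite [LHS]mulrC -(cintegralZ _ dA' by0).
by rewrite -(cintegral_shift (- s) by0 (dominatedZ (g s * fkernel z s) dA')).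
Qed.

End convolution.

(** * Complex differentiability uniform in the frequency *)

Section weighted_differentiability.
Context {R : realType}.
Implicit Types (w : R -> R) (F G : R[i] -> R -> R[i]) (t h : R[i]) (C D e : R).

(** For [w = expw b] this unfolds to [dominated b], and is used as such by conversion. *)
Definition wbounded w C (f : R -> R[i]) := cmeas f /\ forall m, normc (f m) <= C * w m.

(** The weight of multipliers such as [denom] and the powers of [t]; the functions they multiply
    carry the weight [expw b]. *)
Definition wone : R -> R := fun=> 1.

(* Complex differentiability at [t] of a function of [t] and [m], with a
   quadratic remainder that is uniform in [m] relative to the weight [w]. *)
Definition wdiff w F t := exists (dF : R -> R[i]) C C' D e,
  [/\ wbounded w C (F t), wbounded w C' dF, 0 < e, 0 <= D &
  forall h, normc h <= e -> cmeas (F (t + h)) /\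
    forall m, normc (F (t + h) m - F t m - h * dF m) <= D * normc h ^+ 2 * w m].

Lemma wbounded_ge0 w C f : wbounded w C f -> 0 < w 0 -> 0 <= C.
Proof. by move=> [_ /(_ 0)] h w0; rewrite -(pmulr_lge0 _ w0) (le_trans (normc_ge0 _) h). Qed.

Lemma wdiff_increment w F t (dF : R -> R[i]) C' D e h m : 0 <= w m -> 0 <= D ->
  normc (dF m) <= C' * w m ->
  normc (F (t + h) m - F t m - h * dF m) <= D * normc h ^+ 2 * w m -> normc h <= e ->
  normc (F (t + h) m - F t m) <= normc h * (C' + D * e) * w m.
Proof.
move=> w0 D0 F'C FD he.
rewrite -[X in normc X](subrK (h * dF m)) (le_trans (normcD _ _))//.
have h1 : normc (h * dF m) <= normc h * C' * w m.
  by rewrite normcM -mulrA ler_wpM2l ?normc_ge0.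
have h2 : D * normc h ^+ 2 * w m <= normc h * (D * e) * w m.
  rewrite ler_wpM2r// expr2 mulrCA ler_wpM2l ?normc_ge0//.
  by rewrite ler_wpM2l.
apply: (le_trans (lerD FD h1)); apply: (le_trans (lerD h2 (lexx _))).
by rewrite -mulrDl -mulrDr [D * e + _]addrC.
Qed.

Section fixed_weight.
Variable w : R -> R.
Hypothesis w_gt0 : forall m, 0 < w m.

Let w_ge0 m : 0 <= w m. Proof. exact: ltW. Qed.

Lemma wdiffD F G t : wdiff w F t -> wdiff w G t -> wdiff w (fun t m => F t m + G t m) t.
Proof.
move=> [dF [C [C' [D [e [FC F'C e0 D0 FD]]]]]] [dG [B [B' [E [e' [GB G'B e'0 E0 GE]]]]]].
exists (fun m => dF m + dG m), (C + B), (C' + B'), (D + E), (Order.min e e').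
split; [| |by rewrite lt_min e0|exact: addr_ge0|].
- case: FC GB => mF FC [mG GB]; split; first exact: cmeasD.
  by move=> m; rewrite mulrDl (le_trans (normcD _ _))// lerD.
- case: F'C G'B => mF F'C [mG G'B]; split; first exact: cmeasD.
  by move=> m; rewrite mulrDl (le_trans (normcD _ _))// lerD.
move=> h; rewrite le_min => /andP[he he'].
have [mF {}FD] := FD h he; have [mG {}GE] := GE h he'.
split; first exact: cmeasD.
move=> m; rewrite (_ : _ - _ - _ = (F (t + h) m - F t m - h * dF m) + (G (t + h) m - G t m - h * dG m)); last by ring.
by rewrite (le_trans (normcD _ _))// !mulrDl lerD.
Qed.

Lemma wdiffM (P : R[i] -> R -> R[i]) F t : wdiff wone P t -> wdiff w F t -> wdiff w (fun t m => P t m * F t m) t.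
Proof.
move=> [dP [B [B' [E [e' [PB P'B e'0 E0 PE]]]]]] [dF [C [C' [D [e [FC F'C e0 D0 FD]]]]]].
have B0 : 0 <= B by apply: wbounded_ge0 PB _.
have B'0 : 0 <= B' by apply: wbounded_ge0 P'B _.
have C0 : 0 <= C by apply: wbounded_ge0 FC _.
have C'0 : 0 <= C' by apply: wbounded_ge0 F'C _.
pose r := Order.min e e'.
have r0 : 0 < r by rewrite lt_min e0.
exists (fun m => dP m * F t m + P t m * dF m), (B * C), (B' * C + B * C'),
  (B * D + E * C + (B' + E * r) * (C' + D * r)), r.
case: PB => mP PB; case: P'B => mP' P'B; case: FC => mF FC; case: F'C => mF' F'C.
rewrite /wone in PB P'B PE.
have {}PB m : normc (P t m) <= B by rewrite -[B]mulr1.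
have {}P'B m : normc (dP m) <= B' by rewrite -[B']mulr1.
split => //.
- split; first exact: cmeasM.
  by move=> m; rewrite normcM -mulrA ler_pM ?normc_ge0.
- split; first by apply: cmeasD; exact: cmeasM.
  move=> m; rewrite mulrDl (le_trans (normcD _ _))// !normcM -!mulrA.
  by apply: lerD; apply: ler_pM; rewrite ?normc_ge0.
- by rewrite !(addr_ge0, mulr_ge0)// ltW.
move=> h hr; have := hr; rewrite le_min => /andP[he he'].
have [mPh {}PE] := PE h he'; have [mFh {}FD] := FD h he.
split; first exact: cmeasM.
move=> m.
have dPh : normc (P (t + h) m - P t m) <= normc h * (B' + E * r).
  have := @wdiff_increment wone P t dP B' E r h m ler01 E0; rewrite /wone !mulr1; apply => //.
  by have := PE m; rewrite mulr1.
have dFh := wdiff_increment (w_ge0 m) D0 (F'C m) (FD m) hr.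
(* Both increments are O(h), so their product belongs to the quadratic remainder. *)
rewrite (_ : _ - _ - _ = P t m * (F (t + h) m - F t m - h * dF m) +
   (P (t + h) m - P t m - h * dP m) * F t m +
   (P (t + h) m - P t m) * (F (t + h) m - F t m)); last by ring.
have b1 : normc (P t m * (F (t + h) m - F t m - h * dF m)) <= B * (D * normc h ^+ 2 * w m).
  by rewrite normcM ler_pM ?normc_ge0.
have b2 : normc ((P (t + h) m - P t m - h * dP m) * F t m) <= E * normc h ^+ 2 * (C * w m).
  by rewrite normcM; apply: ler_pM; rewrite ?normc_ge0//; have := PE m; rewrite mulr1.
have b3 : normc ((P (t + h) m - P t m) * (F (t + h) m - F t m)) <=
    normc h * (B' + E * r) * (normc h * (C' + D * r) * w m).
  by rewrite normcM ler_pM ?normc_ge0.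
apply: (le_trans (normcD _ _)).
apply: (le_trans (lerD (le_trans (normcD _ _) (lerD b1 b2)) b3)).
by rewrite le_eqVlt; apply/orP; left; apply/eqP; ring.
Qed.

Lemma wdiff_scale F (l : R[i]) t : wdiff w F (l * t) -> wdiff w (fun t => F (l * t)) t.
Proof.
move=> [dF [C [C' [D [e [[mF FC] [mF' F'C] e0 D0 FD]]]]]].
exists (fun m => l * dF m), C, (normc l * C'), (D * normc l ^+ 2), (e / (normc l + 1)).
have l0 : 0 < normc l + 1 by rewrite ltr_wpDl ?normc_ge0.
split => //.
- split; first exact: cmeasZ.
  by move=> m; rewrite normcM -mulrA ler_wpM2l ?normc_ge0.
- exact: divr_gt0.
- by rewrite mulr_ge0// sqr_ge0.
move=> h he; have lhe : normc (l * h) <= e.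
  move: he; rewrite ler_pdivlMr// => he; rewrite normcM mulrC (le_trans _ he)//.
  by rewrite ler_wpM2l ?normc_ge0// lerDl.
rewrite mulrDr; have [mFh {}FD] := FD _ lhe; split => // m.
have := FD m; rewrite normcM exprMn [D * (_ * _)]mulrA.
by rewrite (_ : h * (l * dF m) = l * h * dF m)//; ring.
Qed.

Lemma wdiff_series (a : nat -> R -> R[i]) (K B : R) t :
  (forall n, cmeas (a n)) -> (forall n m, normc (a n m) <= K * B ^+ n * w m) ->
  0 <= B -> B * normc t < 1 -> wdiff w (fun t m => csum (fun n => a n m * t ^+ n)) t.
Proof.
(* With this radius B (|t| + e) is at most (1 + B |t|) / 2, so the series still converges
   geometrically on the whole disc of radius [e] around [t]. *)
move=> ma aKB B0 Bt; pose e := (1 - B * normc t) / (2 * (B + 1)).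
have B1 : 0 < B + 1 by rewrite ltr_wpDl.
have e0 : 0 < e by rewrite divr_gt0 ?subr_gt0// mulr_gt0.
have K0 : 0 <= K.
  by have := aKB 0%N 0; rewrite expr0 mulr1 => /(le_trans (normc_ge0 _)); rewrite pmulr_lge0.
pose y := normc t + e; pose x := B * y.
have y0 : 0 < y by rewrite ltr_wpDl ?normc_ge0.
have x01 : 0 <= x < 1.
  rewrite mulr_ge0 ?(ltW y0)//= /x /y mulrDr.
  have : B * e <= (1 - B * normc t) / 2.
    rewrite /e invfM [2^-1 * _]mulrC !mulrA ler_wpM2r// [B * _]mulrC -mulrA ler_piMr//.
      by rewrite subr_ge0 ltW.
    by rewrite ler_pdivrMr// mul1r lerDl.
  lra.
have x1 : 0 < 1 - x by case/andP: x01 => _; rewrite subr_gt0.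
have ub m n (z : R[i]) c : normc z <= c * y ^+ n -> 0 <= c ->
    normc (a n m * z) <= K * w m * c * x ^+ n.
  move=> zc c0; rewrite normcM; apply: (le_trans (ler_pM (normc_ge0 _) (normc_ge0 _) (aKB n m) zc)).
  by rewrite le_eqVlt; apply/orP; left; apply/eqP; rewrite /x exprMn; ring.
have dn (h : R[i]) n : normc h <= e ->
   normc ((t + h) ^+ n - t ^+ n - h * (n%:R * t ^+ n.-1)) <= (normc h / e) ^+ 2 * y ^+ n.
  move=> he; apply: (le_trans (pow_remainder t n e0 he)).
  rewrite ler_wpM2l ?sqr_ge0// -/y -addrA -opprD lerBlDr lerDl addr_ge0 ?exprn_ge0 ?normc_ge0//.
  by rewrite mulr_ge0 ?(ltW e0)// mulr_ge0 ?ler0n ?exprn_ge0 ?normc_ge0.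
have ln n : normc (n%:R * t ^+ n.-1) <= e^-1 * y ^+ n.
  have nr : normc (n%:R : R[i]) = n%:R by rewrite -(rmorph_nat (real_complex R)) normcR normr_nat.
  have ne : normc e%:C <= e by rewrite normcR ger0_norm ?(ltW e0).
  (* Nonnegativity of the majorant in [pow_remainder] is the convexity inequality e n |t|^(n-1) <=
     (|t| + e)^n - |t|^n. *)
  have := le_trans (normc_ge0 _) (pow_remainder t n e0 ne).
  rewrite normcR ger0_norm ?(ltW e0)// divff ?gt_eqF// expr1n mul1r -addrA -opprD subr_ge0 -/y.
  rewrite [e^-1 * _]mulrC ler_pdivlMr// normcM normcX nr => /(le_trans _); apply.
  by rewrite [_ * e]mulrC lerDr exprn_ge0// normc_ge0.
have tn n : normc (t ^+ n) <= 1 * y ^+ n.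
  by rewrite mul1r normcX lerXn2r ?nnegrE ?normc_ge0 ?(ltW y0)// lerDl ltW.
have thn (h : R[i]) n : normc h <= e -> normc ((t + h) ^+ n) <= 1 * y ^+ n.
  move=> he; rewrite mul1r normcX lerXn2r ?nnegrE ?normc_ge0 ?(ltW y0)//.
  by rewrite (le_trans (normcD _ _))// lerD2l.
have e'0 : 0 <= e^-1 by rewrite invr_ge0 ltW.
pose dF m := csum (fun n => a n m * (n%:R * t ^+ n.-1)).
have mser (z : nat -> R[i]) c : 0 <= c -> (forall n, normc (z n) <= c * y ^+ n) ->
    cmeas (fun m => csum (fun n => a n m * z n)).
  move=> c0 zc; apply: cmeas_csum => [n|m].
    by apply: cmeasM => //; exact: cmeas_cst.
  exact: cvg_csum x01 (fun n => ub m n _ _ (zc n) c0).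
exists dF, (K / (1 - x)), (K * e^-1 / (1 - x)), (K * (e^-1) ^+ 2 / (1 - x)), e.
split => //.
- split; first exact: (mser _ _ ler01).
  move=> m; apply: (le_trans (csum_le x01 (fun n => ub m n _ _ (tn n) ler01))).
  by rewrite mulr1 mulrAC.
- split; first exact: (mser _ _ e'0).
  move=> m; apply: (le_trans (csum_le x01 (fun n => ub m n _ _ (ln n) e'0))).
  by rewrite le_eqVlt; apply/orP; left; apply/eqP; ring.
- by rewrite divr_ge0 ?(ltW x1)// mulr_ge0// sqr_ge0.
move=> h he; split; first by apply: (mser _ _ ler01) => n; exact: thn.
move=> m.
have c1 := cvg_csum x01 (fun n => ub m n _ _ (thn h n he) ler01).
have c2 := cvg_csum x01 (fun n => ub m n _ _ (tn n) ler01).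
have c3 := cvg_csum x01 (fun n => ub m n _ _ (ln n) e'0).
have he2 : 0 <= (normc h / e) ^+ 2 by rewrite sqr_ge0.
rewrite /dF -(csum_comb h c1 c2 c3).
rewrite (_ : (fun n => _ - _ - _) = (fun n => a n m * ((t + h) ^+ n - t ^+ n - h * (n%:R * t ^+ n.-1)))); last first.
  by apply/funext => n; ring.
apply: (le_trans (csum_le x01 (fun n => ub m n _ _ (dn h n he) he2))).
by rewrite le_eqVlt; apply/orP; left; apply/eqP; rewrite expr_div_n exprVn; ring.
Qed.

End fixed_weight.

Lemma wone_gt0 m : 0 < wone m. Proof. exact: ltr01. Qed.

Lemma wdiff_cst (f : R -> R[i]) C t : cmeas f -> (forall m, normc (f m) <= C) ->
  wdiff wone (fun _ m => f m) t.
Proof.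
move=> mf fC; exists (fun=> 0), C, 0, 0, 1; split => //.
- by split => // m; rewrite mulr1.
- by split; [exact: cmeas_cst|move=> m; rewrite normc0 mul0r].
- move=> h _; split => // m.
  by rewrite subrr mulr0 subrr normc0 !mul0r.
Qed.

Lemma wdiff_id t : wdiff wone (fun t _ => t) t.
Proof.
exists (fun=> 1), (normc t), 1, 0, 1; split => //.
- by split; [exact: cmeas_cst|move=> m; rewrite mulr1].
- by split; [exact: cmeas_cst|move=> m; rewrite normc1 mulr1].
- move=> h _; split; first exact: cmeas_cst.
  by move=> m; rewrite mulr1 [t + h]addrC addrK subrr normc0 !mul0r.
Qed.

Lemma wdiff_pow n t : wdiff wone (fun t _ => t ^+ n) t.
Proof.
elim: n => [|n IH].
  under eq_fun do under eq_fun do rewrite expr0.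
  by apply: (@wdiff_cst (fun=> 1) 1); [exact: cmeas_cst|move=> m; rewrite normc1].
under eq_fun do under eq_fun do rewrite exprS.
by apply: (wdiffM wone_gt0) => //; exact: wdiff_id.
Qed.

Lemma wdiffV F t (c : R) : 0 < c -> (forall m, c <= normc (F t m)) ->
  wdiff wone F t -> wdiff wone (fun t m => (F t m)^-1) t.
Proof.
move=> c0 Fc [dF [C [C' [D [e [[mF FC] [mF' F'C] e0 D0 FD]]]]]].
have Ft0 m : F t m != 0.
  by apply/eqP => F0; have := Fc m; rewrite F0 normc0 leNgt c0.
have mFi : cmeas (fun m => (F t m)^-1) by apply: cmeasV.
have Fi m : normc (F t m)^-1 <= c^-1.
  by rewrite normcV lef_pV2 ?posrE// (lt_le_trans c0).
have C'0 : 0 <= C' by have := F'C 0; rewrite mulr1; exact: le_trans (normc_ge0 _).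
pose L := C' + D * e.
have L0 : 0 <= L by rewrite addr_ge0// mulr_ge0// ltW.
(* [L] is a Lipschitz constant for the increment of [F]; within this radius [F] moves by at most
   [c / 2] and so stays at least [c / 2] in modulus. *)
pose r := Order.min e (c / (2 * (L + 1))).
have L1 : 0 < L + 1 by rewrite ltr_wpDl.
have r0 : 0 < r by rewrite lt_min e0 divr_gt0// mulr_gt0.
exists (fun m => - (dF m * ((F t m)^-1 ^+ 2))), c^-1, (C' * c^-1 ^+ 2),
  (c^-1 ^+ 2 * D + 2 * c^-1 ^+ 3 * L ^+ 2), r.
have ci0 : 0 <= c^-1 by rewrite invr_ge0 ltW.
split => //.
- by split => // m; rewrite mulr1.
- split; first by apply: cmeasN; apply: cmeasM => //; exact: cmeasX.
  move=> m; rewrite mulr1 normcN' normcM normcX.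
  have := F'C m; rewrite mulr1 => h.
  by apply: ler_pM; rewrite ?normc_ge0 ?exprn_ge0 ?normc_ge0// lerXn2r ?nnegrE ?normc_ge0.
- by rewrite addr_ge0 ?mulr_ge0 ?exprn_ge0.
move=> h; rewrite le_min => /andP[he hL].
have [mFh {}FD] := FD h he.
have dFh m : normc (F (t + h) m - F t m) <= normc h * L.
  have := @wdiff_increment wone F t dF C' D e h m ler01 D0 (F'C m) (FD m) he.
  by rewrite mulr1.
have hL2 : normc h * L <= c / 2.
  move: hL; rewrite ler_pdivlMr ?mulr_gt0// => hL.
  have : normc h * L <= normc h * (L + 1) by rewrite ler_wpM2l ?normc_ge0// lerDl.
  move: hL; rewrite mulrCA; lra.
have Fh m : c / 2 <= normc (F (t + h) m).
  have := normc_le_dist (F t m) (F (t + h) m); rewrite normcBC => h1.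
  have := Fc m; have := dFh m; lra.
have c20 : 0 < c / 2 by lra.
have Fth0 m : F (t + h) m != 0.
  by apply/eqP => F0; have := Fh m; rewrite F0 normc0 leNgt c20.
split; first exact: cmeasV.
move=> m; rewrite mulr1.
rewrite (_ : _ - _ - _ = - ((F t m)^-1 ^+ 2 * (F (t + h) m - F t m - h * dF m)) +
  (F t m)^-1 ^+ 2 * (F (t + h) m)^-1 * (F (t + h) m - F t m) ^+ 2); last first.
  by field; rewrite Ft0 Fth0.
rewrite (le_trans (normcD _ _))// mulrDl lerD//.
  rewrite normcN' normcM normcX -[leRHS]mulrA; apply: ler_pM; rewrite ?exprn_ge0 ?normc_ge0//.
    by rewrite lerXn2r ?nnegrE ?normc_ge0.
  by have := FD m; rewrite mulr1.
rewrite normcM normcM !normcX.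
have -> : 2 * c^-1 ^+ 3 * L ^+ 2 * normc h ^+ 2 = c^-1 ^+ 2 * (c / 2)^-1 * (normc h * L) ^+ 2.
  by field; rewrite gt_eqF.
apply: ler_pM; rewrite ?mulr_ge0 ?exprn_ge0 ?normc_ge0//.
  apply: ler_pM; rewrite ?exprn_ge0 ?normc_ge0//.
    by rewrite lerXn2r ?nnegrE ?normc_ge0.
  by rewrite normcV lef_pV2 ?posrE// (lt_le_trans c20).
by rewrite lerXn2r ?nnegrE ?normc_ge0 ?mulr_ge0 ?normc_ge0.
Qed.

Lemma wdiff_linear b M (T : (R -> R[i]) -> R -> R[i]) F t :
  (forall C f, dominated b C f -> dominated b (M * C) (T f)) ->
  (forall C C' f g, dominated b C f -> dominated b C' g ->
     T (fun s => f s + g s) =1 (fun m => T f m + T g m)) ->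
  (forall C f x, dominated b C f -> T (fun s => x * f s) =1 (fun m => x * T f m)) ->
  wdiff (expw b) F t -> wdiff (expw b) (fun t => T (F t)) t.
Proof.
move=> TM TD TZ [dF [C [C' [D [e [FC F'C e0 D0 FD]]]]]].
(* Testing [T] on the weight itself shows that its bound is nonnegative. *)
have M0 : 0 <= M.
  have d1 : dominated b 1 (fun m => (expw b m)%:C).
    split; first by apply: cmeas_real; exact: measurable_expw.
    by move=> m; rewrite normcR ger0_norm ?expw_ge0 ?mul1r.
  by have := dominated_ge0 (TM _ _ d1); rewrite mulr1.
exists (T dF), (M * C), (M * C'), (M * D), e.
split; [exact: TM|exact: TM|by []|exact: mulr_ge0|].
move=> h he; have [mFh {}FD] := FD h he.
have dr : dominated b (D * normc h ^+ 2) (fun m => F (t + h) m - F t m - h * dF m).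
  split => //; apply: cmeasB; first by apply: cmeasB => //; case: FC.
  by apply: cmeasZ; case: F'C.
have dFh : dominated b (D * normc h ^+ 2 + (C + normc h * C')) (F (t + h)).
  split => // m; rewrite mulrDl.
  rewrite (_ : F (t + h) m = (F (t + h) m - F t m - h * dF m) + (F t m + h * dF m)); last by ring.
  rewrite (le_trans (normcD _ _))// lerD// mulrDl (le_trans (normcD _ _))// lerD//.
    by case: FC.
  by rewrite normcM -mulrA ler_wpM2l ?normc_ge0//; case: F'C.
split; first by case: (TM _ _ dFh).
move=> m.
have -> : T (F (t + h)) m - T (F t) m - h * T dF m =
    T (fun m => F (t + h) m - F t m - h * dF m) m.
  (* [T] is linear only on dominated functions, so [F (t + h)] is split into pieces whose domination
     is known. *)
  have e1 : T (F (t + h)) m = T (fun s => (F (t + h) s - F t s - h * dF s) + (F t s + h * dF s)) m.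
    by congr (T _ m); apply/funext => s; ring.
  rewrite e1 (TD _ _ _ _ dr (dominatedD FC (dominatedZ h F'C))).
  by rewrite (TD _ _ _ _ FC (dominatedZ h F'C)) (TZ _ _ _ F'C); ring.
by case: (TM _ _ dr) => _ /(_ m); rewrite mulrA.
Qed.

End weighted_differentiability.

(** * Inverse Fourier transforms as elements of O_b *)

Section bounded_holomorphic_image.
Context {R : realType}.
Implicit Types (a b C : R) (f g : R -> R[i]).

Definition strip_fourier a f : R[i] -> R[i] :=
  fun z => if `|complex.Im z| < a then inv_fourier f z else 0.

Lemma strip_fourier_in a b C f : dominated b C f -> 0 < a -> a < b ->
  strip_fourier a f \in bounded_hol (strip a).
Proof.
move=> df a0 ab; apply/asboolP; split.
- move=> z za; have [e e0 He] := strip_ball za.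
  apply: (near_derive1 (G := inv_fourier f) e0 _).1 => [h /He|].
    by rewrite /strip /strip_fourier/= => ->.
  apply: (inv_fourier_derive (decays_dominated df) _).1.
  by rewrite /strip/= (lt_trans za).
- exists (fbound (b - a) * C) => z za; rewrite /strip_fourier za.
  exact: inv_fourier_le df (ltW za) ab.
- by move=> z za; rewrite /strip_fourier; case: ifPn.
Qed.

(** [insubd] makes this total with default value 0; [Ob_fourierE] identifies it as soon as [f] is
    dominated at a rate larger than [a]. *)
Definition Ob_fourier a f : Ob (strip a) := insubd 0 (strip_fourier a f).

Section image.
Variables (a b : R).
Hypotheses (a0 : 0 < a) (ab : a < b).

Lemma Ob_fourierE C f : dominated b C f -> Ob_fun (Ob_fourier a f) = strip_fourier a f.
Proof. by move=> df; apply: insubdK; exact: strip_fourier_in df a0 ab. Qed.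

Lemma Ob_fourierD C C' f g : dominated b C f -> dominated b C' g ->
  Ob_fourier a (fun m => f m + g m) = Ob_fourier a f + Ob_fourier a g.
Proof.
move=> df dg; apply: val_inj; rewrite [LHS](Ob_fourierE (dominatedD df dg)).
apply/funext => z; transitivity (strip_fourier a f z + strip_fourier a g z).
  rewrite /strip_fourier; case: ifPn => za; last by rewrite addr0.
  exact: inv_fourierD df dg (lt_trans za ab).
by rewrite -(Ob_fourierE df) -(Ob_fourierE dg).
Qed.

Lemma Ob_fourierZ C f (c : R[i]) : dominated b C f ->
  Ob_fourier a (fun m => c * f m) = c *: Ob_fourier a f.
Proof.
move=> df; apply: val_inj; rewrite [LHS](Ob_fourierE (dominatedZ c df)).
apply/funext => z; transitivity (c * strip_fourier a f z).
  rewrite /strip_fourier; case: ifPn => za; last by rewrite mulr0.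
  exact: inv_fourierZ df (lt_trans za ab).
by rewrite -(Ob_fourierE df).
Qed.

Lemma Ob_fourier0 : Ob_fourier a (fun=> 0) = 0.
Proof.
apply: val_inj; rewrite [LHS](Ob_fourierE (dominated0 b)); apply/funext => z.
by rewrite /strip_fourier inv_fourier0 if_same.
Qed.

Lemma Ob_fourier_sum I (r : seq I) (P : pred I) (C : I -> R) (F : I -> R -> R[i]) :
  (forall i, P i -> dominated b (C i) (F i)) ->
  Ob_fourier a (fun m => \sum_(i <- r | P i) F i m) = \sum_(i <- r | P i) Ob_fourier a (F i).
Proof.
move=> dF; elim: r => [|i r IH].
  by under eq_fun do rewrite big_nil; rewrite big_nil Ob_fourier0.
under eq_fun do rewrite big_cons; rewrite big_cons.
have [Pi|nPi] := boolP (P i) => //.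
by rewrite (Ob_fourierD (dF i Pi) (dominated_sum r dF)) IH.
Qed.

Lemma Ob_fourier_norm C f : dominated b C f ->
  `|Ob_fourier a f| <= (fbound (b - a) * C)%:C.
Proof.
move=> df; change (sup_norm (Ob_fourier a f) <= (fbound (b - a) * C)%:C).
rewrite /sup_norm lecR; apply: ge_sup.
  by exists (normc (Ob_fourier a f 0)), 0 => //; rewrite /strip/= normr0.
move=> _ [z za <-]; rewrite (Ob_fourierE df) /strip_fourier za.
exact: inv_fourier_le df (ltW za) ab.
Qed.

(** The remainder in [wdiff] is uniform in [m] relative to the weight, hence its transform is a
    quadratic remainder in the sup norm. *)
Lemma Ob_fourier_derivable (F : R[i] -> R -> R[i]) t : wdiff (expw b) F t ->
  derivable (fun t => Ob_fourier a (F t)) t 1.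
Proof.
move=> [dF [C [C' [D [e [FC F'C e0 D0 FD]]]]]].
apply: (quad_derivable (D := Ob_fourier a dF) (C := fbound (b - a) * D) e0 _).1 => h he.
have [mFh {}FD] := FD h he.
have dr : dominated b (D * normc h ^+ 2) (fun m => F (t + h) m - F t m - h * dF m).
  split => //; apply: cmeasB; first by apply: cmeasB => //; case: FC.
  by apply: cmeasZ; case: F'C.
have d1 : dominated b (C + normc h * C') (fun m => F t m + h * dF m).
  exact: (dominatedD FC (dominatedZ h F'C)).
have -> : Ob_fourier a (F (t + h)) - Ob_fourier a (F t) - h *: Ob_fourier a dF =
   Ob_fourier a (fun m => F (t + h) m - F t m - h * dF m).
  rewrite -(Ob_fourierZ h F'C) -addrA -opprD -(Ob_fourierD FC (dominatedZ h F'C)).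
  apply/eqP; rewrite subr_eq -(Ob_fourierD dr d1); apply/eqP.
  by congr (Ob_fourier a); apply/funext => m; ring.
by rewrite -mulrA; exact: Ob_fourier_norm.
Qed.

End image.
End bounded_holomorphic_image.

(** * Taylor coefficients in the Borel plane *)

Section strong_recursion.
Context {X : Type} (x0 : X) (Phi : nat -> (nat -> X) -> X).

(** Total sequences that agree with the solution below [n]. [Phi p] may inspect any entry; [srecE]
    asks that it depend only on those below [p]. *)
Fixpoint srec_approx n : nat -> X := match n with
  | 0 => fun=> x0
  | n'.+1 => fun p => if p == n' then Phi n' (srec_approx n') else srec_approx n' p
  end.

Definition srec p := srec_approx p.+1 p.

Lemma srec_approxE n p : (p < n)%N -> srec_approx n p = srec p.
Proof.
elim: n => // n IH; rewrite ltnS leq_eqVlt => /orP[/eqP ->//|pn].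
by rewrite /= ltn_eqF// IH.
Qed.

Lemma srecE p : (forall u v, (forall j, (j < p)%N -> u j = v j) -> Phi p u = Phi p v) ->
  srec p = Phi p srec.
Proof. by move=> H; rewrite {1}/srec /= eqxx; apply: H => j jp; exact: srec_approxE. Qed.

End strong_recursion.

(** * The Taylor series of exp_q(alpha t^d) *)

Section q_exponential.
Context {R : realType}.
Variable q : R.
Hypothesis q1 : 1 < q.

Lemma qfact_ge n : (n`!)%:R <= qfact q n.
Proof.
elim: n => [|n IH]; first by rewrite /qfact big_geq.
rewrite /qfact big_nat_recr//= -/(qfact q n) factS natrM mulrC.
apply: ler_pM => //; rewrite -[X in X%:R <= _]card_ord -sumr_const.
by apply: ler_sum => i _; exact/exprn_ege1/ltW.
Qed.

Lemma qfact_gt0 n : 0 < qfact q n.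
Proof. by apply: lt_le_trans (qfact_ge n); rewrite ltr0n fact_gt0. Qed.

Lemma qfact0 : qfact q 0 = 1.
Proof. by rewrite /qfact big_geq. Qed.

Lemma exp_coeff_le_expR (x : R) n : 0 <= x -> x ^+ n / (n`!)%:R <= expR x.
Proof.
move=> x0; have nd : nondecreasing_seq (series (exp_coeff x)).
  apply/nondecreasing_seqP => m; rewrite seriesSr lerDl /exp_coeff/=.
  by rewrite divr_ge0 ?exprn_ge0.
have := nondecreasing_cvgn_le nd (@is_cvg_series_exp_coeff R x) n.+1.
apply: le_trans; rewrite seriesSr lerDr /series/=.
by apply: sumr_ge0 => i _; rewrite /exp_coeff/= divr_ge0 ?exprn_ge0.
Qed.

(** Since [qfact q n] is at least n!, this compares with a single term of the exponential series at
    1/y; the ratio [y] is arbitrary because exp_q is entire. *)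
Lemma qfact_inv_le (y : R) n : 0 < y -> (qfact q n)^-1 <= expR y^-1 * y ^+ n.
Proof.
move=> y0; have yi : 0 <= y^-1 by rewrite invr_ge0 ltW.
have := exp_coeff_le_expR n yi; rewrite exprVn => h.
rewrite -ler_pdivrMr ?exprn_gt0//; apply: le_trans h.
rewrite mulrC ler_wpM2l ?invr_ge0 ?exprn_ge0 ?(ltW y0)//.
by rewrite lef_pV2 ?posrE ?qfact_gt0 ?ltr0n ?fact_gt0// qfact_ge.
Qed.

(** Taylor coefficients in [t] of exp_q(alpha t^d). *)
Definition ecoef (alpha : R) d p : R :=
  if (d %| p)%N then alpha ^+ (p %/ d)%N / qfact q (p %/ d)%N else 0.

Lemma ecoef0 alpha d : (0 < d)%N -> ecoef alpha d 0 = 1.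
Proof. by move=> d0; rewrite /ecoef dvdn0 div0n qfact0 expr0 divr1. Qed.

Lemma ecoef_le alpha d (x : R) : 0 < alpha -> (0 < d)%N -> 0 < x ->
  exists2 K : R, 0 <= K & forall p, normc (ecoef alpha d p)%:C <= K * x ^+ p.
Proof.
move=> al0 d0 x0; pose y := x ^+ d / alpha.
have y0 : 0 < y by rewrite divr_gt0// exprn_gt0.
exists (expR y^-1); first exact: expR_ge0.
move=> p; rewrite normcR /ecoef; case: ifPn => dp; last first.
  by rewrite normr0 mulr_ge0 ?expR_ge0 ?exprn_ge0 ?(ltW x0).
rewrite ger0_norm ?divr_ge0 ?exprn_ge0 ?(ltW al0) ?(ltW (qfact_gt0 _))//.
have := qfact_inv_le (p %/ d) y0 => /(ler_wpM2l (exprn_ge0 (p %/ d)%N (ltW al0))) /le_trans; apply.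
rewrite /y expr_div_n -exprM mulnC divnK// mulrCA ler_wpM2l ?expR_ge0//.
by rewrite mulrCA divff ?mulr1// expf_neq0 ?gt_eqF.
Qed.

(** The partial sums of [a] form the subsequence, along the multiples of [d], of the partial sums of
    the sparse series. *)
Lemma csum_sparse (d : nat) (a : nat -> R[i]) : (0 < d)%N ->
  series (fun p => if (d %| p)%N then a (p %/ d)%N else 0) @ \oo -->
    csum (fun p => if (d %| p)%N then a (p %/ d)%N else 0) ->
  csum (fun p => if (d %| p)%N then a (p %/ d)%N else 0) = csum a.
Proof.
set b := fun p => _; move=> d0 cb; symmetry; apply: csum_eq.
have -> : series a = (fun N => series b (N * d)%N).
  apply/funext => N; elim: N => [|N IH]; first by rewrite mul0n /series/= !big_geq.
  rewrite seriesSr IH mulSn series_addn; congr (_ + _).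
  rewrite big_ltn; last by rewrite -[X in (X < _)%N]add0n ltn_add2r.
  rewrite {1}/b dvdn_mull// mulnK// big_nat big1 ?addr0// => i /andP[i1 i2].
  rewrite /b; case: ifPn => // /dvdnP[j ij]; exfalso.
  move: i1 i2; rewrite ij ltn_mul2r d0/= -mulSn ltn_mul2r d0/= ltnS.
  by move=> h1 h2; have := leq_trans h1 h2; rewrite ltnn.
apply: (cvg_comp (fun N => (N * d)%N) (series b) _ cb).
apply/cvgnyPge => M; exists M => // n /= Mn.
by rewrite (leq_trans Mn)// leq_pmulr.
Qed.

Lemma csum_ecoef alpha d (t : R[i]) : 0 < alpha -> (0 < d)%N ->
  csum (fun p => (ecoef alpha d p)%:C * t ^+ p) = exp_q q (alpha%:C * t ^+ d).
Proof.
move=> al0 d0.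
pose a n : R[i] := ((qfact q n)^-1)%:C * (alpha%:C * t ^+ d) ^+ n.
have E : (fun p => (ecoef alpha d p)%:C * t ^+ p) = (fun p => if (d %| p)%N then a (p %/ d)%N else 0).
  apply/funext => p; rewrite /ecoef; case: ifPn => dp; last by rewrite mul0r.
  rewrite /a exprMn -exprM [(d * _)%N]mulnC divnK// rmorphM rmorphXn/=; ring.
have [|K K0 eK] := @ecoef_le alpha d ((2 * (normc t + 1))^-1) al0 d0.
  by rewrite invr_gt0 mulr_gt0// ltr_wpDl ?normc_ge0.
have h : forall p, normc ((ecoef alpha d p)%:C * t ^+ p) <= K * 2^-1 ^+ p.
  move=> p; rewrite normcM normcX.
  apply: (le_trans (ler_wpM2r (exprn_ge0 _ (normc_ge0 _)) (eK p))).
  rewrite -mulrA ler_wpM2l// -exprMn lerXn2r ?nnegrE ?mulr_ge0 ?normc_ge0 ?invr_ge0//.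
    by rewrite mulr_ge0// addr_ge0 ?normc_ge0.
  rewrite invfM -mulrA ler_piMr// mulrC ler_pdivrMr ?ltr_wpDl ?normc_ge0//.
  by rewrite mul1r lerDl.
have x01 : 0 <= (2^-1 : R) < 1 by apply/andP; split; lra.
have c := cvg_csum x01 h.
by rewrite E in c *; rewrite (csum_sparse d0 c).
Qed.

End q_exponential.

Section real_estimates.
Context {R : realType}.

Lemma powR_expR (q x : R) : 0 < q -> q `^ x = expR (x * ln q).
Proof. by move=> q0; rewrite /powR gt_eqF. Qed.

Lemma natr_mul_pred (n : nat) : (n * n.-1)%:R = n%:R * (n%:R - 1) :> R.
Proof. by case: n => [|n]; rewrite ?mul0r// natrM -natr1 addrK. Qed.

Lemma quadratic_le (a b x : R) : 0 < a -> b * x - a * x ^+ 2 <= b ^+ 2 / (4 * a).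
Proof.
move=> a0; rewrite -subr_ge0.
have -> : b ^+ 2 / (4 * a) - (b * x - a * x ^+ 2) = a * (x - b / (2 * a)) ^+ 2.
  by field; rewrite gt_eqF.
by rewrite mulr_ge0 ?sqr_ge0// ltW.
Qed.

Lemma gauss_geo (a b y : R) : 0 < a -> 0 < y ->
  exists2 C : R, 0 <= C & forall n : nat, expR (b * n%:R - a * n%:R ^+ 2) <= C * y ^+ n.
Proof.
move=> a0 y0; exists (expR ((b - ln y) ^+ 2 / (4 * a))); first exact: expR_ge0.
move=> n; have -> : y ^+ n = expR (n%:R * ln y) by rewrite expRM_natl lnK ?posrE.
rewrite -expRD ler_expR -lerBlDr.
apply: le_trans (quadratic_le (b - ln y) n%:R a0).
by rewrite le_eqVlt; apply/orP; left; apply/eqP; ring.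
Qed.

End real_estimates.

(** * Coefficients of the terms indexed by A *)

Section coefficients.
Context {R : realType}.
Variables (q : R) (k : nat).
Hypotheses (q1 : 1 < q) (k0 : (0 < k)%N).
Implicit Types l : nat * nat * nat.

Let q0 : 0 < q. Proof. exact: lt_trans ltr01 q1. Qed.
Let lnq0 : 0 < ln q. Proof. exact: ln_gt0. Qed.
Let kR0 : 0 < k%:R :> R. Proof. by rewrite ltr0n. Qed.

(** The solution [j] of l2 (j + l0) = p; [lok l p] says that it exists in nat, both operations being
    truncated otherwise. *)
Definition lidx l p : nat := (p %/ ell2 l - ell0 l)%N.

Definition lok l p : bool := (ell2 l %| p)%N && (ell0 l <= p %/ ell2 l)%N.

(* If [u_p = q^(p(p-1)/(2k)) omega_p], the coefficient of [t^p] in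
   [(t^l0 sigma^l1 u)(t^l2)] is [q^(p(p-1)/(2k)) * lcoef l p * omega_(lidx l p)]. *)
Definition lexp l p : R := (ell1 l)%:R * (lidx l p)%:R +
  (lidx l p * (lidx l p).-1)%:R / (2 * k%:R) - (p * p.-1)%:R / (2 * k%:R).

Definition lcoef l p : R := if lok l p then q `^ lexp l p else 0.

Lemma lcoef_ge0 l p : 0 <= lcoef l p.
Proof. by rewrite /lcoef; case: ifP => // _; exact: powR_ge0. Qed.

Lemma lidx_lt l p : (0 < ell0 l)%N -> lok l p -> (lidx l p < p)%N.
Proof.
move=> l0 /andP[_ lp]; rewrite /lidx ltn_subLR// (leq_ltn_trans (leq_div _ _))//.
by rewrite -[X in (X < _)%N]add0n ltn_add2r.
Qed.

(** For l2 = 1 the quadratic parts of the exponents cancel and [lcoef] is geometric in [lidx]: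
    [ldil] is the ratio, that is lambda_l, and [lcst] the value at index 0, that is c_l. *)
Definition ldil l : R := q `^ ((ell1 l)%:R - (ell0 l)%:R / k%:R).
Definition lcst l : R := q `^ (- ((ell0 l)%:R * ((ell0 l)%:R - 1) / (2 * k%:R))).

Lemma ldil_le l : (ell1 l)%:R <= (ell0 l)%:R / k%:R - 1 :> R -> 0 < ldil l <= q^-1.
Proof.
move=> h; rewrite /ldil powR_gt0//=.
have -> : q^-1 = expR (- ln q) by rewrite expRN lnK ?posrE.
by rewrite powR_expR// ler_expR -[- ln q]mulN1r ler_wpM2r ?(ltW lnq0)//; lra.
Qed.

Lemma lcst_gt0 l : 0 < lcst l. Proof. exact: powR_gt0. Qed.

Lemma lidx1 l j : ell2 l = 1%N -> lidx l (j + ell0 l) = j.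
Proof. by move=> l2; rewrite /lidx l2 divn1 addnK. Qed.

Lemma lcoef1 l j : ell2 l = 1%N -> lcoef l (j + ell0 l) = lcst l * ldil l ^+ j.
Proof.
move=> l2; rewrite /lcoef /lok l2 dvd1n divn1 leq_addl/=.
rewrite /lexp lidx1// !natr_mul_pred natrD /lcst /ldil !powR_expR// -expRM_natl -expRD.
by congr expR; field; rewrite gt_eqF.
Qed.

Lemma lcoef1_lt l p : ell2 l = 1%N -> (p < ell0 l)%N -> lcoef l p = 0.
Proof. by move=> l2 pl; rewrite /lcoef /lok l2 dvd1n divn1 leqNgt pl. Qed.

Lemma lcoef1_le l p : ell2 l = 1%N -> (ell1 l)%:R <= (ell0 l)%:R / k%:R - 1 :> R ->
  (0 < ell0 l)%N -> lcoef l p <= 1.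
Proof.
move=> l2 h l0; have [pl|lp] := ltnP p (ell0 l); first by rewrite lcoef1_lt.
rewrite -(subnK lp) lcoef1//; have /andP[d0 dq] := ldil_le h.
have d1 : ldil l <= 1 by rewrite (le_trans dq)// invf_le1// ltW.
have c1 : lcst l <= 1.
  rewrite /lcst powR_expR// -[leRHS]expR0 ler_expR mulr_le0_ge0 ?(ltW lnq0)// oppr_le0.
  by rewrite divr_ge0 ?mulr_ge0// subr_ge0 ler1n.
by rewrite mulr_ile1 ?exprn_ge0 ?exprn_ile1 ?(ltW d0) ?(ltW (lcst_gt0 l)).
Qed.

(** Since j = [lidx l p] is at most p / l2, the quadratic exponent (j^2 - p^2)/(2k) is at most -(1 -
    1/l2^2) p^2/(2k). The linear terms cost l1 p and p/(2k) <= p, whence the factor l1 + 1. *)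
Lemma lcoef_gauss l p : (1 < ell2 l)%N ->
  lcoef l p <= expR (((ell1 l)%:R + 1) * ln q * p%:R -
    (1 - ((ell2 l)%:R ^+ 2)^-1) * ln q / (2 * k%:R) * p%:R ^+ 2).
Proof.
move=> l2; rewrite /lcoef; case: ifPn => [/andP[dv lp]|_]; last exact: expR_ge0.
rewrite powR_expR// ler_expR.
have l20 : 0 < (ell2 l)%:R :> R by rewrite ltr0n ltnW.
pose j := lidx l p.
have jp : j%:R <= p%:R / (ell2 l)%:R :> R.
  rewrite ler_pdivlMr// -natrM ler_nat -[X in (_ <= X)%N](divnK dv) leq_mul2r.
  by rewrite leq_subr orbT.
have pl2 : p%:R / (ell2 l)%:R <= p%:R :> R.
  by rewrite ler_pdivrMr// ler_peMr// ler1n ltnW.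
have j0 : 0 <= j%:R :> R by [].
have j2 : j%:R * (j%:R - 1) <= p%:R ^+ 2 / (ell2 l)%:R ^+ 2 :> R.
  apply: (@le_trans _ _ (j%:R ^+ 2)); first by rewrite expr2 ler_wpM2l// gerBl.
  by rewrite -expr_div_n lerXn2r ?nnegrE// divr_ge0.
rewrite /lexp -/j !natr_mul_pred.
have -> : ((ell1 l)%:R + 1) * ln q * p%:R - (1 - ((ell2 l)%:R ^+ 2)^-1) * ln q / (2 * k%:R) * p%:R ^+ 2 =
   ((ell1 l)%:R * p%:R + p%:R + (p%:R ^+ 2 / (ell2 l)%:R ^+ 2 - p%:R ^+ 2) / (2 * k%:R)) * ln q.
  by field; rewrite !gt_eqF.
rewrite ler_wpM2r ?(ltW lnq0)//.
have k2 : 0 < 2 * k%:R :> R by rewrite mulr_gt0.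
have h1 : (ell1 l)%:R * j%:R <= (ell1 l)%:R * p%:R :> R by rewrite ler_wpM2l// (le_trans jp).
have h2 : j%:R * (j%:R - 1) / (2 * k%:R) <= p%:R ^+ 2 / (ell2 l)%:R ^+ 2 / (2 * k%:R) :> R.
  by rewrite ler_wpM2r// invr_ge0 ltW.
have h3 : p%:R / (2 * k%:R) <= p%:R :> R.
  rewrite ler_pdivrMr// ler_peMr// -natrM ler1n muln_gt0 k0//.
rewrite mulrBl mulrBr mulr1 mulrBl -expr2; lra.
Qed.

End coefficients.

Section linear_operators.
Context {R : realType}.
Implicit Types (T : (R -> R[i]) -> R -> R[i]).

Definition bounded_linear b M T := [/\
  forall C f, dominated b C f -> dominated b (M * C) (T f),
  forall C C' f g, dominated b C f -> dominated b C' g ->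
    T (fun s => f s + g s) =1 (fun m => T f m + T g m) &
  forall C f x, dominated b C f -> T (fun s => x * f s) =1 (fun m => x * T f m)].

Lemma bounded_linear_wconv (P Q : {poly R[i]}) (A : R -> R[i]) (b beta CA : R) :
  (forall m, P.[0 +i* m] != 0) -> (size Q <= size P)%N -> 0 < b -> b < beta ->
  dominated beta CA A -> exists2 M : R, 0 <= M & bounded_linear b M (wconv P Q A).
Proof.
move=> P0 sQP b0 bb dA; have [M M0 HM] := wconv_dominated P0 sQP b0 bb dA.
exists M => //; split => //.
- by move=> C C' f g; exact: (wconvD P Q b0 bb dA).
- by move=> C f x; exact: (wconvZ P Q b0 bb dA).
Qed.

Variables (b M : R) (T : (R -> R[i]) -> R -> R[i]).
Hypotheses (b0 : 0 < b) (M0 : 0 <= M) (TM : bounded_linear b M T).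

Lemma bounded_linear_sum I (r : seq I) (C : I -> R) (F : I -> R -> R[i]) :
  (forall i, dominated b (C i) (F i)) ->
  T (fun m => \sum_(i <- r) F i m) =1 (fun m => \sum_(i <- r) T (F i) m).
Proof.
case: TM => TB TD TZ dF; elim: r => [|i r IH] m.
  rewrite big_nil (_ : (fun m => _) = (fun m : R => (0 : R[i]) * 0)).
    by rewrite (TZ 0 (fun=> 0) 0 (dominated0 b)) mul0r.
  by apply/funext => s; rewrite big_nil mulr0.
rewrite big_cons -IH -(TD _ _ _ _ (dF i) (dominated_sum r (fun i _ => dF i))).
by congr (T _ m); apply/funext => s; rewrite big_cons.
Qed.

(** [T] need not respect pointwise limits, but the tail of the series is dominated with a constant
    of order x^N, and [T] is bounded for domination. *)
Lemma bounded_linear_csum (u : nat -> R -> R[i]) (K B : R) (z : R[i]) m :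
  (forall n, dominated b (K * B ^+ n) (u n)) -> 0 <= B -> B * normc z < 1 ->
  T (fun m => csum (fun n => u n m * z ^+ n)) m = csum (fun n => T (u n) m * z ^+ n).
Proof.
move=> du B0 Bz; have [TB TD TZ] := TM.
have x01 : 0 <= B * normc z < 1 by rewrite mulr_ge0 ?normc_ge0.
set x := B * normc z in x01.
have ub s n : normc (u n s * z ^+ n) <= (K * expw b s) * x ^+ n.
  rewrite normcM normcX; case: (du n) => _ /(_ s) h.
  apply: (le_trans (ler_wpM2r (exprn_ge0 _ (normc_ge0 _)) h)).
  by rewrite /x exprMn le_eqVlt; apply/orP; left; apply/eqP; ring.
have K0 : 0 <= K by have := dominated_ge0 (du 0%N); rewrite expr0 mulr1.
have x1 : 0 < 1 - x by case/andP: x01; rewrite subr_gt0.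
have mu n : cmeas (u n) by case: (du n).
have duz n : dominated b (normc (z ^+ n) * (K * B ^+ n)) (fun s => z ^+ n * u n s).
  exact: dominatedZ.
symmetry; apply: csum_eq.
apply: (@cvg_normc_le _ _ _ _ (fun N => M * (K / (1 - x)) * expw b m * x ^+ N)); last exact: cvg_geo0.
move=> N; rewrite normcE lecR.
pose S s := \sum_(0 <= n < N) z ^+ n * u n s.
have dS : dominated b (\sum_(0 <= n < N) normc (z ^+ n) * (K * B ^+ n)) S by apply: dominated_sum.
pose f s := csum (fun n => u n s * z ^+ n).
have df : dominated b (K / (1 - x)) f.
  split.
    apply: cmeas_csum => [n|s]; last exact: cvg_csum x01 (ub s).
    by apply: cmeasM => //; exact: cmeas_cst.
  by move=> s; apply: (le_trans (csum_le x01 (ub s))); rewrite mulrAC.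
have dfS : dominated b (K * x ^+ N / (1 - x)) (fun s => f s - S s).
  split; first by apply: cmeasB; [case: df|case: dS].
  move=> s; have := csum_tail x01 (ub s) N.
  rewrite (_ : series _ N = S s); last by apply: eq_bigr => n _; rewrite mulrC.
  by move=> /le_trans; apply; rewrite le_eqVlt; apply/orP; left; apply/eqP; ring.
have -> : series (fun n => T (u n) m * z ^+ n) N = T S m.
  rewrite (bounded_linear_sum _ duz); apply: eq_bigr => n _.
  by rewrite (TZ _ _ _ (du n)) mulrC.
have fE : T f m = T (fun s => (f s - S s)) m + T S m.
  by rewrite -(TD _ _ _ _ dfS dS); congr (T _ m); apply/funext => s; rewrite subrK.
rewrite normcBC fE addrK; case: (TB _ _ dfS) => _ /(_ m) /le_trans; apply.
by rewrite le_eqVlt; apply/orP; left; apply/eqP; ring.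
Qed.

End linear_operators.

Section finite_families.
Context {R : realType}.

Lemma seq_ub (I : eqType) (r : seq I) (P : I -> R -> Prop) :
  (forall x L L', P x L -> L <= L' -> P x L') ->
  (forall x, x \in r -> exists L, P x L) ->
  exists L, 0 <= L /\ forall x, x \in r -> P x L.
Proof.
move=> Pm; elim: r => [|x r IH] H; first by exists 0.
have [|L [L0 HL]] := IH; first by move=> y yr; apply: H; rewrite inE yr orbT.
have [|L' HL'] := H x; first by rewrite inE eqxx.
exists (Order.max L L'); split; first by rewrite le_max L0.
move=> y; rewrite inE => /orP[/eqP ->|yr].
  by apply: Pm HL' _; rewrite le_max lexx orbT.
by apply: Pm (HL y yr) _; rewrite le_max lexx.
Qed.

Lemma dominated_sum_seq b (I : eqType) (r : seq I) (P : pred I) (C : I -> R) (F : I -> R -> R[i]) :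
  (forall i, i \in r -> P i -> dominated b (C i) (F i)) ->
  dominated b (\sum_(i <- r | P i) C i) (fun m => \sum_(i <- r | P i) F i m).
Proof.
move=> dF; rewrite big_seq_cond.
rewrite (_ : (fun m => _) = (fun m => \sum_(i <- r | (i \in r) && P i) F i m)); last first.
  by apply/funext => m; rewrite big_seq_cond.
by apply: dominated_sum => i /andP[]; exact: dF.
Qed.

Lemma cvgc_sum (I : eqType) (r : seq I) (P : pred I) (u : I -> nat -> R[i]) (v : I -> R[i]) :
  (forall i, i \in r -> P i -> u i @ \oo --> v i) ->
  (fun N => \sum_(i <- r | P i) u i N) @ \oo --> \sum_(i <- r | P i) v i.
Proof.
elim: r => [|i r IH] H.
  by under eq_fun do rewrite big_nil; rewrite big_nil; exact: cvg_cst.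
under eq_fun do rewrite big_cons; rewrite big_cons.
have {}IH := IH (fun j jr => H j (mem_behead (s := i :: r) jr)).
case Pi : (P i); last exact: IH.
have ui := H i (mem_head i r) Pi.
exact: (@cvgD _ _ _ _ _ (u i) (fun N => \sum_(i <- r | P i) u i N) _ _ ui IH).
Qed.

End finite_families.

(** * The equation in the Borel plane and its continuation *)

Section borel_equation.
Context {R : realType}.
Variables (q alpha : R) (k d : nat) (r : seq (nat * nat * nat)).
Variables (T : nat * nat * nat -> (R -> R[i]) -> R -> R[i]) (pc : R -> R[i]).
Variable fr : nat -> R -> R[i].
Implicit Types (l : nat * nat * nat) (t : R[i]) (m : R).
Hypotheses (q1 : 1 < q) (k0 : (0 < k)%N) (d0 : (0 < d)%N) (alpha0 : 0 < alpha).
Hypothesis r_pos : forall l, l \in r -> [/\ (0 < ell0 l)%N, (0 < ell1 l)%N & (0 < ell2 l)%N].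
Hypothesis r_dil : forall l, l \in r -> (ell1 l)%:R <= (ell0 l)%:R / k%:R - 1 :> R.
Hypothesis r_gauss : forall l, l \in r -> (1 < ell2 l)%N ->
  k%:R < ((ell2 l)%:R ^+ 2 - 1) * d%:R ^+ 2 :> R.

Local Notation ec p := (ecoef q alpha d p)%:C.
Local Notation lc := (lcoef q k).

Let q0 : 0 < q. Proof. exact: lt_trans ltr01 q1. Qed.
Let lnq0 : 0 < ln q. Proof. exact: ln_gt0. Qed.
Let kR0 : 0 < k%:R :> R. Proof. by rewrite ltr0n. Qed.

(* Coefficient of [t^p] in the Borel-plane equation solved for [omega_p]: the
   term [i = 0] of [exp_q] (equal to 1) has been moved to the left-hand side. *)
Definition borel_step p (u : nat -> R -> R[i]) (m : R) : R[i] :=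
  (pc m - 1)^-1 * (\sum_(i < p) ec i.+1 * u (p - i.+1)%N m +
    \sum_(l <- r) (lc l p)%:C * T l (u (lidx l p)) m + fr p m).

Definition borel_coef : nat -> R -> R[i] := srec (fun=> 0) borel_step.

Local Notation omega := borel_coef.

Lemma borel_coefE p : omega p = borel_step p omega.
Proof.
apply: srecE => u v uv; apply/funext => m; rewrite /borel_step; congr (_ * (_ + _ + _)).
  apply: eq_bigr => i _; rewrite uv//.
  by rewrite ltn_subrL/= (leq_ltn_trans _ (ltn_ord i)).
rewrite !big_seq; apply: eq_bigr => l lr.
(* When [lok] fails, the truncated index [lidx l p] need not lie below [p] (for instance at p = 0),
   but then the coefficient vanishes. *)
have [ok|nok] := boolP (lok l p); last by rewrite /lcoef (negbTE nok) !mul0r.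
by rewrite uv//; apply: lidx_lt => //; case: (r_pos lr).
Qed.

Lemma borel_coef_eq p m : pc m - 1 != 0 ->
  pc m * omega p m = \sum_(i < p.+1) ec i * omega (p - i)%N m +
    \sum_(l <- r) (lc l p)%:C * T l (omega (lidx l p)) m + fr p m.
Proof.
move=> pc1; rewrite big_ord_recl/= subn0 ecoef0// mul1r -!addrA.
apply/eqP; rewrite [X in _ == X]addrC -subr_eq -[X in _ - X]mul1r -mulrBl; apply/eqP.
by rewrite [in LHS]borel_coefE /borel_step mulrA divff// mul1r -!addrA.
Qed.

Section fixed_decay.
Variables (b c0 CF : R) (M : nat * nat * nat -> R) (J0 : nat).
Hypothesis M0 : forall l, 0 <= M l.
Hypothesis TM : forall l, l \in r -> bounded_linear b (M l) (T l).
Hypotheses (mpc : cmeas pc) (c00 : 0 < c0) (pc1 : forall m, c0 <= normc (pc m - 1)).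
Hypotheses (frC : forall p, dominated b CF (fr p)) (fr0 : forall p m, (J0 < p)%N -> fr p m = 0).

Let pc1_neq0 m : pc m - 1 != 0.
Proof. by apply/eqP => pc0; have := pc1 m; rewrite pc0 normc0 leNgt c00. Qed.

Lemma lcoef_bounded : exists L, 0 <= L /\ forall l, l \in r -> forall p, lc l p <= L.
Proof.
apply: (seq_ub (P := fun l L => forall p, lc l p <= L)).
  by move=> l L L' H LL' p; exact: le_trans (H p) LL'.
move=> l lr; have [l0 _ l2] := r_pos lr; have [l21|l21] := leqP (ell2 l) 1.
  exists 1 => p; apply: lcoef1_le => //; last exact: r_dil.
  by apply/eqP; rewrite eqn_leq l21 l2.
pose a := (1 - ((ell2 l)%:R ^+ 2)^-1) * ln q / (2 * k%:R).
have a0 : 0 < a.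
  rewrite divr_gt0 ?mulr_gt0// subr_gt0 invf_lt1 ?exprn_gt0 ?ltr0n//.
  by rewrite exprn_egt1// ltr1n.
exists (expR ((((ell1 l)%:R + 1) * ln q) ^+ 2 / (4 * a))) => p.
by apply: (le_trans (lcoef_gauss q1 k0 p l21)); rewrite ler_expR; exact: quadratic_le.
Qed.

Lemma borel_coef_bound : exists K B, [/\ 0 <= K, 1 <= B & forall p, dominated b (K * B ^+ p) (omega p)].
Proof.
have [Ke Ke0 eK] := @ecoef_le _ q q1 alpha d 1 alpha0 d0 ltr01.
have [L [L0 HL]] := lcoef_bounded.
have CF0 : 0 <= CF by exact: dominated_ge0 (frC 0%N).
pose SM := \sum_(l <- r) M l.
have SM0 : 0 <= SM by apply: sumr_ge0 => l _; exact: M0.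
have ci0 : 0 <= c0^-1 by rewrite invr_ge0 ltW.
(* Indices drop by at least one, which gains a factor 1/B. [B >= 2] bounds the geometric sum of the
   exp_q terms by 2, and [B] is large enough for them and the operators to use at most half of K
   B^p; [K] leaves the other half to the forcing. *)
pose B := 2 + 2 * (c0^-1 * (2 * Ke + L * SM)).
have z0 : 0 <= c0^-1 * (2 * Ke + L * SM) by rewrite mulr_ge0// addr_ge0// mulr_ge0.
have B2 : 2 <= B by rewrite /B lerDl mulr_ge0.
have B0 : 0 < B by rewrite (lt_le_trans _ B2).
have B1 : 1 <= B by rewrite (le_trans _ B2)// ler1n.
pose K := 2 * (c0^-1 * CF).
have K0 : 0 <= K by rewrite mulr_ge0// mulr_ge0.
exists K, B; split => //.
elim/ltn_ind => p IH; rewrite borel_coefE.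
have Xp : 0 <= K * B ^+ p by rewrite mulr_ge0// exprn_ge0// ltW.
have d1 : dominated b (\sum_(i < p) normc (ec i.+1) * (K * B ^+ (p - i.+1)%N))
    (fun m => \sum_(i < p) ec i.+1 * omega (p - i.+1)%N m).
  apply: dominated_sum => i _; apply: dominatedZ; apply: IH.
  by rewrite ltn_subrL/= (leq_ltn_trans _ (ltn_ord i)).
have d2 : dominated b (\sum_(l <- r) L * M l * (K * B ^+ p / B))
    (fun m => \sum_(l <- r) (lc l p)%:C * T l (omega (lidx l p)) m).
  apply: dominated_sum_seq => l lr _.
  have nn : 0 <= L * M l * (K * B ^+ p / B) by apply: mulr_ge0; [exact: mulr_ge0|rewrite divr_ge0// ltW].
  have [ok|nok] := boolP (lok l p); last first.
    rewrite /lcoef (negbTE nok) (_ : (fun m => _) = fun=> 0).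
      exact: dominated_weaken (dominated0 b) (lexx _) nn.
    by apply/funext => m; rewrite mul0r.
  have jp : (lidx l p < p)%N by apply: lidx_lt => //; case: (r_pos lr).
  have [TB _ _] := TM lr; have := dominatedZ (lc l p)%:C (TB _ _ (IH _ jp)).
  move=> /dominated_weaken; apply => //.
  rewrite normcR ger0_norm ?lcoef_ge0// -mulrA; apply: ler_pM; rewrite ?lcoef_ge0//.
  - by rewrite mulr_ge0// mulr_ge0// exprn_ge0// ltW.
  - exact: HL.
  apply: ler_wpM2l; first exact: M0.
  by rewrite ler_pdivlMr// -mulrA -exprSr ler_wpM2l// ler_weXn2l.
have d3 := dominatedD (dominatedD d1 d2) (frC p).
have pi m : normc (pc m - 1)^-1 <= c0^-1.
  by rewrite normcV lef_pV2 ?posrE// (lt_le_trans c00).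
have d4 := dominatedM (cmeasV pc1_neq0 (cmeasB mpc (cmeas_cst _ 1))) pi d3.
apply: dominated_weaken d4 (lexx _) _.
have s1 : \sum_(i < p) normc (ec i.+1) * (K * B ^+ (p - i.+1)%N) <= 2 * Ke * (K * B ^+ p / B).
  have Bi : 0 <= B^-1 <= 2^-1.
    by rewrite invr_ge0 (ltW B0)/= lef_pV2 ?posrE.
  apply: (@le_trans _ _ (\sum_(0 <= i < p) Ke * (K * B ^+ p / B) * B^-1 ^+ i)).
    rewrite big_mkord; apply: ler_sum => i _.
    apply: (@le_trans _ _ (Ke * (K * B ^+ (p - i.+1)%N))).
      rewrite ler_wpM2r ?mulr_ge0 ?exprn_ge0 ?(ltW B0)//.
      by have := eK i.+1; rewrite expr1n mulr1.
    have -> : B ^+ p = B ^+ (p - i.+1) * (B * B ^+ i).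
      by rewrite -exprS -exprD subnK.
    rewrite exprVn le_eqVlt; apply/orP; left; apply/eqP; field.
    by rewrite expf_neq0 gt_eqF.
  have Bi1 : 0 <= B^-1 < 1 by case/andP: Bi => -> /= h; lra.
  apply: (le_trans (geo_sum_le _ _ _ Bi1)).
    by rewrite mulr_ge0// divr_ge0// ltW.
  rewrite expr0 mulr1 -[2 * Ke * _]mulrA; set Y := Ke * _.
  have Y0 : 0 <= Y by rewrite mulr_ge0// divr_ge0// ltW.
  case/andP: Bi => _ h; have h' := ler_wpM2l Y0 h.
  have Bi0 : 0 < 1 - B^-1 by lra.
  by rewrite ler_pdivrMr// mulrBr mulr1; lra.
rewrite -mulr_suml -mulr_sumr -/SM.
apply: (@le_trans _ _ (c0^-1 * (2 * Ke * (K * B ^+ p / B) + L * SM * (K * B ^+ p / B) + CF))).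
  by rewrite ler_wpM2l// !lerD2r.
have e1 : c0^-1 * (2 * Ke * (K * B ^+ p / B) + L * SM * (K * B ^+ p / B) + CF) =
   (c0^-1 * (2 * Ke + L * SM)) / B * (K * B ^+ p) + K / 2.
  by rewrite /K; field; rewrite !gt_eqF.
rewrite e1.
have h1 : (c0^-1 * (2 * Ke + L * SM)) / B <= 2^-1.
  by rewrite ler_pdivrMr// /B; lra.
have h2 : K <= K * B ^+ p by rewrite ler_peMr// exprn_ege1.
have := ler_wpM2r Xp h1; lra.
Qed.

(* Coefficients of size [exp (- kap p^2 / 2)] with [gauss_rate < kap] give an
   entire function of size [exp ((k + d^2) ln^2 |t| / (2 ln q))]; division by
   [exp_q (alpha t^d)], of size [exp (d^2 ln^2 |t| / (2 ln q))], leaves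
   q-exponential growth of order [k]. *)
Definition gauss_rate : R := ln q / (k%:R + d%:R ^+ 2).

Let gauss_rate_gt0 : 0 < gauss_rate.
Proof. by rewrite divr_gt0// ltr_pwDl// exprn_ge0. Qed.

Definition gauss (g : nat -> R -> R[i]) := exists C kap, [/\ 0 <= C, gauss_rate < kap &
  forall p, dominated b (C * expR (- (kap / 2 * p%:R ^+ 2))) (g p)].

Lemma gaussD g g' : gauss g -> gauss g' -> gauss (fun p m => g p m + g' p m).
Proof.
move=> [C [kap [C0 ck gC]]] [C' [kap' [C'0 ck' gC']]].
exists (C + C'), (Order.min kap kap'); split; [exact: addr_ge0|by rewrite lt_min ck|].
move=> p; rewrite mulrDl; apply: dominatedD.
  apply: dominated_weaken (gC p) (lexx _) _; rewrite ler_wpM2l// ler_expR lerN2.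
  by rewrite ler_wpM2r ?exprn_ge0// ler_wpM2r ?invr_ge0// ge_min lexx.
apply: dominated_weaken (gC' p) (lexx _) _; rewrite ler_wpM2l// ler_expR lerN2.
by rewrite ler_wpM2r ?exprn_ge0// ler_wpM2r ?invr_ge0// ge_min lexx orbT.
Qed.

Lemma gauss0 : gauss (fun _ _ => 0).
Proof.
exists 0, (gauss_rate + 1); split => //; first by rewrite ltrDl.
by move=> p; rewrite mul0r; exact: dominated0.
Qed.

Lemma gauss_sum (P : pred (nat * nat * nat)) (F : nat * nat * nat -> nat -> R -> R[i]) :
  (forall l, l \in r -> P l -> gauss (F l)) -> gauss (fun p m => \sum_(l <- r | P l) F l p m).
Proof.
elim: r => [|l s IH] H.
  by under eq_fun do under eq_fun do rewrite big_nil; exact: gauss0.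
under eq_fun do under eq_fun do rewrite big_cons.
have {}IH := IH (fun j jr => H j (mem_behead (s := l :: s) jr)).
case Pl : (P l); last exact: IH.
by apply: gaussD IH; apply: H => //; rewrite inE eqxx.
Qed.

Lemma gauss_geometric g y : gauss g -> 0 < y ->
  exists2 C, 0 <= C & forall p, dominated b (C * y ^+ p) (g p).
Proof.
move=> [C [kap [C0 ck gC]]] y0.
have [|D D0 HD] := @gauss_geo R (kap / 2) 0 y _ y0.
  by rewrite divr_gt0// (lt_trans _ ck).
exists (C * D); first exact: mulr_ge0.
move=> p; apply: dominated_weaken (gC p) (lexx _) _; rewrite -[leRHS]mulrA ler_wpM2l//.
by have := HD p; rewrite mul0r add0r.
Qed.

(** The positive part of the logarithm, which lets one formula cover small and large |t|. *)
Definition lnmax (x : R) : R := ln (Order.max 1 x).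

Lemma lnmax_ge0 x : 0 <= lnmax x.
Proof. by rewrite ln_ge0// le_max lexx. Qed.

Lemma pow_le_lnmax (x : R) p : 0 <= x -> x ^+ p <= expR (p%:R * lnmax x).
Proof.
move=> x0; rewrite expRM_natl /lnmax lnK ?posrE ?lt_max ?ltr01//.
by rewrite lerXn2r ?nnegrE// ?le_max ?lexx ?orbT ?ler01.
Qed.

(** The part [gauss_rate] of the Gaussian exponent is spent on maximising p L - gauss_rate p^2 / 2
    over [p], with value at most L^2 / (2 gauss_rate); the surplus [kap - gauss_rate] provides the
    summable factor 2^-p. *)
Lemma gauss_series g : gauss g -> exists2 C, 0 <= C & forall t p m,
  normc (g p m * t ^+ p) <=
  (C * expR (lnmax (normc t) ^+ 2 / (2 * gauss_rate)) * expw b m) * 2^-1 ^+ p.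
Proof.
move=> [C [kap [C0 ck gC]]].
have [||D D0 HD] := @gauss_geo R ((kap - gauss_rate) / 2) 0 2^-1.
- by rewrite divr_gt0// subr_gt0.
- by rewrite invr_gt0.
exists (C * D); first exact: mulr_ge0.
move=> t p m; rewrite normcM normcX; case: (gC p) => _ /(_ m) h.
apply: (le_trans (ler_pM (normc_ge0 _) (exprn_ge0 _ (normc_ge0 _)) h (pow_le_lnmax p (normc_ge0 t)))).
set L := lnmax _; have {}HD := HD p; rewrite mul0r add0r in HD.
rewrite -[leLHS](_ : C * (expR (- (kap / 2 * p%:R ^+ 2)) * expR (p%:R * L)) * expw b m = _); last by ring.
have -> : C * D * expR (L ^+ 2 / (2 * gauss_rate)) * expw b m * 2^-1 ^+ p =
  C * (D * 2^-1 ^+ p * expR (L ^+ 2 / (2 * gauss_rate))) * expw b m by ring.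
rewrite ler_wpM2r ?expw_ge0// ler_wpM2l//.
apply: le_trans (ler_wpM2r (expR_ge0 _) HD).
rewrite -!expRD ler_expR.
have := quadratic_le L p%:R (divr_gt0 gauss_rate_gt0 (ltr0n R 2)).
have -> : 4 * (gauss_rate / 2) = 2 * gauss_rate by field.
by lra.
Qed.

(* The substitution [t^l2] with [l2 >= 2] makes these coefficients Gaussian, so
   that they act as a known entire source term in the continuation. *)
Definition gcoef p (m : R) : R[i] :=
  \sum_(l <- r | ell2 l != 1%N) (lc l p)%:C * T l (omega (lidx l p)) m + fr p m.

Lemma gauss_gcoef : gauss gcoef.
Proof.
have [K [B [K0 B1 oKB]]] := borel_coef_bound.
have B0 : 0 < B by exact: lt_le_trans B1.
apply: gaussD; last first.
  have CF0 : 0 <= CF by exact: dominated_ge0 (frC 0%N).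
  (* Finitely many coefficients are Gaussian at any rate; the constant compensates the factor at the
     last index [J0]. *)
  exists (CF * expR ((gauss_rate + 1) / 2 * J0%:R ^+ 2)), (gauss_rate + 1).
  split; [by rewrite mulr_ge0 ?expR_ge0|by rewrite ltrDl|].
  move=> p; have [pJ|Jp] := leqP p J0; last first.
    rewrite (_ : fr p = fun=> 0); last by apply/funext => m; exact: fr0.
    by apply: dominated_weaken (dominated0 b) (lexx _) _; rewrite !mulr_ge0 ?expR_ge0.
  apply: dominated_weaken (frC p) (lexx _) _; rewrite -[leRHS]mulrA ler_peMr// -expRD -[leLHS]expR0 ler_expR.
  rewrite -mulrBr mulr_ge0//; first by rewrite divr_ge0// addr_ge0// ltW.
  by rewrite subr_ge0 lerXn2r ?nnegrE// ler_nat.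
apply: gauss_sum => l lr l21; have [l0 _ l2] := r_pos lr.
have {}l21 : (1 < ell2 l)%N by rewrite ltn_neqAle eq_sym l21 l2.
have l2R : 1 < (ell2 l)%:R ^+ 2 :> R by rewrite exprn_egt1// ltr1n.
pose a := (1 - ((ell2 l)%:R ^+ 2)^-1) * ln q / (2 * k%:R).
(* The difference has the sign of (l2^2 - 1) d^2 - k, which [r_gauss] makes positive. *)
have ha : gauss_rate / 2 < a.
  rewrite /gauss_rate /a -subr_gt0.
  have -> : (1 - ((ell2 l)%:R ^+ 2)^-1) * ln q / (2 * k%:R) - ln q / (k%:R + d%:R ^+ 2) / 2 =
     (((ell2 l)%:R ^+ 2 - 1) * d%:R ^+ 2 - k%:R) * ln q /
     (2 * k%:R * (k%:R + d%:R ^+ 2) * (ell2 l)%:R ^+ 2).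
    have gen (L K' D : R) : L != 0 -> K' != 0 -> K' + D != 0 ->
        (1 - L^-1) * ln q / (2 * K') - ln q / (K' + D) / 2 =
        ((L - 1) * D - K') * ln q / (2 * K' * (K' + D) * L).
      by move=> h1 h2 h3; field; rewrite h1 h2 h3.
    apply: gen; rewrite gt_eqF//; first exact: lt_trans l2R.
    by rewrite ltr_pwDl// exprn_ge0.
  rewrite divr_gt0 ?mulr_gt0 ?subr_gt0 ?r_gauss ?ltr0n//.
  by rewrite ltr_pwDl// exprn_ge0.
(* [kap / 2] lies strictly between [gauss_rate / 2] and [a]; the margin [a - kap / 2] absorbs the
   linear exponent [c], which includes the growth of B^p. *)
pose kap := a + gauss_rate / 2.
pose c := ((ell1 l)%:R + 1) * ln q + ln B.
have ak : 0 < a - kap / 2 by rewrite /kap; lra.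
exists (M l * K * expR (c ^+ 2 / (4 * (a - kap / 2)))), kap.
split; [by rewrite !mulr_ge0 ?expR_ge0|by rewrite /kap; lra|move=> p].
have [TB _ _] := TM lr.
apply: dominated_weaken (dominatedZ (lc l p)%:C (TB _ _ (oKB (lidx l p)))) (lexx _) _.
rewrite normcR ger0_norm ?lcoef_ge0//.
apply: (le_trans (ler_wpM2r _ (lcoef_gauss q1 k0 p l21))).
  by rewrite !mulr_ge0// exprn_ge0// ltW.
have Bj : B ^+ lidx l p <= expR (p%:R * ln B).
  rewrite expRM_natl lnK ?posrE// ler_weXn2l//.
  by rewrite (leq_trans (leq_subr _ _))// leq_div.
rewrite -/a; set E1 := expR (_ - _).
have -> : E1 * (M l * (K * B ^+ lidx l p)) = M l * K * (E1 * B ^+ lidx l p) by ring.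
rewrite -[leRHS]mulrA; apply: ler_wpM2l; first exact: mulr_ge0.
apply: (le_trans (ler_wpM2l (expR_ge0 _) Bj)); rewrite -!expRD ler_expR.
have := quadratic_le c p%:R ak; rewrite /c; lra.
Qed.

Definition gfun t m : R[i] := csum (fun n => gcoef n m * t ^+ n).

Let half01 : 0 <= (2^-1 : R) < 1. Proof. by apply/andP; split; lra. Qed.

Lemma gfun_bound : exists2 C, 0 <= C & forall t,
  dominated b (C * expR (lnmax (normc t) ^+ 2 / (2 * gauss_rate))) (gfun t).
Proof.
have [C C0 HC] := gauss_series gauss_gcoef; exists (C * 2); first exact: mulr_ge0.
move=> t; split.
  apply: cmeas_csum => [n|m]; last exact: cvg_csum half01 (fun n => HC t n m).
  have [D [kap [_ _ /(_ n)[mg _]]]] := gauss_gcoef.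
  by apply: cmeasM => //; exact: cmeas_cst.
move=> m; apply: (le_trans (csum_le half01 (fun n => HC t n m))).
by rewrite le_eqVlt; apply/orP; left; apply/eqP; field.
Qed.

Definition bsum t m : R[i] := csum (fun n => omega n m * t ^+ n).
Definition esum_q t : R[i] := csum (fun n => ec n * t ^+ n).
Definition denom t m : R[i] := pc m - esum_q t.

Section functional_equation.
Variables (K B : R) (t : R[i]) (m : R).
Hypotheses (B1 : 1 <= B) (oKB : forall p, dominated b (K * B ^+ p) (omega p)).
Hypothesis Bt : B * normc t < 1.

Let B0 : 0 <= B. Proof. exact: le_trans ler01 B1. Qed.

Lemma cvg_bsum_term : exists2 y : R, 0 <= y < 1 & B * normc t <= y /\ 0 < y.
Proof.
(* Averaging with 1 keeps the ratio positive when [t = 0]. *)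
exists ((1 + B * normc t) / 2); have h := Bt;
  have h' : 0 <= B * normc t by rewrite mulr_ge0 ?normc_ge0.
  by apply/andP; split; lra.
by split; lra.
Qed.

Lemma bsum_term_le y n : B * normc t <= y ->
  normc (omega n m * t ^+ n) <= (K * expw b m) * y ^+ n.
Proof.
move=> hy; rewrite normcM normcX; case: (oKB n) => _ /(_ m) h.
apply: (le_trans (ler_wpM2r (exprn_ge0 _ (normc_ge0 _)) h)).
have K0 : 0 <= K by have := dominated_ge0 (oKB 0%N); rewrite expr0 mulr1.
have -> : K * B ^+ n * expw b m * normc t ^+ n = K * expw b m * (B * normc t) ^+ n.
  by rewrite exprMn; ring.
rewrite ler_wpM2l ?mulr_ge0 ?expw_ge0// lerXn2r ?nnegrE ?mulr_ge0 ?normc_ge0//.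
by apply: le_trans hy; rewrite mulr_ge0 ?normc_ge0.
Qed.

Lemma cvg_dilated_term l : l \in r -> ell2 l = 1%N ->
  series (fun n => (lc l n)%:C * T l (omega (lidx l n)) m * t ^+ n) @ \oo -->
  (lcst q k l)%:C * t ^+ ell0 l * T l (bsum ((ldil q k l)%:C * t)) m.
Proof.
move=> lr l2.
have K0 : 0 <= K by have := dominated_ge0 (oKB 0%N); rewrite expr0 mulr1.
have /andP[dl0 dl1] := ldil_le q1 (r_dil lr).
set z := (ldil q k l)%:C * t.
have zt : normc z <= normc t.
  rewrite normcM normcR ger0_norm ?(ltW dl0)// ler_piMl ?normc_ge0//.
  by rewrite (le_trans dl1)// invf_le1// ltW.
have Bz : B * normc z < 1 by apply: le_lt_trans Bt; rewrite ler_wpM2l.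
have [TB _ _] := TM lr.
rewrite (bounded_linear_csum (TM lr) m oKB B0 Bz).
have ub n : normc (T l (omega n) m * z ^+ n) <= (M l * K * expw b m) * (B * normc z) ^+ n.
  rewrite normcM normcX; case: (TB _ _ (oKB n)) => _ /(_ m) h.
  apply: (le_trans (ler_wpM2r (exprn_ge0 _ (normc_ge0 _)) h)).
  by rewrite exprMn le_eqVlt; apply/orP; left; apply/eqP; ring.
have x01 : 0 <= B * normc z < 1 by rewrite mulr_ge0 ?normc_ge0.
have c := @cvgcZ _ ((lcst q k l)%:C * t ^+ ell0 l) _ _ (cvg_csum x01 ub).
(* The terms below [ell0 l] vanish; after this shift the geometric form of [lcoef] becomes
   evaluation at the dilated point. *)
rewrite -(@cvg_shiftn (ell0 l)).
rewrite (_ : (fun n => _) = (fun n => (lcst q k l)%:C * t ^+ ell0 l * series (fun n => T l (omega n) m * z ^+ n) n))//.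
apply/funext => n; elim: n => [|n IH].
  rewrite add0n /series/= [in RHS]big_geq// mulr0 big_nat big1// => i /andP[_ il].
  by rewrite lcoef1_lt// !mul0r.
rewrite addSn !seriesSr IH mulrDr; congr (_ + _).
rewrite lidx1// lcoef1// /z exprMn exprD rmorphM rmorphXn/=; ring.
Qed.

Lemma bsum_functional : (forall m, pc m - 1 != 0) ->
  denom t m * bsum t m =
  \sum_(l <- r | ell2 l == 1%N) (lcst q k l)%:C * t ^+ ell0 l * T l (bsum ((ldil q k l)%:C * t)) m
  + gfun t m.
Proof.
move=> pc1n.
have [y y01 [hy y0]] := cvg_bsum_term; have oy n := bsum_term_le n hy.
(* [csum_cauchy] needs a ratio strictly below [y] for one factor; the coefficients of exp_q admit
   any positive ratio, so y / 2 is available. *)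
have [Ke Ke0 eK] := @ecoef_le _ q q1 alpha d (y / 2 / (normc t + 1)) alpha0 d0
  (divr_gt0 (divr_gt0 y0 (ltr0n R 2)) (ltr_wpDl (normc_ge0 t) ltr01)).
have t1 : 0 < normc t + 1 by rewrite ltr_wpDl ?normc_ge0.
have ey n : normc (ec n * t ^+ n) <= Ke * (y / 2) ^+ n.
  rewrite normcM normcX; apply: (le_trans (ler_wpM2r (exprn_ge0 _ (normc_ge0 _)) (eK n))).
  rewrite -[leLHS]mulrA ler_wpM2l// -exprMn lerXn2r ?nnegrE ?mulr_ge0 ?invr_ge0 ?normc_ge0 ?(ltW y0) ?(ltW t1)//.
  rewrite -[leLHS]mulrA ler_piMr ?divr_ge0 ?(ltW y0)// mulrC ler_pdivrMr// mul1r.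
  by rewrite lerDl.
have y1 : y < 1 by case/andP: y01.
have hyy : y / 2 < y by lra.
have y20 : 0 <= y / 2 by lra.
have ceo := csum_cauchy ey oy y20 hyy y1.
pose cau p := \sum_(i < p.+1) (ec i * t ^+ i) * (omega (p - i)%N m * t ^+ (p - i)%N).
pose dil p := \sum_(l <- r | ell2 l == 1%N) (lc l p)%:C * T l (omega (lidx l p)) m * t ^+ p.
pose gg p := gcoef p m * t ^+ p.
have E p : pc m * (omega p m * t ^+ p) = cau p + dil p + gg p.
  rewrite mulrA borel_coef_eq// (bigID (fun l => ell2 l == 1%N))/=.
  rewrite /cau /dil /gg /gcoef -mulr_suml.
  have -> : \sum_(i < p.+1) (ec i * t ^+ i) * (omega (p - i)%N m * t ^+ (p - i)%N) =
      \sum_(i < p.+1) ec i * omega (p - i)%N m * t ^+ p.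
    apply: eq_bigr => i _; have -> : t ^+ p = t ^+ i * t ^+ (p - i).
      by rewrite -exprD subnKC// -ltnS.
    by ring.
  by rewrite -mulr_suml -!mulrDl; congr (_ * _); ring.
have cdil : series dil @ \oo --> \sum_(l <- r | ell2 l == 1%N) (lcst q k l)%:C * t ^+ ell0 l * T l (bsum ((ldil q k l)%:C * t)) m.
  rewrite (_ : series dil = (fun N => \sum_(l <- r | ell2 l == 1%N) series (fun n => (lc l n)%:C * T l (omega (lidx l n)) m * t ^+ n) N)).
    apply: cvgc_sum => l lr /eqP l2; exact: cvg_dilated_term.
  by apply/funext => N; rewrite /series/= exchange_big.
have [C C0 HC] := gauss_series gauss_gcoef.
have cgg := cvg_csum half01 (fun n => HC t n m); rewrite -/(gfun t m) in cgg.
have co := cvg_csum y01 oy.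
have cl := @cvgcZ _ (pc m) _ _ co.
have cc := cvgcB (cvgcB cl cdil) cgg.
have {}cc : csum cau = pc m * bsum t m - \sum_(l <- r | ell2 l == 1%N)
    (lcst q k l)%:C * t ^+ ell0 l * T l (bsum ((ldil q k l)%:C * t)) m - gfun t m.
  apply: csum_eq.
  rewrite (_ : series cau = (fun N => (pc m * series (fun n => omega n m * t ^+ n) N - series dil N) - series gg N))//.
  apply/funext => N; rewrite /series/= mulr_sumr -!sumrB; apply: eq_bigr => p _; rewrite E; ring.
rewrite /denom mulrBl [esum_q t * _](_ : _ = csum cau); last by rewrite -ceo.
by rewrite cc; ring.
Qed.

End functional_equation.

Lemma borel_coef0 : (forall m, fr 0 m = 0) -> omega 0%N = fun=> 0.
Proof.
move=> fr00; rewrite borel_coefE; apply/funext => m; rewrite /borel_step big_ord0 fr00 add0r addr0.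
rewrite big_seq big1 ?mulr0// => l lr; have [l0 _ _] := r_pos lr.
by rewrite /lcoef /lok dvdn0 div0n/= leqNgt l0 mul0r.
Qed.

(** The growth allowed by G_q-summability with Delta = 2, apart from the factor |xi|. *)
Definition qexp_bound (al x : R) : R :=
  expR (k%:R / (2 * ln q) * ln (x + 2) ^+ 2 + al * ln (x + 2)).

Section continuation.
Variables (K B rho0 r2 : R) (S : set R[i]).
Hypotheses (B1 : 1 <= B) (oKB : forall p, dominated b (K * B ^+ p) (omega p)).
Hypotheses (rho00 : 0 < rho0) (Brho : B * rho0 <= 2^-1).
Hypothesis denomD : forall t, normc t < rho0 -> forall m, denom t m != 0.
Hypothesis fr00 : forall m, fr 0 m = 0.
Hypothesis pcr2 : forall m, normc (pc m) <= r2.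
Hypothesis S_scale : forall (x : R) t, 0 < x -> S t -> S (x%:C * t).
Variables (cS cP cL : R).
Hypotheses (cS0 : 0 < cS) (cP0 : 0 <= cP) (cL0 : 0 <= cL).
Hypothesis denomS : forall t m, S t -> cS <= normc (denom t m).
Hypothesis denom_inv : forall t m, S t -> normc (denom t m)^-1 <=
  cP * expR (cL * lnmax (normc t) - d%:R ^+ 2 / (2 * ln q) * lnmax (normc t) ^+ 2).

Let B0 : 0 < B. Proof. exact: lt_le_trans ltr01 B1. Qed.

Let K0 : 0 <= K.
Proof. by have := dominated_ge0 (oKB 0%N); rewrite expr0 mulr1. Qed.

Let Bt t : normc t < rho0 -> B * normc t < 2^-1.
Proof. by move=> tr; apply: lt_le_trans Brho; rewrite ltr_pM2l. Qed.

Let Bt1 t : normc t < rho0 -> B * normc t < 1.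
Proof. by move=> /Bt h; lra. Qed.

(** [omega 0] vanishes, so starting the sum at 1 loses nothing, and [maxn 1 N] keeps one factor |t|
    even for [N = 0]. That case gives [dominated_bsum], the source of the factor |xi| near 0. *)
Lemma bsum_dist t N m : normc t < rho0 ->
  normc (bsum t m - \sum_(1 <= n < N) omega n m * t ^+ n) <=
  2 * K * (B * normc t) ^+ (maxn 1 N) * expw b m.
Proof.
move=> tr; have h1 := Bt tr; have h0 : 0 <= B * normc t by rewrite mulr_ge0 ?normc_ge0 ?(ltW B0).
have x01 : 0 <= B * normc t < 1 by apply/andP; split; lra.
have := csum_tail x01 (fun n => bsum_term_le m B1 oKB n (lexx _)) (maxn 1 N).
have -> : series (fun n => omega n m * t ^+ n) (maxn 1 N) = \sum_(1 <= n < N) omega n m * t ^+ n.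
  rewrite /series/= big_ltn ?leq_max// borel_coef0// mul0r add0r.
  case: N => [|N]; first by rewrite maxn0 !big_geq.
  by rewrite (maxn_idPr _).
move=> /le_trans; apply; rewrite ler_pdivrMr ?subr_gt0; last by lra.
have Y0 : 0 <= K * (B * normc t) ^+ maxn 1 N * expw b m by rewrite !mulr_ge0 ?expw_ge0 ?exprn_ge0.
have h2 : B * normc t <= 2^-1 by lra.
have := ler_wpM2l Y0 h2; rewrite mulrAC; lra.
Qed.

Lemma cmeas_bsum t : normc t < rho0 -> cmeas (bsum t).
Proof.
move=> tr; apply: cmeas_csum => [n|m].
  by apply: cmeasM; [case: (oKB n)|exact: cmeas_cst].
have x01 : 0 <= B * normc t < 1 by rewrite mulr_ge0 ?normc_ge0 ?(ltW B0)//=; exact: Bt1.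
exact: cvg_csum x01 (fun n => bsum_term_le m B1 oKB n (lexx _)).
Qed.

Lemma dominated_bsum t : normc t < rho0 -> dominated b (2 * K * B * normc t) (bsum t).
Proof.
move=> tr; split; first exact: cmeas_bsum.
by move=> m; have := bsum_dist 0 m tr; rewrite big_geq// subr0 maxn0 expr1 !mulrA.
Qed.

(* The [l2 = 1] terms are evaluated at [lambda t] with [lambda <= 1/q], so one
   application enlarges the disc of validity by the factor [q]. *)
Definition continue (f : R[i] -> R -> R[i]) t m : R[i] := (denom t m)^-1 *
  (\sum_(l <- r | ell2 l == 1%N) ((lcst q k l)%:C * t ^+ ell0 l) * T l (f ((ldil q k l)%:C * t)) m
   + gfun t m).

Definition approx n : R[i] -> R -> R[i] := iter n continue bsum.

Let ldilq l t : l \in r -> normc ((ldil q k l)%:C * t) <= normc t / q.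
Proof.
move=> lr; have /andP[l0 lq] := ldil_le q1 (r_dil lr).
by rewrite normcM normcR ger0_norm ?(ltW l0)// mulrC ler_wpM2l ?normc_ge0.
Qed.

(** At level 0 this is the functional equation divided by the nonzero denominator; at later levels
    the dilated points fall into the previous disc. *)
Lemma approx_succ n t : normc t < q ^+ n * rho0 -> approx n t = approx n.+1 t.
Proof.
elim: n t => [|n IH] t.
  rewrite expr0 mul1r => tr; apply/funext => m; rewrite /approx/= /continue.
  rewrite -(bsum_functional m B1 oKB (Bt1 tr) pc1_neq0) mulrA mulVf ?mul1r//.
  exact: denomD.
move=> tr; apply/funext => m; rewrite /approx iterS [in RHS]iterS {1 2}/continue.
congr (_ * (_ + _)); rewrite big_seq_cond [in RHS]big_seq_cond.
apply: eq_bigr => l /andP[lr _]; rewrite -/(approx n) -/(approx n.+1) IH//.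
by apply: (le_lt_trans (ldilq t lr)); rewrite ltr_pdivrMr// mulrC mulrA -exprS.
Qed.

Lemma approx_stable n n' t : (n <= n')%N -> normc t < q ^+ n * rho0 -> approx n t = approx n' t.
Proof.
move=> nn' tr; rewrite -(subnKC nn'); elim: (n' - n)%N => [|j IH]; first by rewrite addn0.
rewrite IH addnS approx_succ// (lt_le_trans tr)// ler_pM2r// ler_weXn2l ?(ltW q1)//.
exact: leq_addr.
Qed.

Lemma wdiff_sum w (P : pred (nat * nat * nat))
    (F : nat * nat * nat -> R[i] -> R -> R[i]) t :
  (forall l, l \in r -> P l -> wdiff w (F l) t) ->
  wdiff w (fun t m => \sum_(l <- r | P l) F l t m) t.
Proof.
elim: r => [|l s IH] H.
  under eq_fun do under eq_fun do rewrite big_nil.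
  exists (fun=> 0), 0, 0, 0, 1; split => //.
  - by split; [exact: cmeas_cst|move=> m; rewrite normc0 mul0r].
  - by split; [exact: cmeas_cst|move=> m; rewrite normc0 mul0r].
  - move=> h _; split; first exact: cmeas_cst.
    by move=> m; rewrite mulr0 !subrr normc0 !mul0r.
under eq_fun do under eq_fun do rewrite big_cons.
have {}IH := IH (fun j jr => H j (mem_behead (s := l :: s) jr)).
case Pl : (P l); last exact: IH.
by apply: wdiffD IH => //; apply: H => //; rewrite inE eqxx.
Qed.

Lemma wdiff_esum t : wdiff wone (fun t _ => esum_q t) t.
Proof.
have t1 : 0 < normc t + 1 by rewrite ltr_wpDl ?normc_ge0.
have y0 : 0 < (normc t + 1)^-1 by rewrite invr_gt0.
have [Ke Ke0 eK] := @ecoef_le _ q q1 alpha d _ alpha0 d0 y0.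
apply: (wdiff_series wone_gt0 (a := fun n _ => ec n) (K := Ke)) (ltW y0) _ => [n|n m|].
- exact: cmeas_cst.
- by rewrite mulr1.
- by rewrite mulrC ltr_pdivrMr// mul1r ltrDl.
Qed.

Lemma wdiff_denom t : wdiff wone denom t.
Proof.
rewrite (_ : denom = (fun t m => pc m + (-1) * esum_q t)); last first.
  by apply/funext => s; apply/funext => m; rewrite /denom mulN1r.
apply: wdiffD; first exact: wdiff_cst mpc pcr2.
apply: (wdiffM wone_gt0); last exact: wdiff_esum.
by apply: (@wdiff_cst _ (fun=> -1) 1); [exact: cmeas_cst|move=> m; rewrite normcN' normc1].
Qed.

Lemma wdiff_gfun t : wdiff (expw b) gfun t.
Proof.
have t1 : 0 < normc t + 1 by rewrite ltr_wpDl ?normc_ge0.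
have y0 : 0 < (normc t + 1)^-1 by rewrite invr_gt0.
have [C C0 HC] := gauss_geometric gauss_gcoef y0.
apply: (wdiff_series (expw_gt0 b) (K := C)) (ltW y0) _ => [n|n m|].
- by case: (HC n).
- by case: (HC n).
- by rewrite mulrC ltr_pdivrMr// mul1r ltrDl.
Qed.

Lemma wdiff_approx n t : S t -> normc t < q ^+ n * rho0 -> wdiff (expw b) (approx n) t.
Proof.
elim: n t => [|n IH] t St.
  rewrite expr0 mul1r => tr; apply: (wdiff_series (expw_gt0 b)) (ltW B0) (Bt1 tr) => [p|p m].
    by case: (oKB p).
  by case: (oKB p).
move=> tr; rewrite /approx iterS; apply: (wdiffM (expw_gt0 b)).
  by apply: wdiffV cS0 _ (wdiff_denom t) => m; exact: denomS.
apply: wdiffD; last exact: wdiff_gfun.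
apply: wdiff_sum => l lr _.
apply: (wdiffM (expw_gt0 b)).
  apply: (wdiffM wone_gt0); last exact: wdiff_pow.
  by apply: (@wdiff_cst _ (fun=> (lcst q k l)%:C)); [exact: cmeas_cst|move=> m; exact: lexx].
have [TB TD TZ] := TM lr.
apply: (wdiff_linear TB TD TZ); apply: wdiff_scale; apply: IH.
  by apply: S_scale => //; have /andP[] := ldil_le q1 (r_dil lr).
by apply: (le_lt_trans (ldilq t lr)); rewrite ltr_pdivrMr// mulrC mulrA -exprS.
Qed.

Lemma qexp_bound_ge1 al x : 0 <= al -> 0 <= x -> 1 <= qexp_bound al x.
Proof.
move=> al0 x0; rewrite -expR0 ler_expR; have ln0 : 0 <= ln (x + 2) by rewrite ln_ge0//; lra.
by rewrite addr_ge0 ?mulr_ge0 ?exprn_ge0 ?invr_ge0// mulr_ge0// ltW.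
Qed.

Lemma lnmax_le x : 0 <= x -> lnmax x <= ln (x + 2).
Proof.
move=> x0; rewrite /lnmax ler_ln ?posrE; last by lra.
  by rewrite ge_max; apply/andP; split; lra.
by rewrite lt_max ltr01.
Qed.

(** The quotient (x/q + 2)/(x + 2) decreases in [x], so beyond [rho0] it is at most its value [th]
    there. It tends to 1 at the origin, so a gain uniform in [x] requires staying away from 0. *)
Lemma qexp_bound_dil al x y : 0 <= al -> rho0 <= x -> 0 <= y -> y <= x / q ->
  qexp_bound al y <= qexp_bound al x * expR (al * ln ((rho0 / q + 2) / (rho0 + 2))).
Proof.
move=> al0 rx y0 yx; set th := (_ / (rho0 + 2)).
have rq0 : 0 < rho0 / q by rewrite divr_gt0.
have r20 : 0 < rho0 + 2 by rewrite addr_gt0.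
have th0 : 0 < th by rewrite divr_gt0// addr_gt0.
have th1 : th <= 1.
  by rewrite ler_pdivrMr// mul1r lerD2r ler_pdivrMr// ler_peMr ?(ltW rho00)// ltW.
have x0 : 0 < x by exact: lt_le_trans rx.
have qi : q^-1 <= 1 by rewrite invf_le1// ltW.
have yth : y + 2 <= (x + 2) * th.
  rewrite mulrA ler_pdivlMr//; apply: (@le_trans _ _ ((x / q + 2) * (rho0 + 2))).
    by rewrite ler_wpM2r ?(ltW r20)// lerD2r.
  have : 0 <= (x - rho0) * (1 - q^-1) by rewrite mulr_ge0// subr_ge0.
  by rewrite !mulrDl !mulrDr; lra.
have lnle : ln (y + 2) <= ln (x + 2) + ln th.
  have y20 : 0 < y + 2 by lra.
  have x20 : 0 < x + 2 by lra.
  have xt0 : 0 < (x + 2) * th by rewrite mulr_gt0.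
  rewrite -lnM ?posrE// ler_ln ?posrE//.
have lnth : ln th <= 0 by apply: ln_le0.
have lny : 0 <= ln (y + 2) by rewrite ln_ge0//; lra.
have lnyx : ln (y + 2) <= ln (x + 2) by lra.
rewrite -expRD ler_expR -addrA -mulrDr; apply: lerD; last exact: ler_wpM2l.
rewrite ler_wpM2l// ?divr_ge0 ?mulr_ge0 ?(ltW lnq0)//.
by rewrite lerXn2r ?nnegrE// (le_trans lny).
Qed.

Lemma approx_growth : exists al C, [/\ 0 <= al, 0 <= C & forall n t,
  S t -> normc t < q ^+ n * rho0 -> dominated b (C * qexp_bound al (normc t)) (approx n t)].
Proof.
have [Cg Cg0 HG] := gfun_bound.
pose a := d%:R ^+ 2 / (2 * ln q) : R.
have a0 : 0 < a by rewrite divr_gt0 ?mulr_gt0 ?exprn_gt0 ?ltr0n.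
(* Bounds, uniformly in [t], the product of 1/|denom|, c_l |t|^l0 and the norm of T_l: the exponent
   (cL + l0) L - a L^2 is maximised by completing the square. *)
pose hl l : R := cP * lcst q k l * M l * expR ((cL + (ell0 l)%:R) ^+ 2 / (4 * a)).
have hl0 l : 0 <= hl l by rewrite !mulr_ge0 ?expR_ge0 ?(ltW (lcst_gt0 _ q1 l)).
pose H := \sum_(l <- r | ell2 l == 1%N) hl l.
have H0 : 0 <= H by apply: sumr_ge0 => l _; exact: hl0.
pose th : R := (rho0 / q + 2) / (rho0 + 2).
have r20 : 0 < rho0 + 2 by rewrite addr_gt0.
have th0 : 0 < th by rewrite divr_gt0// addr_gt0// divr_gt0.
have th1 : th < 1.
  by rewrite ltr_pdivrMr// mul1r ltrD2r ltr_pdivrMr// ltr_pMr.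
have lnth : ln th < 0 by rewrite ln_lt0// th0.
(* [cL] is needed for the source term; the second entry makes H th^al at most 1/2, so that the
   constant [C] is reproduced from one level to the next. *)
pose al := Order.max cL (ln (2 * H + 1) / (- ln th)).
have al0 : 0 <= al by rewrite le_max cL0.
have H21 : 0 < 2 * H + 1 by lra.
have eal : H * expR (al * ln th) <= 2^-1.
  have : expR (al * ln th) <= (2 * H + 1)^-1.
    rewrite -[leRHS]lnK ?posrE ?invr_gt0// ler_expR lnV ?posrE//.
    have : ln (2 * H + 1) / (- ln th) <= al by rewrite le_max lexx orbT.
    by rewrite ler_pdivrMr ?oppr_gt0// mulrN; lra.
  move=> /(ler_wpM2l H0) /le_trans; apply.
  by rewrite ler_pdivrMr//; lra.
(* The first entry covers the initial disc; the second lets the source use at most C / 2, the other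
   half going to the dilated terms. *)
pose C := Order.max (2 * K) (2 * (cP * Cg)).
have C0 : 0 <= C by rewrite le_max mulr_ge0.
exists al, C; split => // n t St.
have small s : normc s < rho0 -> forall m, normc (bsum s m) <= C * qexp_bound al (normc s) * expw b m.
  move=> sr m; have [_ /(_ m)] := dominated_bsum sr; move=> /le_trans; apply.
  rewrite ler_wpM2r ?expw_ge0//.
  apply: (@le_trans _ _ C); last by rewrite ler_peMr// qexp_bound_ge1// normc_ge0.
  apply: (@le_trans _ _ (2 * K)); last by rewrite le_max lexx.
  rewrite -mulrA ler_piMr ?mulr_ge0//; have := Bt sr; lra.
elim: n t St => [|n IH] t St tr.
  split; last by apply: small; move: tr; rewrite expr0 mul1r.
  by apply: cmeas_bsum; move: tr; rewrite expr0 mul1r.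
(* Inside the initial disc the dilation gains nothing uniform, so the power series bound is used
   there at every level. *)
have [trho|rhot] := ltP (normc t) rho0.
  rewrite -(@approx_stable 0 n.+1 t)//; last by rewrite expr0 mul1r.
  by split; [exact: cmeas_bsum|exact: small].
split; first by have [? [? [? [? [? [[]]]]]]] := wdiff_approx St tr.
move=> m; rewrite /approx iterS /continue -/(approx n).
set E := qexp_bound al (normc t); set L := lnmax (normc t).
have E0 : 0 <= E by exact: expR_ge0.
have L0 : 0 <= L by exact: lnmax_ge0.
have LE := lnmax_le (normc_ge0 t).
have di := denom_inv m St; rewrite -/L -/a in di.
have hG : normc ((denom t m)^-1 * gfun t m) <= cP * Cg * E * expw b m.
  rewrite normcM; have [_ /(_ m) hg] := HG t.
  apply: (le_trans (ler_pM (normc_ge0 _) (normc_ge0 _) di hg)).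
  rewrite -/L mulrA ler_wpM2r ?expw_ge0// mulrACA ler_wpM2l ?mulr_ge0//.
  rewrite -expRD ler_expR.
  (* The second summand is exactly the decay of the inverse denominator, and the first is the growth
     of order [k]. *)
  have -> : L ^+ 2 / (2 * gauss_rate) = k%:R / (2 * ln q) * L ^+ 2 + a * L ^+ 2.
    rewrite /gauss_rate /a; have kd : k%:R + d%:R ^+ 2 != 0 :> R by rewrite gt_eqF// ltr_pwDl// exprn_ge0.
    by field; rewrite kd gt_eqF.
  have h1 : cL * L <= al * ln (normc t + 2).
    by apply: ler_pM => //; rewrite le_max lexx.
  have h2 : k%:R / (2 * ln q) * L ^+ 2 <= k%:R / (2 * ln q) * ln (normc t + 2) ^+ 2.
    rewrite ler_wpM2l ?divr_ge0 ?mulr_ge0 ?(ltW lnq0)//.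
    by rewrite lerXn2r ?nnegrE// (le_trans L0).
  lra.
have hS : normc ((denom t m)^-1 * \sum_(l <- r | ell2 l == 1%N)
    ((lcst q k l)%:C * t ^+ ell0 l) * T l (approx n ((ldil q k l)%:C * t)) m) <=
    H * (C * (E * expR (al * ln th))) * expw b m.
  rewrite mulr_sumr big_seq_cond; apply: (le_trans (normc_sum _ _ _)).
  rewrite /H !mulr_suml [leRHS]big_seq_cond; apply: ler_sum => l /andP[lr _].
  have [TB _ _] := TM lr.
  have nl : normc ((ldil q k l)%:C * t) < q ^+ n * rho0.
    by apply: (le_lt_trans (ldilq t lr)); rewrite ltr_pdivrMr// mulrC mulrA -exprS.
  have Sl : S ((ldil q k l)%:C * t).
    by apply: S_scale => //; have /andP[] := ldil_le q1 (r_dil lr).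
  have [_ /(_ m) hT] := TB _ _ (IH _ Sl nl).
  have hE := qexp_bound_dil al0 rhot (normc_ge0 _) (ldilq t lr).
  have lc0 : 0 <= lcst q k l by rewrite ltW ?lcst_gt0.
  rewrite normcM normcM normcM normcR ger0_norm// normcX.
  have hp := pow_le_lnmax (ell0 l) (normc_ge0 t).
  have h3 : normc (denom t m)^-1 * (lcst q k l * normc t ^+ ell0 l) <=
     cP * lcst q k l * expR ((cL + (ell0 l)%:R) ^+ 2 / (4 * a)).
    apply: (@le_trans _ _ (cP * expR (cL * L - a * L ^+ 2) * (lcst q k l * expR ((ell0 l)%:R * L)))).
      by apply: ler_pM; rewrite ?normc_ge0 ?mulr_ge0 ?exprn_ge0 ?normc_ge0// ler_wpM2l.
    rewrite mulrACA -expRD ler_wpM2l ?mulr_ge0// ler_expR.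
    have := quadratic_le (cL + (ell0 l)%:R) L a0; lra.
  rewrite mulrA; apply: (@le_trans _ _ (cP * lcst q k l * expR ((cL + (ell0 l)%:R) ^+ 2 / (4 * a)) *
     (M l * (C * (E * expR (al * ln th))) * expw b m))).
    apply: ler_pM => //; rewrite ?mulr_ge0 ?normc_ge0 ?exprn_ge0 ?normc_ge0//.
    apply: (le_trans hT); rewrite ler_wpM2r ?expw_ge0//; apply: ler_wpM2l; first exact: M0.
    exact: ler_wpM2l.
  by rewrite /hl le_eqVlt; apply/orP; left; apply/eqP; ring.
rewrite mulrDr; apply: (le_trans (normcD _ _)).
apply: (le_trans (lerD hS hG)); rewrite -mulrDl ler_wpM2r ?expw_ge0//.
have -> : H * (C * (E * expR (al * ln th))) + cP * Cg * E = (H * expR (al * ln th) * C + cP * Cg) * E by ring.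
rewrite ler_wpM2r//.
have h4 := ler_wpM2r C0 eal.
have h5 : 2 * (cP * Cg) <= C by rewrite le_max lexx orbT.
lra.
Qed.

End continuation.
End fixed_decay.
End borel_equation.

(** * Summability and the formal solution *)

Section summability.
Context {R : realType}.
Implicit Types (t xi : R[i]).

Lemma expr_unbounded (q x : R) : 1 < q -> exists n : nat, x < q ^+ n.
Proof.
move=> q1; have q10 : 0 < q - 1 by rewrite subr_gt0.
have bern n : 1 + n%:R * (q - 1) <= q ^+ n.
  elim: n => [|n IH]; first by rewrite mul0r addr0 expr0.
  rewrite exprS; apply: (@le_trans _ _ (q * (1 + n%:R * (q - 1)))); last first.
    by rewrite ler_wpM2l// ltW// (lt_trans ltr01).
  have : 0 <= n%:R * (q - 1) ^+ 2 by rewrite mulr_ge0// sqr_ge0.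
  by rewrite -natr1; lra.
pose n := Num.truncn (`|x| / (q - 1)); exists n.+1.
apply: lt_le_trans (bern _); apply: (le_lt_trans (ler_norm x)).
have : `|x| / (q - 1) < n.+1%:R by exact: truncnS_gt.
by rewrite ltr_pdivrMr//; lra.
Qed.

Lemma sector_scale (d delta x : R) t : 0 < x -> sector d delta t -> sector d delta (x%:C * t).
Proof.
move=> x0 [r [phi [r0 hphi ->]]]; exists (x * r), phi; split => //; first exact: mulr_gt0.
by rewrite rmorphM mulrA.
Qed.

Section continuation_to_Gq.
Variables (q a b rho0 K B al C C2 : R) (k : nat) (d delta : R).
Variables (omega : nat -> R -> R[i]) (f : nat -> R[i] -> R -> R[i]).
Hypotheses (q1 : 1 < q) (a0 : 0 < a) (ab : a < b) (rho00 : 0 < rho0) (B0 : 0 < B) (Brho : B * rho0 <= 2^-1).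
Hypotheses (al0 : 0 <= al) (C0 : 0 <= C) (K0 : 0 <= K) (C20 : 0 <= C2) (delta0 : 0 < delta).
Hypothesis domega : forall p, exists D, dominated b D (omega p).
Hypothesis f_stable : forall n n' t, (n <= n')%N -> normc t < q ^+ n * rho0 -> f n t = f n' t.
Hypothesis f_wdiff : forall n t, sector d delta t -> normc t < q ^+ n * rho0 -> wdiff (expw b) (f n) t.
Hypothesis f0_dist : forall t N m, normc t < rho0 ->
  normc (f 0%N t m - \sum_(1 <= n < N) omega n m * t ^+ n) <= K * (B * normc t) ^+ (maxn 1 N) * expw b m.
Hypothesis f_growth : forall n t, sector d delta t -> normc t < q ^+ n * rho0 ->
  dominated b (C * qexp_bound q k al (normc t)) (f n t).
Hypothesis f0_small : forall t, normc t < rho0 -> dominated b (C2 * normc t) (f 0%N t).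

Let weight p : R := q `^ ((p * p.-1)%:R / (2 * k%:R)).

Lemma level_exists t : exists n, normc t < q ^+ n * rho0.
Proof.
have [n hn] := expr_unbounded (normc t / rho0) q1; exists n.
by rewrite -ltr_pdivrMr.
Qed.

Let level t := projT1 (cid (level_exists t)).
Let levelP t : normc t < q ^+ level t * rho0.
Proof. exact: projT2 (cid (level_exists t)). Qed.

(** The levels are glued by choosing for each [t] some disc containing it; [f_stable] makes the
    value independent of the choice. *)
Let W t : Ob (strip a) := Ob_fourier a (f (level t) t).

Let WE n t : normc t < q ^+ n * rho0 -> W t = Ob_fourier a (f n t).
Proof.
move=> tn; rewrite /W; congr (Ob_fourier a _).
have [h|/ltnW h] := leqP (level t) n; first exact: f_stable.
by symmetry; exact: f_stable.
Qed.

Lemma weight_inv p : q `^ (- ((p * p.-1)%:R / (2 * k%:R))) * weight p = 1.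
Proof. by rewrite /weight powRN mulVf// gt_eqF// powR_gt0// (lt_trans ltr01). Qed.

Lemma Gq_summable_continuation :
  Gq_summable q k d (fun p => Ob_fourier a (fun m => (weight p)%:C * omega p m)).
Proof.
(* The weight in the coefficients cancels the Borel factor q^(-n(n-1)/(2k)), leaving the Taylor sums
   of [omega]. *)
have partE xi N : qBorel_partial_sum q k (fun p => Ob_fourier a (fun m => (weight p)%:C * omega p m)) xi N =
    Ob_fourier a (fun m => \sum_(1 <= n < N) omega n m * xi ^+ n).
  have [D HD] := choice domega.
  rewrite (_ : (fun m => _) = (fun m => \sum_(1 <= n < N) xi ^+ n * omega n m)); last first.
    by apply/funext => m; apply: eq_bigr => n _; rewrite mulrC.
  rewrite (Ob_fourier_sum a0 ab _ (fun n _ => dominatedZ (xi ^+ n) (HD n))).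
  apply: eq_bigr => n _.
  rewrite (Ob_fourierZ a0 ab _ (HD n)) (Ob_fourierZ a0 ab _ (HD n)) scalerA.
  by rewrite mulrAC -rmorphM weight_inv rmorph1 mul1r.
have cvgW xi : normc xi < rho0 -> qBorel_partial_sum q k (fun p => Ob_fourier a (fun m => (weight p)%:C * omega p m)) xi @ \oo --> W xi.
  move=> xr; have xB : 0 <= B * normc xi < 1.
    rewrite mulr_ge0 ?normc_ge0 ?(ltW B0)//=.
    by apply: (@lt_le_trans _ _ (B * rho0)); rewrite ?ltr_pM2l//; have h := Brho; lra.
  have xr0 : normc xi < q ^+ 0 * rho0 by rewrite expr0 mul1r.
  rewrite (WE xr0).
  apply: (@cvg_normc_le _ _ _ _ (fun N => fbound (b - a) * K * (B * normc xi) ^+ N)); last exact: cvg_geo0.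
  move=> N; rewrite distrC.
  have [D HD] := choice domega.
  have dS : dominated b (\sum_(1 <= n < N) normc (xi ^+ n) * D n) (fun m => \sum_(1 <= n < N) omega n m * xi ^+ n).
    rewrite (_ : (fun m => _) = (fun m => \sum_(1 <= n < N) xi ^+ n * omega n m)); last first.
      by apply/funext => m; apply: eq_bigr => n _; rewrite mulrC.
    by apply: dominated_sum => n _; exact: dominatedZ.
  have df := f0_small xr.
  have dd : dominated b (K * (B * normc xi) ^+ (maxn 1 N)) (fun m => f 0%N xi m - \sum_(1 <= n < N) omega n m * xi ^+ n).
    split; last by move=> m; exact: f0_dist.
    by apply: cmeasB; [case: df|case: dS].
  have -> : Ob_fourier a (f 0%N xi) - qBorel_partial_sum q k (fun p => Ob_fourier a (fun m => (weight p)%:C * omega p m)) xi N =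
     Ob_fourier a (fun m => f 0%N xi m - \sum_(1 <= n < N) omega n m * xi ^+ n).
    rewrite partE; apply/eqP; rewrite subr_eq -(Ob_fourierD a0 ab dd dS); apply/eqP.
    by congr (Ob_fourier a _); apply/funext => m; rewrite subrK.
  apply: (le_trans (Ob_fourier_norm a0 ab dd)); rewrite lecR -mulrA.
  rewrite ler_wpM2l ?fbound_ge0//.
  rewrite ler_wpM2l//; apply: ler_wiXn2l; rewrite ?leq_maxr//.
  - by case/andP: xB.
  - by case/andP: xB => _ /ltW.
exists rho0 => //; split.
  by move=> xi xr; apply/cvg_ex; exists (W xi); exact: cvgW.
exists delta, W; split => //.
- move=> z Sz; pose n := level z.
  (* On a disc around [z] that stays in the disc of level [n], the glued function coincides with the
     single function of that level. *)
  have e0 : 0 < (q ^+ n * rho0 - normc z) / 2 by rewrite divr_gt0// subr_gt0 levelP.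
  apply: (near_derive1 (G := fun t => Ob_fourier a (f n t)) e0 _).1; last first.
    by apply: (@Ob_fourier_derivable _ a b a0 ab (f n) z); apply: f_wdiff => //; exact: levelP.
  move=> h hz; apply: WE; apply: (le_lt_trans (normcD _ _)).
  have := levelP z; rewrite -/n; lra.
- by move=> xi _ xr; symmetry; apply: cvg_lim; [exact: norm_hausdorff|exact: cvgW].
(* The bound needs a factor |xi|: near 0 it comes with [C2], and beyond [rho0] from 1 <= |xi| /
   rho0. The added 1 here, like the one in [al + 1] below, secures strict positivity. *)
pose K1 := fbound (b - a) * (C2 + C / rho0) + 1.
have fb0 := fbound_ge0 (b - a) : 0 <= fbound (b - a) :> R.
have K10 : 0 < K1 by rewrite ltr_wpDl// mulr_ge0// addr_ge0// divr_ge0// ltW.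
exists K1, (al + 1), 2; split => //; [by rewrite ltr_wpDl|by rewrite ltr1n|].
move=> xi Sxi; have n0 := normc_ge0 xi.
have E1 : qexp_bound q k al (normc xi) <=
   expR (k%:R / (2 * ln q) * ln (normc xi + 2) ^+ 2 + (al + 1) * ln (normc xi + 2)).
  rewrite ler_expR lerD2l ler_wpM2r ?lerDl// ln_ge0//; lra.
have [xr|rx] := ltP (normc xi) rho0.
  have xr0 : normc xi < q ^+ 0 * rho0 by rewrite expr0 mul1r.
  rewrite (WE xr0); apply: (le_trans (Ob_fourier_norm a0 ab (f0_small xr))).
  rewrite lecR; apply: (@le_trans _ _ (K1 * normc xi)).
    rewrite mulrA ler_wpM2r// /K1 mulrDr.
    have : 0 <= fbound (b - a) * (C / rho0) by rewrite mulr_ge0// divr_ge0// ltW.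
    lra.
  rewrite ler_peMr ?mulr_ge0 ?(ltW K10)//; apply: le_trans E1.
  exact: qexp_bound_ge1.
have dn := f_growth Sxi (levelP xi).
apply: (le_trans (Ob_fourier_norm a0 ab dn)); rewrite lecR.
have Q0 : 0 <= qexp_bound q k al (normc xi) by exact: expR_ge0.
apply: (@le_trans _ _ (K1 * normc xi * qexp_bound q k al (normc xi))); last first.
  by rewrite ler_wpM2l// mulr_ge0// ltW.
rewrite mulrA ler_wpM2r//; apply: (@le_trans _ _ (fbound (b - a) * (C / rho0) * normc xi)).
  by rewrite -mulrA ler_wpM2l// mulrAC ler_pdivlMr// ler_wpM2l.
rewrite ler_wpM2r// /K1 mulrDr.
have : 0 <= fbound (b - a) * C2 by rewrite mulr_ge0.
lra.
Qed.

End continuation_to_Gq.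
End summability.

(** * Lower bounds for the denominator on the sector *)

Section denominator.
Context {R : realType}.
Implicit Types (t p : R[i]).

Lemma exp_q0 (q : R) : exp_q q 0 = 1 :> R[i].
Proof.
apply: limc_eq; apply: (@cvg_normc_le _ _ _ _ (fun N => 2 * (2^-1 : R) ^+ N)); last first.
  by apply: cvg_geo0; apply/andP; split; lra.
case=> [|N]; first by rewrite /series/= big_geq// sub0r normrN normcE normc1 lecR expr0 mulr1 ler1n.
rewrite /series/= big_nat_recl//= expr0 mulr1 qfact0 invr1.
rewrite big1 ?addr0; last by move=> i _; rewrite expr0n/= mulr0.
by rewrite subrr normr0 ler0c mulr_ge0// exprn_ge0// invr_ge0.
Qed.

Variables (q alpha C0 e0 r2 : R) (d : nat) (S : set R[i]).
Let x0 := Num.sqrt q / (q - 1).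
Let I0 := inf [set expR (mu_q q x) | x in [set x : R | x0 <= x]].
Hypotheses (q1 : 1 < q) (d0 : (0 < d)%N) (alpha0 : 0 < alpha) (e00 : 0 < e0).
Hypothesis exp_disc : forall z : R[i], normc z <= x0 -> C0 <= normc (exp_q q z).
Hypothesis exp_sector : forall t, S t -> x0 <= normc (alpha%:C * t ^+ d) ->
  e0 * expR (mu_q q (normc (alpha%:C * t ^+ d))) <= normc (exp_q q (alpha%:C * t ^+ d)).
Hypotheses (r20 : 0 < r2) (r2C : r2 < C0) (r2I : r2 < e0 * I0).

Let q0 : 0 < q. Proof. exact: lt_trans ltr01 q1. Qed.
Let lnq0 : 0 < ln q. Proof. exact: ln_gt0. Qed.
Let x00 : 0 < x0. Proof. by rewrite divr_gt0 ?sqrtr_gt0// subr_gt0. Qed.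

Let I0_le x : x0 <= x -> I0 <= expR (mu_q q x).
Proof.
move=> xx; apply: ge_inf; last by exists x.
by exists 0 => _ [y _ <-]; exact: expR_ge0.
Qed.

Lemma exp_q_denominator_lower : exists2 c : R, 0 < c & forall t p, S t -> normc p <= r2 ->
  c <= normc (p - exp_q q (alpha%:C * t ^+ d)).
Proof.
exists (Order.min (C0 - r2) (e0 * I0 - r2)); first by rewrite lt_min !subr_gt0 r2C.
move=> t p St pr; rewrite normcBC; apply: le_trans (normc_le_dist _ _).
have [zx|xz] := leP (normc (alpha%:C * t ^+ d)) x0.
  by rewrite ge_min; apply/orP; left; have := exp_disc zx; lra.
rewrite ge_min; apply/orP; right.
have h := exp_sector St (ltW xz).
have h' := ler_wpM2l (ltW e00) (I0_le (ltW xz)); lra.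
Qed.

(** For large |t| the denominator is at least a fixed fraction of exp(mu_q(alpha |t|^d)), whose
    leading exponent is d^2 ln^2 |t| / (2 ln q). On the remaining bounded range the uniform lower
    bound suffices. *)
Lemma exp_q_denominator_inv : exists cP cL : R, [/\ 0 <= cP, 0 <= cL & forall t p, S t -> normc p <= r2 ->
  normc (p - exp_q q (alpha%:C * t ^+ d))^-1 <=
  cP * expR (cL * lnmax (normc t) - d%:R ^+ 2 / (2 * ln q) * lnmax (normc t) ^+ 2)].
Proof.
have [c c0 Hc] := exp_q_denominator_lower.
pose a := d%:R ^+ 2 / (2 * ln q); have a0 : 0 <= a by rewrite divr_ge0 ?exprn_ge0// mulr_ge0// ltW.
pose A := ln alpha; pose b1 := - 2^-1 + ln (q - 1) / ln q.
pose L1 := lnmax (x0 / alpha).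
(* As exp(mu_q) is at least [I0], r2 is at most r2 / I0 times it; subtracting from the lower bound
   on exp_q leaves the factor [kap]. *)
pose kap := e0 - r2 / I0.
have I00 : 0 < I0 by rewrite -(pmulr_rgt0 _ e00) (lt_trans r20).
have kap0 : 0 < kap by rewrite subr_gt0 ltr_pdivrMr.
pose cP := Order.max (c^-1 * expR (a * L1 ^+ 2)) (kap^-1 * expR (`|b1 * A|)).
pose cL := `|A| * d%:R / ln q + `|b1| * d%:R.
have cP0 : 0 <= cP by rewrite le_max mulr_ge0 ?expR_ge0// invr_ge0 ltW.
have cL0 : 0 <= cL by rewrite addr_ge0 ?mulr_ge0 ?invr_ge0 ?(ltW lnq0).
exists cP, cL; split => // t p St pr; rewrite -/a.
set L := lnmax (normc t); have L0 : 0 <= L by exact: lnmax_ge0.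
set z := alpha%:C * t ^+ d.
have zE : normc z = alpha * normc t ^+ d by rewrite normcM normcR normcX gtr0_norm.
have n0 := normc_ge0 t.
have small : L <= L1 -> normc (p - exp_q q z)^-1 <= cP * expR (cL * L - a * L ^+ 2).
  move=> LL; rewrite normcV.
  apply: (@le_trans _ _ c^-1); first by rewrite lef_pV2 ?posrE ?(lt_le_trans c0)// Hc.
  apply: (@le_trans _ _ (c^-1 * expR (a * L1 ^+ 2) * expR (cL * L - a * L ^+ 2))); last first.
    by rewrite ler_wpM2r ?expR_ge0// le_max lexx.
  rewrite -mulrA -expRD ler_peMr ?invr_ge0 ?(ltW c0)// -[leLHS]expR0 ler_expR.
  have : a * L ^+ 2 <= a * L1 ^+ 2 by rewrite ler_wpM2l// lerXn2r ?nnegrE ?lnmax_ge0.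
  have : 0 <= cL * L by rewrite mulr_ge0.
  lra.
have [t1|t1] := leP (normc t) 1.
  by apply: small; rewrite /L /lnmax (max_idPl t1) ln1 lnmax_ge0.
have LE : L = ln (normc t) by rewrite /L /lnmax (max_idPr (ltW t1)).
have tp : 0 < normc t by exact: lt_trans t1.
have [zx|xz] := leP (normc z) x0.
  apply: small; rewrite LE /L1 /lnmax ler_ln ?posrE ?lt_max ?ltr01// le_max; apply/orP; right.
  rewrite ler_pdivlMr// mulrC; apply: le_trans zx; rewrite zE ler_wpM2l ?(ltW alpha0)//.
  rewrite -[X in X <= _]expr1 ler_weXn2l//; exact: ltW.
have h := exp_sector St (ltW xz); rewrite -/z in h.
have Ile := I0_le (ltW xz); set mz := expR _ in h Ile.
have mz0 : 0 < mz by exact: expR_gt0.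
have low : kap * mz <= normc (p - exp_q q z).
  rewrite normcBC; apply: le_trans (normc_le_dist _ _).
  have : r2 <= r2 / I0 * mz by rewrite mulrAC ler_pdivlMr// ler_wpM2l// ltW.
  rewrite /kap mulrBl; lra.
rewrite normcV; apply: (@le_trans _ _ (kap * mz)^-1).
  by rewrite lef_pV2 ?posrE ?mulr_gt0// (lt_le_trans _ low)// mulr_gt0.
apply: (@le_trans _ _ (kap^-1 * expR (`|b1 * A|) * expR (cL * L - a * L ^+ 2))); last first.
  by rewrite ler_wpM2r ?expR_ge0// le_max lexx orbT.
rewrite invfM -[leRHS]mulrA ler_wpM2l ?invr_ge0 ?(ltW kap0)// /mz -expRN -expRD ler_expR.
have -> : mu_q q (normc z) = (A + d%:R * L) ^+ 2 / (2 * ln q) + b1 * (A + d%:R * L).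
  have lnz : ln (normc z) = A + d%:R * L.
    by rewrite zE lnM ?posrE ?exprn_gt0// lnXn// LE mulr_natl.
  by rewrite /mu_q lnz.
have -> : (A + d%:R * L) ^+ 2 / (2 * ln q) = A ^+ 2 / (2 * ln q) + A * d%:R / ln q * L + a * L ^+ 2.
  by rewrite /a; field; rewrite gt_eqF.
have g1 : 0 <= A ^+ 2 / (2 * ln q) by rewrite divr_ge0 ?sqr_ge0// mulr_ge0// ltW.
have g2 : - (A * d%:R / ln q * L) <= `|A| * d%:R / ln q * L.
  rewrite -!mulNr ler_wpM2r// ler_wpM2r ?invr_ge0 ?(ltW lnq0)// ler_wpM2r//.
  by rewrite -normrN ler_norm.
have g3 : - (b1 * A) <= `|b1 * A| by rewrite -normrN ler_norm.
have g4 : - (b1 * (d%:R * L)) <= `|b1| * d%:R * L.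
  by rewrite -mulNr mulrA ler_wpM2r// ler_wpM2r// -normrN ler_norm.
have e1 : cL * L = `|A| * d%:R / ln q * L + `|b1| * d%:R * L by rewrite /cL mulrDl.
have e2 : b1 * (A + d%:R * L) = b1 * A + b1 * (d%:R * L) by rewrite mulrDr.
rewrite e1 e2; lra.
Qed.

End denominator.

(** * Coefficient identities under the q-Borel weights *)

Section coefficient_identities.
Context {R : realType}.
Variables (q : R) (k : nat).
Hypotheses (q1 : 1 < q) (k0 : (0 < k)%N).

Let q0 : 0 < q. Proof. exact: lt_trans ltr01 q1. Qed.
Let kn0 : k%:R != 0 :> R. Proof. by rewrite pnatr_eq0 -lt0n. Qed.

Definition bweight p : R := q `^ ((p * p.-1)%:R / (2 * k%:R)).

Lemma bweight_gt0 p : 0 < bweight p. Proof. exact: powR_gt0. Qed.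

Lemma iter_dilation (V : lmodType R[i]) (d n p : nat) (g : nat -> V) :
  iter n (fun h => t_mul d (q_dilation q (d%:R / k%:R) h)) g p =
  if (n * d <= p)%N then
    (bweight p / bweight (p - n * d) * (q `^ (- ((d * d.-1)%:R / (2 * k%:R)))) ^+ n)%:C *: g (p - n * d)%N
  else 0.
Proof.
elim: n p => [|n IH] p.
  by rewrite mul0n subn0 expr0 mulr1 divff ?scale1r// gt_eqF// bweight_gt0.
rewrite iterS /t_mul; case: ifPn => dp; last first.
  rewrite ifN// -ltnNge mulSn (leq_trans _ (leq_addr _ _))// ltnNge.
  exact: dp.
rewrite /q_dilation IH leq_subRL// -mulSn; case: ifPn => // ndp; last by rewrite scaler0.
rewrite scalerA -subnDA -mulSn; congr (_ *: _); rewrite -rmorphM; congr (_ %:C).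
(* Relative to the weights each iterate contributes the constant q^(-d(d-1)/(2k)); this is the
   factor that turns [alphaD] into [alphaDt]. *)
have key : q `^ (d%:R / k%:R * (p - d)%:R) * bweight (p - d) =
    bweight p * q `^ (- ((d * d.-1)%:R / (2 * k%:R))).
  rewrite /bweight !powR_expR// -!expRD; congr expR; rewrite -!mulrDl; congr (_ * _).
  rewrite !natr_mul_pred natrB//; field; exact: kn0.
rewrite exprS; set x := q `^ (d%:R / _ * _) in key *; set y := q `^ _ in key *.
transitivity ((x * bweight (p - d)) / bweight (p - n.+1 * d) * y ^+ n); first by ring.
by rewrite key; ring.
Qed.

Lemma sum_sparse (W : zmodType) (d p : nat) (F : nat -> nat -> W) : (0 < d)%N ->
  \sum_(n < p.+1) (if (n * d <= p)%N then F n (p - n * d)%N else 0) =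
  \sum_(i < p.+1) (if (d %| i)%N then F (i %/ d)%N (p - i)%N else 0).
Proof.
move=> d0.
pose G i := if (d %| i)%N && (i <= p)%N then F (i %/ d)%N (p - i)%N else 0.
have GN N : \sum_(0 <= n < N) G (n * d)%N = \sum_(0 <= i < N * d) G i.
  elim: N => [|N IH]; first by rewrite mul0n !big_geq.
  rewrite big_nat_recr//= IH mulSn addnC [RHS](big_cat_nat (n := (N * d)%N)) ?leq_addr//=.
  congr (_ + _); rewrite big_ltn; last by rewrite -[X in (X < _)%N]addn0 ltn_add2l.
  rewrite [X in _ = _ + X]big_nat big1 ?addr0// => i /andP[i1 i2].
  rewrite /G; case: ifPn => // /andP[/dvdnP[j ij] _]; exfalso.
  move: i1 i2; rewrite ij ltn_mul2r d0/= -mulSnr ltn_mul2r d0/= ltnS.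
  by move=> h1 h2; have := leq_trans h1 h2; rewrite ltnn.
transitivity (\sum_(0 <= n < p.+1) G (n * d)%N).
  by rewrite big_mkord; apply: eq_bigr => n _; rewrite /G dvdn_mull//= mulnK.
rewrite GN (big_cat_nat (n := p.+1))//=; last by rewrite leq_pmulr.
rewrite [X in _ + X = _]big_nat [X in _ + X = _]big1 ?addr0; last first.
  by move=> i /andP[pi _]; rewrite /G leqNgt pi andbF.
by rewrite big_mkord; apply: eq_bigr => i _; rewrite /G -ltnS ltn_ord andbT.
Qed.

Lemma lcoef_weight l p : lok l p ->
  lcoef q k l p = q `^ ((ell1 l)%:R * (lidx l p)%:R) * bweight (lidx l p) / bweight p.
Proof.
move=> ok; rewrite /lcoef ok /lexp /bweight !powR_expR// -expRN -!expRD; congr expR.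
ring.
Qed.

End coefficient_identities.

(** * The formal solution *)

Section formal_solution_coefficients.
Context {R : realType}.
Variables (q alphaD alphaDt beta : R) (k dD : nat) (A : {fset nat * nat * nat}) (J : {fset nat}).
Variables (Q RD : {poly R[i]}) (Rl : nat * nat * nat -> {poly R[i]}).
Variables (Al : nat * nat * nat -> R -> R[i]) (Cl : nat * nat * nat -> R) (Fj : nat -> R -> R[i]).
Hypotheses (q1 : 1 < q) (k0 : (0 < k)%N) (d0 : (0 < dD)%N).
Hypothesis alphaE : alphaDt = alphaD * q `^ (- ((dD * dD.-1)%:R / (2 * k%:R))).
Hypothesis RD0 : forall m : R, RD.[0 +i* m] != 0.
Hypothesis A_pos : forall l, l \in enum_fset A -> [/\ (0 < ell0 l)%N, (0 < ell1 l)%N & (0 < ell2 l)%N].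

Definition borel_op l : (R -> R[i]) -> R -> R[i] := wconv RD (Rl l) (Al l).
Definition borel_pc (m : R) : R[i] := Q.[0 +i* m] / RD.[0 +i* m].
Definition borel_forcing p (m : R) : R[i] := if p \in J then (RD.[0 +i* m])^-1 * Fj p m else 0.

Local Notation omega := (borel_coef q alphaDt k dD (enum_fset A) borel_op borel_pc borel_forcing).
Local Notation w p := (bweight q k p).

Hypothesis pc1 : forall m, borel_pc m - 1 != 0.
Hypothesis dAl : forall l, l \in enum_fset A -> dominated beta (Cl l) (Al l).
Hypothesis dFj : forall j, j \in J -> decays beta (Fj j).
Hypothesis domega : forall p, decays beta (omega p).
Hypothesis dT : forall l p, l \in enum_fset A -> decays beta (borel_op l (omega p)).

Definition borel_solution p : R[i] -> R[i] := inv_fourier (fun m => (w p)%:C * omega p m).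

Lemma dominated_strip z f : strip beta z -> decays beta f ->
  exists b C, [/\ `|complex.Im z| < b, b < beta & dominated b C f].
Proof.
rewrite /strip/= => zb df; pose a := (`|complex.Im z| + beta) / 2.
have za : `|complex.Im z| < a by rewrite /a; lra.
have [|C fC] := df a; last by exists a, C; split => //; rewrite /a; lra.
by apply/andP; split; rewrite /a; have := normr_ge0 (complex.Im z); lra.
Qed.

Section at_point.
Variable z : R[i].
Hypothesis zb : strip beta z.

Lemma diffop_borel_solution P p : diffop P (borel_solution p) z =
  (w p)%:C * inv_fourier (fun m => P.[0 +i* m] * omega p m) z.
Proof.
rewrite /borel_solution (diffop_inv_fourier _ (decaysZ _ (domega p)) zb).
rewrite -(inv_fourier_decaysZ _ (decays_horner P (domega p)) zb).
by apply: eq_inv_fourier => m; rewrite mulrCA.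
Qed.

Lemma exp_q_op_borel p :
  exp_q_op q k alphaD dD (fun n => diffop RD (borel_solution n)) p z =
  (w p)%:C * \sum_(i < p.+1) (ecoef q alphaDt dD i)%:C *
    inv_fourier (fun m => RD.[0 +i* m] * omega (p - i)%N m) z.
Proof.
rewrite /exp_q_op fct_sumE.
pose F n j : R[i] := (alphaDt ^+ n / qfact q n)%:C * inv_fourier (fun m => RD.[0 +i* m] * omega j m) z.
transitivity (\sum_(n < p.+1) (w p)%:C * (if (n * dD <= p)%N then F n (p - n * dD)%N else 0)).
  apply: eq_bigr => n _; rewrite iter_dilation//; case: ifPn => [np|_]; last first.
    by rewrite mulr0 scaler0.
  rewrite scalerA; set c := (_ * _)%:C; set c' := _ * _.
  rewrite -[LHS]/(c' * diffop RD (borel_solution (p - n * dD)) z).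
  rewrite diffop_borel_solution /F mulrA mulrA; congr (_ * _).
  rewrite /c' /c -!(rmorphM (real_complex R)); congr (_ %:C); rewrite alphaE exprMn.
  have w0 : w (p - n * dD) != 0 by rewrite gt_eqF// bweight_gt0.
  have reorder (a x1 x2 x3 x4 : R) : x2 != 0 -> x4 != 0 ->
      a / x4 * (x1 / x2 * x3) * x2 = x1 * (a * x3 / x4).
    by move=> x20 x40; field; apply/andP.
  by apply: reorder => //; rewrite gt_eqF// qfact_gt0.
rewrite -mulr_sumr; congr (_ * _); rewrite (sum_sparse _ F)//; apply: eq_bigr => i _.
by rewrite /F /ecoef; case: ifP => // _; rewrite mul0r.
Qed.

(** Multiplication by a_l becomes convolution with A_l, and the factor [RD] cancels the division
    built into [wconv]. *)
Lemma source_borel l p : l \in enum_fset A ->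
  inv_fourier (Al l) z * t_subst (ell2 l) (t_mul (ell0 l)
    (q_dilation q (ell1 l)%:R (fun n => diffop (Rl l) (borel_solution n)))) p z =
  (w p)%:C * ((lcoef q k l p)%:C * inv_fourier (fun m => RD.[0 +i* m] * borel_op l (omega (lidx l p)) m) z).
Proof.
move=> lA; rewrite /t_subst /t_mul.
have [ok|nok] := boolP (lok l p); last first.
  rewrite /lcoef (negbTE nok) mul0r mulr0; move: nok; rewrite /lok negb_and.
  by case: ifP => //= _; [case: ifP => // _ _; rewrite mulr0|rewrite mulr0].
have /andP[-> ->] := ok; rewrite /q_dilation -/(lidx l p) /=.
rewrite -[X in _ * X]/(_ * diffop (Rl l) (borel_solution (lidx l p)) z).
rewrite diffop_borel_solution lcoef_weight//.
have w0 : (w p)%:C != 0 :> R[i] by rewrite (inj_eq (@complexI R)) gt_eqF// bweight_gt0.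
rewrite (eq_inv_fourier (f := fun m => RD.[0 +i* m] * _) (g := fconv (Al l) (fun s => (Rl l).[0 +i* s] * omega (lidx l p) s))); last first.
  by move=> m; rewrite /borel_op /wconv mulrA mulfV// mul1r.
have [b [C [zb' bb dC]]] := dominated_strip zb (decays_horner (Rl l) (domega (lidx l p))).
rewrite -(inv_fourier_conv (dAl lA) dC (ltW bb) zb') !rmorphM fmorphV/=.
by field.
Qed.

Lemma forcing_borel p : forcing q k J (fun j => inv_fourier (Fj j)) p z =
  (w p)%:C * inv_fourier (fun m => RD.[0 +i* m] * borel_forcing p m) z.
Proof.
rewrite /forcing /borel_forcing -/(w p) mulrC; case: ifP => pJ; last first.
  under eq_fun do rewrite mulr0.
  by rewrite inv_fourier0 mulr0.
by congr (_ * _); apply: eq_inv_fourier => m; rewrite mulrA mulfV// mul1r.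
Qed.

Lemma borel_forcing_decays p : decays beta (fun m => RD.[0 +i* m] * borel_forcing p m).
Proof.
rewrite /borel_forcing; have [pJ|pJ] := boolP (p \in J); last first.
  by under eq_fun do rewrite mulr0; exact: decays0.
rewrite (_ : (fun m => _) = Fj p); first exact: dFj.
by apply/funext => m; rewrite mulrA mulfV// mul1r.
Qed.

End at_point.

(** Once the weight is factored out, both sides are inverse Fourier transforms of RD(im) times the
    two sides of the Borel recursion; [decays] tolerates the polynomial factors when the transform
    is distributed over the sums. *)
Lemma formal_solution_borel :
  formal_solution q k beta A alphaD dD Q RD Rl (fun l => inv_fourier (Al l))
    (forcing q k J (fun j => inv_fourier (Fj j))) borel_solution.
Proof.
move=> p z zb; rewrite exp_q_op_borel// forcing_borel// diffop_borel_solution//.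
have -> : \sum_(l <- A) inv_fourier (Al l) z * t_subst (ell2 l) (t_mul (ell0 l)
    (q_dilation q (ell1 l)%:R (fun n => diffop (Rl l) (borel_solution n)))) p z =
  (w p)%:C * \sum_(l <- A | l \in enum_fset A) (lcoef q k l p)%:C *
     inv_fourier (fun m => RD.[0 +i* m] * borel_op l (omega (lidx l p)) m) z.
  rewrite mulr_sumr big_seq; apply: eq_bigr => l lA; exact: source_borel.
rewrite -!mulrDr; congr (_ * _).
have d1 i : decays beta (fun m => (ecoef q alphaDt dD i)%:C * (RD.[0 +i* m] * omega (p - i)%N m)).
  by apply: decaysZ; exact: decays_horner.
have d2 l : l \in enum_fset A -> decays beta (fun m => (lcoef q k l p)%:C * (RD.[0 +i* m] * borel_op l (omega (lidx l p)) m)).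
  by move=> lA; apply: decaysZ; apply: decays_horner; exact: dT.
have s1 := decays_sum (index_enum 'I_p.+1) (P := xpredT) (fun (i : 'I_p.+1) _ => d1 i).
have s2 := decays_sum (enum_fset A) (P := fun l => l \in enum_fset A) d2.
transitivity (inv_fourier (fun m => (\sum_(i < p.+1) (ecoef q alphaDt dD i)%:C * (RD.[0 +i* m] * omega (p - i)%N m) +
   \sum_(l <- A | l \in enum_fset A) (lcoef q k l p)%:C * (RD.[0 +i* m] * borel_op l (omega (lidx l p)) m)) +
   RD.[0 +i* m] * borel_forcing p m) z).
  apply: eq_inv_fourier => m.
  have -> : Q.[0 +i* m] * omega p m = RD.[0 +i* m] * (borel_pc m * omega p m).
    by rewrite /borel_pc mulrA mulrCA mulfV ?mulr1.
  rewrite borel_coef_eq// !mulrDr !mulr_sumr -big_seq; congr (_ + _ + _).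
    by apply: eq_bigr => i _; rewrite mulrCA.
  by apply: eq_bigr => l _; rewrite mulrCA.
rewrite (inv_fourier_decaysD (decaysD s1 s2) (borel_forcing_decays p) zb).
rewrite (inv_fourier_decaysD s1 s2 zb); congr (_ + _ + _).
  rewrite (inv_fourier_sum _ (b := beta))//.
  by apply: eq_bigr => i _; rewrite (inv_fourier_decaysZ _ _ zb)//; exact: decays_horner.
rewrite (inv_fourier_sum _ (b := beta))//.
apply: eq_bigr => l lA; rewrite (inv_fourier_decaysZ _ _ zb)//.
by apply: decays_horner; exact: dT.
Qed.

End formal_solution_coefficients.

(** * Summability of the formal solution *)

Section borel_summability.
Context {R : realType}.
Variables (q alpha : R) (k d : nat) (r : seq (nat * nat * nat)).
Variables (T : nat * nat * nat -> (R -> R[i]) -> R -> R[i]) (pc : R -> R[i]) (fr : nat -> R -> R[i]).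
Hypotheses (q1 : 1 < q) (k0 : (0 < k)%N) (d0 : (0 < d)%N) (alpha0 : 0 < alpha).
Hypothesis r_pos : forall l, l \in r -> [/\ (0 < ell0 l)%N, (0 < ell1 l)%N & (0 < ell2 l)%N].
Hypothesis r_dil : forall l, l \in r -> (ell1 l)%:R <= (ell0 l)%:R / k%:R - 1 :> R.
Hypothesis r_gauss : forall l, l \in r -> (1 < ell2 l)%N ->
  k%:R < ((ell2 l)%:R ^+ 2 - 1) * d%:R ^+ 2 :> R.
Variables (b c0 CF : R) (M : nat * nat * nat -> R) (J0 : nat).
Hypothesis M0 : forall l, 0 <= M l.
Hypothesis TM : forall l, l \in r -> bounded_linear b (M l) (T l).
Hypotheses (mpc : cmeas pc) (c00 : 0 < c0) (pc1 : forall m, c0 <= normc (pc m - 1)).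
Hypothesis frC : forall p, dominated b CF (fr p).
Hypothesis fr0 : forall p m, (J0 < p)%N -> fr p m = 0.
Hypothesis fr00 : forall m, fr 0%N m = 0.
Variables (C0 e0 r2 rho dir delta a : R).
Hypotheses (e00 : 0 < e0) (r20 : 0 < r2) (delta0 : 0 < delta) (rho0 : 0 < rho) (a0 : 0 < a) (ab : a < b).
Hypothesis exp_disc : forall z : R[i], normc z <= Num.sqrt q / (q - 1) -> C0 <= normc (exp_q q z).
Hypothesis exp_sector : forall t : R[i], sector dir delta t ->
  Num.sqrt q / (q - 1) <= normc (alpha%:C * t ^+ d) ->
  e0 * expR (mu_q q (normc (alpha%:C * t ^+ d))) <= normc (exp_q q (alpha%:C * t ^+ d)).
Hypothesis r2C : r2 < C0.
Hypothesis r2I : r2 < e0 *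
  inf [set expR (mu_q q x) | x in [set x : R | Num.sqrt q / (q - 1) <= x]].
Hypothesis pcr2 : forall m, normc (pc m) <= r2.
Hypothesis rho_disc : forall t : R[i], normc t < rho ->
  normc (alpha%:C * t ^+ d) < Num.sqrt q / (q - 1).

Local Notation omega := (borel_coef q alpha k d r T pc fr).

Lemma borel_coef_Gq_summable :
  Gq_summable q k dir (fun p => Ob_fourier a (fun m => (bweight q k p)%:C * omega p m)).
Proof.
have [K [B [K0 B1 oKB]]] := borel_coef_bound q1 k0 d0 alpha0 r_pos r_dil M0 TM mpc c00 pc1 frC.
have B0 : 0 < B by exact: lt_le_trans B1.
(* Below [rho] the argument of exp_q stays in the disc where |exp_q| >= C0 > r2, so the denominator
   is nonzero; the second entry gives ratio at most 1/2 in the Taylor series. *)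
pose rho1 := Order.min rho (2 * B)^-1.
have rho10 : 0 < rho1 by rewrite lt_min rho0 invr_gt0 mulr_gt0.
have Brho : B * rho1 <= 2^-1.
  apply: (@le_trans _ _ (B * (2 * B)^-1)); first by rewrite ler_wpM2l ?(ltW B0)// ge_min lexx orbT.
  by rewrite le_eqVlt; apply/orP; left; apply/eqP; field; rewrite gt_eqF.
have denomE t m : denom q alpha d pc t m = pc m - exp_q q (alpha%:C * t ^+ d).
  by rewrite /denom /esum_q csum_ecoef.
have denomD t : normc t < rho1 -> forall m, denom q alpha d pc t m != 0.
  rewrite lt_min => /andP[tr _] m; apply/eqP; rewrite denomE => /eqP; rewrite subr_eq0 => /eqP e.
  by have := exp_disc (ltW (rho_disc tr)); rewrite -e; have := pcr2 m; have := r2C; lra.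
have [cS cS0 HcS] := exp_q_denominator_lower e00 exp_disc exp_sector r2C r2I.
have [cP [cL [cP0 cL0 HcP]]] := exp_q_denominator_inv q1 d0 alpha0 e00 exp_disc exp_sector r20 r2C r2I.
have denomS t m : sector dir delta t -> cS <= normc (denom q alpha d pc t m).
  by move=> St; rewrite denomE; apply: HcS.
have denom_inv t m : sector dir delta t -> normc (denom q alpha d pc t m)^-1 <=
    cP * expR (cL * lnmax (normc t) - d%:R ^+ 2 / (2 * ln q) * lnmax (normc t) ^+ 2).
  by move=> St; rewrite denomE; apply: HcP.
have S_scale := @sector_scale R dir delta.
have [al [C [al0 C_0 growth]]] := approx_growth q1 k0 d0 alpha0 r_pos r_dil r_gauss M0 TM mpc
  c00 pc1 frC fr0 B1 oKB rho10 Brho denomD fr00 pcr2 S_scale cS0 cP0 cL0 denomS denom_inv.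
apply: (Gq_summable_continuation (rho0 := rho1) (K := 2 * K) (B := B) (al := al) (C := C)
  (C2 := 2 * K * B) (delta := delta) (f := approx q alpha k d r T pc fr) q1 a0 ab) => //.
- by rewrite mulr_ge0.
- by rewrite !mulr_ge0// ltW.
- by move=> p; exists (K * B ^+ p); exact: oKB.
- exact: (approx_stable q1 k0 d0 alpha0 r_pos r_dil r_gauss M0 TM mpc
    c00 pc1 frC fr0 B1 oKB rho10 Brho denomD).
- exact: (wdiff_approx q1 k0 d0 alpha0 r_pos r_dil r_gauss M0 TM mpc
    c00 pc1 frC fr0 B1 oKB Brho pcr2 S_scale cS0 denomS).
- exact: (bsum_dist r_pos B1 oKB Brho fr00).
- exact: (dominated_bsum r_pos B1 oKB Brho fr00).
Qed.

End borel_summability.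

Lemma exp_decay_dominated {R : realType} (beta mu C : R) (f : R -> R[i]) : 0 <= mu ->
  continuous f -> exp_decay beta mu C f -> dominated beta C f.
Proof.
move=> mu0 cf df; split; first exact: cmeas_continuous.
have C0 : 0 <= C.
  have := df 0; rewrite normr0 addr0 powR1 mulr0 oppr0 expR0 !mulr1.
  by apply: le_trans; exact: normc_ge0.
move=> m; apply: (le_trans (df m)); rewrite ler_wpM2r ?expR_ge0// ler_piMr//.
by rewrite -[leRHS](powRr0 (1 + `|m|)) ler_powR ?oppr_le0// lerDl.
Qed.

Lemma sqrt_lt_gauss {R : realType} (k l d : nat) : (1 < l)%N ->
  Num.sqrt (k%:R / (l%:R ^+ 2 - 1)) < d%:R :> R ->
  k%:R < (l%:R ^+ 2 - 1) * d%:R ^+ 2 :> R.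
Proof.
move=> l1 h; have l0 : 0 < l%:R ^+ 2 - 1 :> R.
  by rewrite subr_gt0 -natrX ltr1n -(exp1n 2) ltn_exp2r.
have := h; rewrite -(ltr_pXn2r (n := 2)) ?nnegrE ?sqrtr_ge0//.
by rewrite sqr_sqrtr ?divr_ge0 ?(ltW l0)// ltr_pdivrMr// mulrC.
Qed.

(** * Operators and forcing built from the equation data *)

Section theorem_data.
Context {R : realType}.
Variables (beta : R) (A : {fset nat * nat * nat}) (J : {fset nat}).
Variables (Q RD : {poly R[i]}) (Rl : nat * nat * nat -> {poly R[i]}).
Variables (Al : nat * nat * nat -> R -> R[i]) (Cl : nat * nat * nat -> R) (Fj : nat -> R -> R[i]) (Cj : nat -> R).
Hypothesis RD0 : forall m : R, RD.[0 +i* m] != 0.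
Hypothesis deg_Rl : forall l, l \in A -> (size (Rl l) <= size RD)%N.
Hypothesis dAl : forall l, l \in A -> dominated beta (Cl l) (Al l).
Hypothesis dFj : forall j, j \in J -> dominated beta (Cj j) (Fj j).

Lemma borel_op_bounded_linear b : 0 < b -> b < beta ->
  exists2 M : nat * nat * nat -> R, forall l, 0 <= M l &
    forall l, l \in enum_fset A -> bounded_linear b (M l) (borel_op RD Rl Al l).
Proof.
move=> b0 bb.
have H l : exists M : R, 0 <= M /\ (l \in A -> bounded_linear b M (borel_op RD Rl Al l)).
  have [lA|lA] := boolP (l \in A); last by exists 0.
  have [M M0 HM] := bounded_linear_wconv RD0 (deg_Rl lA) b0 bb (dAl lA).
  by exists M.
by have [M HM] := choice H; exists M => [l|l lA]; have [M0] := HM l => // /(_ lA).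
Qed.

Lemma borel_forcing_dominated : exists CF : R, forall p, dominated beta CF (borel_forcing J RD Fj p).
Proof.
have [c c0 Hc] := poly_lower RD0.
have [L [L0 HL]] : exists L : R, 0 <= L /\
    (forall j, j \in enum_fset J -> dominated beta L (fun m => (RD.[0 +i* m])^-1 * Fj j m)).
  apply: (seq_ub (P := fun j L => dominated beta L (fun m => (RD.[0 +i* m])^-1 * Fj j m))) => [j L L' dL LL'|j jJ].
    exact: dominated_weaken dL _ LL'.
  exists (c^-1 * Cj j); apply: dominatedM (dFj jJ); first by apply: cmeasV => //; exact: cmeas_horner.
  move=> m; have cR : c <= normc RD.[0 +i* m].
    by apply: le_trans (Hc m); rewrite ler_peMr ?(ltW c0)// exprn_ege1// lerDl.
  by rewrite normcV lef_pV2 ?posrE// (lt_le_trans c0).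
exists L => p; rewrite /borel_forcing; have [pJ|pJ] := boolP (p \in J); first exact: HL.
by split; [exact: cmeas_cst|move=> m; rewrite normc0 mulr_ge0// expw_ge0].
Qed.

End theorem_data.

Theorem theorem1 (R : realType) (q : R) (k : nat) (beta mu : R)
  (hq : 1 < q) (hk : (1 <= k)%N) (hbeta : 0 < beta) (hmu : 1 < mu)
  (A : {fset nat * nat * nat})
  (hA_pos : forall l, l \in A ->
    [/\ (1 <= ell0 l)%N, (1 <= ell1 l)%N & (1 <= ell2 l)%N])
  (hA : forall l, l \in A ->
    (ell1 l)%:R <= (ell0 l)%:R / k%:R - 1 :> R)
  (alphaD : R) (halphaD : 0 < alphaD)
  (dD : nat) (hdD : (1 <= dD)%N)
  (hdD_A : forall l, l \in A -> (2 <= ell2 l)%N ->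
    Num.sqrt (k%:R / ((ell2 l)%:R ^+ 2 - 1)) < dD%:R :> R)
  (Q RD : {poly R[i]}) (Rl : nat * nat * nat -> {poly R[i]})
  (hQ : forall m : R, Q.[0 +i* m] != 0)
  (hRD : forall m : R, RD.[0 +i* m] != 0)
  (hdeg_Rl : forall l, l \in A -> (size (Rl l) <= size RD)%N)
  (hdeg : size RD = size Q)
  (r1 r2 : R) (hr1 : 0 < r1) (hr12 : r1 < r2)
  (hr : forall m : R,
    r1 <= normc (Q.[0 +i* m] / RD.[0 +i* m]) <= r2)
  (J : {fset nat}) (hJ : forall j, j \in J -> (1 <= j)%N)
  (* geometric configuration *)
  (theta : R) (htheta : 0 < theta < pi / 2)
  (U : set R[i])
  (hU_sector : exists dU deltaU : R, 0 < deltaU /\ U = sector dU deltaU)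
  (hU : U `<=` sector 0 (pi - theta))
  (C0 K0 K1 : R) (hC0 : 0 < C0) (hK0 : 0 < K0) (hK1 : 0 < K1)
  (hexp_disc : forall z : R[i],
    normc z <= Num.sqrt q / (q - 1) -> C0 <= normc (exp_q q z))
  (hexp_U : forall z : R[i],
    U z -> Num.sqrt q / (q - 1) <= normc z ->
    sin theta / K0 * expR (mu_q q (normc z)) <= normc (exp_q q z)
      <= K1 * expR (mu_q q (normc z)))
  (d deltaS : R) (hdeltaS : 0 < deltaS)
  (alphaDt : R)
  (halphaDt : alphaDt =
    alphaD * q `^ (- ((dD * dD.-1)%:R / (2 * k%:R))))
  (hS : forall tau : R[i], sector d deltaS tau -> U (alphaDt%:C * tau ^+ dD))
  (rho : R) (hrho : 0 < rho)
  (hrho_disc : forall tau : R[i], normc tau < rho ->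
    normc (alphaDt%:C * tau ^+ dD) < Num.sqrt q / (q - 1))
  (hr2 : r2 < Num.min C0
    (sin theta / K0 *
      inf [set expR (mu_q q x) | x in [set x : R | Num.sqrt q / (q - 1) <= x]])) :
  exists varpi_c varpi_f : R, [/\ 0 < varpi_c, 0 < varpi_f &
    forall (Al : nat * nat * nat -> R -> R[i]) (Cl : nat * nat * nat -> R)
           (Fj : nat -> R -> R[i]) (Cj : nat -> R),
      (forall l, l \in A -> continuous (Al l) /\ exp_decay beta mu (Cl l) (Al l)) ->
      (forall j, j \in J -> continuous (Fj j) /\ exp_decay beta mu (Cj j) (Fj j)) ->
      (forall l, l \in A -> Cl l <= varpi_c) ->
      (forall j, j \in J -> Cj j <= varpi_f) ->
      exists u : nat -> R[i] -> R[i],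
        [/\ formal_solution q k beta A alphaD dD Q RD Rl
              (fun l => inv_fourier (Al l))
              (forcing q k J (fun j => inv_fourier (Fj j))) u,
            (forall z, strip beta z -> u 0%N z = 0) &
            forall beta' : R, 0 < beta' < beta ->
              exists v : nat -> Ob (strip beta'),
                (forall p z, strip beta' z -> v p z = u p z) /\
                Gq_summable q k d v]].
Proof.
(* The geometric ratio [B] and the exponent [al] are chosen after the data [Al] and [Fj], in terms
   of their constants. *)
exists 1, 1; split => // Al Cl Fj Cj hAl hFj _ _.
have mu0 : 0 <= mu by rewrite ltW// (lt_trans ltr01).
have dAl l : l \in A -> dominated beta (Cl l) (Al l).
  by move=> /hAl[]; exact: exp_decay_dominated.
have dFj j : j \in J -> dominated beta (Cj j) (Fj j).
  by move=> /hFj[]; exact: exp_decay_dominated.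
have alpha0 : 0 < alphaDt by rewrite halphaDt mulr_gt0// powR_gt0// (lt_trans ltr01).
have r_gauss l : l \in A -> (1 < ell2 l)%N ->
    k%:R < ((ell2 l)%:R ^+ 2 - 1) * dD%:R ^+ 2 :> R.
  by move=> lA l1; apply: sqrt_lt_gauss => //; exact: hdD_A.
pose pc := borel_pc Q RD; pose T := borel_op RD Rl Al; pose fr := borel_forcing J RD Fj.
pose omega := borel_coef q alphaDt k dD (enum_fset A) T pc fr.
have r20 : 0 < r2 by exact: lt_trans hr12.
move: hr2; rewrite lt_min => /andP[r2C r2I].
have x00 : 0 <= Num.sqrt q / (q - 1) by rewrite divr_ge0 ?sqrtr_ge0// subr_ge0 ltW.
have r21 : r2 < 1.
  apply: (lt_le_trans r2C); rewrite -(normc1 R) -(exp_q0 q); apply: hexp_disc.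
  by rewrite normc0.
have pcr2 m : normc (pc m) <= r2 by case/andP: (hr m).
have c00 : 0 < 1 - r2 by rewrite subr_gt0.
have pc1 m : 1 - r2 <= normc (pc m - 1).
  rewrite normcBC; apply: le_trans (normc_le_dist _ _); rewrite normc1.
  by have := pcr2 m; lra.
have mpc : cmeas pc.
  by apply: cmeasM; [exact: cmeas_horner|apply: cmeasV => //; exact: cmeas_horner].
have [CF dfr] := borel_forcing_dominated hRD dFj.
have fr00 m : fr 0%N m = 0 by rewrite /fr /borel_forcing; case: ifP => // /hJ.
have [J0 fr0] : exists J0, forall p m, (J0 < p)%N -> fr p m = 0.
  exists (\max_(j <- enum_fset J) j)%N => p m Jp; rewrite /fr /borel_forcing; case: ifP => // pJ.
  by move: Jp; rewrite ltnNge (leq_bigmax_seq (F := id) _ pJ).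
(* [omega] is fixed before [b]; letting the majorant alone depend on [b] gives decay at every rate
   below [beta] for one and the same solution. *)
have dom b : 0 < b -> b < beta -> exists K B : R, forall p, dominated b (K * B ^+ p) (omega p).
  move=> b0 bb; have [M M0 TM] := borel_op_bounded_linear hRD hdeg_Rl dAl b0 bb.
  have dfr' p : dominated b CF (fr p) by apply: dominated_weaken (dfr p) _ _ => //; exact: ltW.
  have [K [B [_ _ H]]] := borel_coef_bound hq hk hdD alpha0 hA_pos hA M0 TM mpc c00 pc1 dfr'.
  by exists K, B.
have domega p : decays beta (omega p).
  by move=> b /andP[b0 bb]; have [K [B H]] := dom b b0 bb; exists (K * B ^+ p).
have dT l p : l \in A -> decays beta (T l (omega p)).
  move=> lA b /andP[b0 bb]; have [M M0 TM] := borel_op_bounded_linear hRD hdeg_Rl dAl b0 bb.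
  have [K [B H]] := dom b b0 bb; exists (M l * (K * B ^+ p)).
  by have [TB _ _] := TM l lA; exact: TB.
exists (borel_solution q alphaDt k dD A J Q RD Rl Al Fj); split.
- apply: formal_solution_borel => //.
  + by move=> m; apply/eqP => e; have := pc1 m; rewrite -/pc e normc0; lra.
  + exact: dAl.
  + by move=> j jJ; apply: decays_dominated (dFj j jJ).
- move=> z _; rewrite /borel_solution borel_coef0//.
  by under eq_fun do rewrite mulr0; exact: inv_fourier0.
(* The midpoint leaves room on both sides: below [beta] for the operators, above beta' for the
   inverse transform. *)
move=> beta' /andP[b'0 b'b]; pose b := (beta' + beta) / 2.
have b'lt : beta' < b by rewrite /b; lra.
have bb : b < beta by rewrite /b; lra.
have b0 : 0 < b by exact: lt_trans b'lt.
have [K [B oKB]] := dom b b0 bb.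
exists (fun p => Ob_fourier beta' (fun m => (bweight q k p)%:C * omega p m)); split.
  move=> p z zb; rewrite (Ob_fourierE b'0 b'lt (dominatedZ _ (oKB p))).
  by rewrite /strip_fourier zb.
have [M M0 TM] := borel_op_bounded_linear hRD hdeg_Rl dAl b0 bb.
have dfr' p : dominated b CF (fr p) by apply: dominated_weaken (dfr p) _ _ => //; exact: ltW.
have e00 : 0 < sin theta / K0.
  by rewrite divr_gt0// sin_gt0_pi//; case/andP: htheta => t0 t1; have := pi_gt0 R; lra.
apply: (borel_coef_Gq_summable hq hk hdD alpha0 hA_pos hA r_gauss M0 TM mpc c00 pc1 dfr' fr0 fr00
  e00 r20 hdeltaS hrho b'0 b'lt hexp_disc _ r2C r2I pcr2 hrho_disc) => t St xt.
by have /andP[] := hexp_U _ (hS _ St) xt.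
Qed.
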